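(* For every $n$, let $\sigma_n$ be a random permutation of size $n$, and for every fixed $k$ (and $n\ge k$) let $I_{n,k}$ be a uniform random subset of $[n]$ with $k$ elements, independent of $\sigma_n$. The following assertions are equivalent. (a) $(\mu_{\sigma_n})_n$ converges in distribution, for the weak topology, to some random permuton $\mu$. (b) The random infinite vector $\big(\widetilde{\mathrm{occ}}(\pi,\sigma_n)\big)_{\pi\in\mathfrak S}$ converges in distribution, in the product topology, to some random infinite vector $(\Lambda_\pi)_{\pi\in\mathfrak S}$. (c) For every $\pi\in\mathfrak S$ there is $\Delta_\pi\ge0$ such that $\mathbb E[\widetilde{\mathrm{occ}}(\pi,\sigma_n)]\to\Delta_\pi$ as $n\to\infty$. (d) For every $k$, the sequence $\big(\mathrm{pat}_{I_{n,k}}(\sigma_n)\big)_n$ of random permutations converges in distribution to some random permutation $\rho_k$. Moreover, whenever these assertions hold, $(\Lambda_\pi)_{\pi}\stackrel{d}{=}(\widetilde{\mathrm{occ}}(\pi,\mu))_\pi$ and, for every $k$ and every $\pi\in\mathfrak S_k$, $$\mathbb P(\rho_k=\pi)=\Delta_\pi=\mathbb E[\Lambda_\pi]=\mathbb E[\widetilde{\mathrm{occ}}(\pi,\mu)]=\mathbb P\big(\mathrm{Perm}(\vec{\mathbf m}_k,\mu)=\pi\big).$$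
   Context: $\mathfrak S_n$ is the set of permutations of $[n]=\{1,\dots,n\}$ and $\mathfrak S=\bigcup_{n\ge1}\mathfrak S_n$. For $\sigma\in\mathfrak S_n$ and $I\subset[n]$ with $|I|=k$, $\mathrm{pat}_I(\sigma)\in\mathfrak S_k$ is the permutation in the same relative order as $(\sigma(i))_{i\in I}$. For $\pi\in\mathfrak S_k$ and $\sigma\in\mathfrak S_n$, $\widetilde{\mathrm{occ}}(\pi,\sigma)=\binom nk^{-1}\#\{I\subset[n]:|I|=k,\ \mathrm{pat}_I(\sigma)=\pi\}$ (for $n<k$, use the convention $\widetilde{\mathrm{occ}}(\pi,\sigma)=0$; this is irrelevant for limits). A permuton is a probability measure on $[0,1]^2$ whose two marginals are Lebesgue measure on $[0,1]$; the set of permutons has the topology of weak convergence, which is compact and metrizable. A random permuton is a random variable with values in this space. To $\sigma\in\mathfrak S_n$ one associates the permuton $\mu_\sigma$ with density $n\mathbf 1_{\sigma(\lceil xn\rceil)=\lceil yn\rceil}$. For a (random) permuton $\mu$, $\vec{\mathbf m}_k$ denotes a sequence of $k$ points of $[0,1]^2$ which, conditionally on $\mu$, are independent with common law $\mu$. $\mathrm{Perm}(\vec{\mathbf m}_k,\mu)\in\mathfrak S_k$ is the a.s. well-defined random permutation in the same relative order as the $y$-coordinates of these points when they are sorted by increasing $x$-coordinate. For a deterministic permuton $\mu$ and $\pi\in\mathfrak S_k$, $\widetilde{\mathrm{occ}}(\pi,\mu)=\mathbb P(\mathrm{Perm}(\vec{\mathbf m}_k,\mu)=\pi)$; for a random permuton,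 $\widetilde{\mathrm{occ}}(\pi,\mu)$ is the corresponding random variable (a measurable function of $\mu$). *)

(* Defs.v *)
From HB Require Import structures.
From mathcomp Require Import all_boot all_order all_algebra all_fingroup.
From mathcomp Require Import all_classical all_reals all_analysis.
From mathcomp Require Import measurable_realfun.

Set Implicit Arguments.
Unset Strict Implicit.
Unset Printing Implicit Defensive.
Import Order.TTheory GRing.Theory Num.Theory.
Import numFieldNormedType.Exports.

Local Open Scope classical_set_scope.
Local Open Scope ring_scope.

Definition borel (S : ptopologicalType) := g_sigma_algebraType (@open S).

HB.instance Definition _ (S : ptopologicalType) := Measurable.on (borel S).

(* Each [X n] may live on its own probability space. *)
Definition cvg_in_dist (R : realType) (S : ptopologicalType)
    (d : nat -> measure_display) (Om : forall n, measurableType (d n))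
    (P : forall n, probability (Om n) R) (X : forall n, {RV (P n) >-> borel S})
    (d' : measure_display) (Om' : measurableType d') (P' : probability Om' R)
    (Y : {RV P' >-> borel S}) : Prop :=
  forall f : S -> R, continuous f -> (exists M, forall s, `|f s| <= M) ->
  ('E_(P n)[fun w => f (X n w)] @[n --> \oo] --> 'E_P'[fun w => f (Y w)])%E.
Arguments cvg_in_dist {R S d Om} P X {d' Om'} P' Y.

Definition eq_dist (R : realType) d (T : measurableType d)
    d1 (Om1 : measurableType d1) (P1 : probability Om1 R) (X : Om1 -> T)
    d2 (Om2 : measurableType d2) (P2 : probability Om2 R) (Y : Om2 -> T) : Prop :=
  forall B, measurable B -> pushforward P1 X B = pushforward P2 Y B.
Arguments eq_dist {R d T d1 Om1} P1 X {d2 Om2} P2 Y.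

HB.instance Definition _ (I : Type) (T : I -> ptopologicalType) :=
  isPointed.Build (prod_topology T) (fun=> point).

HB.instance Definition _ (T : finType) :=
  isPointed.Build (perm_type T) (1%g : {perm T}).
HB.instance Definition _ (T : finType) :=
  hasNbhs.Build (perm_type T) principal_filter.
HB.instance Definition _ (T : finType) :=
  Discrete_ofNbhs.Build (perm_type T) erefl.

HB.instance Definition _ (T : finType) :=
  isPointed.Build (finset.set_type T) (finset.set0 : {set T}).
HB.instance Definition _ (T : finType) :=
  hasNbhs.Build (finset.set_type T) principal_filter.
HB.instance Definition _ (T : finType) :=
  Discrete_ofNbhs.Build (finset.set_type T) erefl.

(* Every function on a discrete space is continuous, so that composing with a
   random element of a discrete space always yields a random element. *)
Section discrete_comp.
Context (R : realType) d (Om : measurableType d) (P : probability Om R).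
Context (T : pdiscreteTopologicalType) (S : ptopologicalType).
Variables (g : T -> S) (X : {RV P >-> borel T}).

Definition discrete_comp (w : Om) : borel S := g (X w).

Let discrete_comp_measurable : measurable_fun setT discrete_comp.
Proof.
move=> _ B _; rewrite setTI.
rewrite (_ : discrete_comp @^-1` B = X @^-1` (g @^-1` B))//.
rewrite -[_ @^-1` _]setTI; apply: measurable_funP => //.
by apply: sub_sigma_algebra; exact: discrete_open.
Qed.

HB.instance Definition _ := isMeasurableFun.Build _ _ Om (borel S)
  discrete_comp discrete_comp_measurable.

End discrete_comp.

Definition independent_rv (R : realType) d (Om : measurableType d)
    (P : probability Om R) d1 (T1 : measurableType d1)
    d2 (T2 : measurableType d2) (X : {RV P >-> T1}) (Y : {RV P >-> T2}) : Prop :=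
  forall A B, measurable A -> measurable B ->
  P (X @^-1` A `&` Y @^-1` B) = (P (X @^-1` A) * P (Y @^-1` B))%E.
Arguments independent_rv {R d Om} P {d1 T1 d2 T2} X Y.

(* The permutation in the same relative order as [v]; it exists and is unique
   when the values of [v] are distinct, and the default value is irrelevant. *)
Definition std (disp : Order.disp_t) (T : orderType disp) (k : nat)
    (v : 'I_k -> T) : 'S_k :=
  odflt 1%g
    [pick s : 'S_k | [forall i, forall j, (s i < s j)%N == (v i < v j)%O]].

(* [enum I] lists [I] increasingly; meaningful when [#|I| = k]. *)
Definition pat (k n : nat) (I : {set 'I_n}) (s : 'S_n) : 'S_k :=
  std (fun i : 'I_k => nth 0%N [seq val (s j) | j <- enum I] i).

(* For [n < k] this is [0 / 0 = 0]. *)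
Definition occ (R : realType) (k n : nat) (p : 'S_k) (s : 'S_n) : R :=
  #|[set I : {set 'I_n} | (#|I| == k) && (pat k I s == p)]%SET|%:R
  / 'C(n, k)%:R.

(* All permutations of positive size. *)
Definition perms := {k : nat & 'S_k.+1}.

Definition occ_vec (R : realType) (n : nat) (s : 'S_n) : {ptws perms -> R} :=
  fun p => occ R (projT2 p) s.

Definition uniform_subset (R : realType) d (Om : measurableType d)
    (P : probability Om R) (n k : nat) (I : {RV P >-> borel {set 'I_n}}) : Prop :=
  forall A : {set 'I_n},
    P (I @^-1` [set A]) = (if #|A| == k then 'C(n, k)%:R^-1 else 0)%:E.
Arguments uniform_subset {R d Om} P {n} k I.

Section random_pat.
Context (R : realType) d (Om : measurableType d) (P : probability Om R).
Context (k n : nat).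
Variables (I : {RV P >-> borel {set 'I_n}}) (s : {RV P >-> borel 'S_n}).

Definition random_pat (w : Om) : borel 'S_k := pat k (I w) (s w).

Let random_pat_measurable : measurable_fun setT random_pat.
Proof.
move=> _ B _; rewrite setTI.
rewrite (_ : random_pat @^-1` B = \bigcup_(A in [set: {set 'I_n}])
    (I @^-1` [set A] `&` s @^-1` [set x | B (pat k A x)])).
  apply: fin_bigcup_measurable => [|A _]; first exact: finite_finset.
  apply: measurableI; rewrite -[_ @^-1` _]setTI; apply: measurable_funP => //;
    by apply: sub_sigma_algebra; exact: discrete_open.
apply/seteqP; split => [w Bw|w [A _ [/= <-]]//].
by exists (I w).
Qed.

HB.instance Definition _ := isMeasurableFun.Build _ _ Om (borel 'S_k)
  random_pat random_pat_measurable.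

End random_pat.

Section Permuton.
Variable R : realType.

Definition unit_square : set (R * R) := `[0, 1]%classic `*` `[0, 1]%classic.

(* The marginal conditions force the measure to be carried by the unit square. *)
Record permuton := Permuton {
  permuton_prob :> probability (R * R)%type R;
  permuton_fst : forall A : set R, measurable A ->
    pushforward permuton_prob fst A = lebesgue_measure (A `&` `[0, 1]%classic);
  permuton_snd : forall A : set R, measurable A ->
    pushforward permuton_prob snd A = lebesgue_measure (A `&` `[0, 1]%classic) }.

(* Values outside the unit square play no role. *)
Definition test_fun := {f : R * R -> R | {within unit_square, continuous f}}.

Definition permuton_eval (mu : permuton) : {ptws test_fun -> R} :=
  fun f => \int[mu]_(z in unit_square) sval f z.

(* The weak topology.  A library measure is also a function on non-measurable
   sets; two permutons that agree on all measurable sets are topologically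
   indistinguishable here, hence not separated by the Borel sigma-algebra. *)
HB.instance Definition _ := gen_eqMixin permuton.
HB.instance Definition _ := gen_choiceMixin permuton.
HB.instance Definition _ :=
  Topological.copy permuton (initial_topology permuton_eval).

Section perm_permuton.
Variables (n : nat) (s : {perm 'I_n.+1}).
Local Notation N := (n.+1%:R : R).

(* The permutation has size n.+1, and [i : 'I_n.+1] stands for the element [i.+1]
   of {1, ..., n.+1}. *)
Definition perm_density (z : R * R) : R :=
  N * [exists i : 'I_n.+1, (Num.ceil (z.1 * N) == i.+1%:Z)
                        && (Num.ceil (z.2 * N) == (s i).+1%:Z)]%:R.

Local Notation leb2 := (@lebesgue_measure R \x @lebesgue_measure R)%E.

Definition perm_measure (A : set (R * R)) : \bar R :=
  (\int[leb2]_(z in A) (perm_density z)%:E)%E.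

Let J (i : 'I_n.+1) : set R := `]i%:R / N, i.+1%:R / N]%classic.

Let N0 : 0 < N. Proof. by rewrite ltr0n. Qed.

Let ceilJ (x : R) (i : 'I_n.+1) :
  (Num.ceil (x * N) == i.+1%:Z) = (x \in J i).
Proof.
have -> : (x \in J i) = (i%:R / N < x <= i.+1%:R / N).
  by apply/idP/idP; rewrite inE /J/= in_itv.
rewrite ceil_eq ltr_pdivrMr// ler_pdivlMr//.
by rewrite (_ : i.+1%:Z - 1 = i%:Z)// -addn1 PoszD addrK.
Qed.

Let J_inj (x : R) (i j : 'I_n.+1) : x \in J i -> x \in J j -> i = j.
Proof.
by rewrite -!ceilJ => /eqP -> /eqP [] /ord_inj.
Qed.

Let sq i : set (R * R) := J i `*` J (s i).

Let perm_densityE z : perm_density z = \sum_i N * \1_(sq i) z.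
Proof.
rewrite -mulr_sumr /perm_density; congr (_ * _).
case: existsP => [[i]|H].
- rewrite !ceilJ => /andP[i1 i2].
  rewrite (bigD1 i)//= big1 ?addr0.
    by rewrite indicE mem_set//; split; exact/set_mem.
  move=> j ji; rewrite indicE memNset// => -[/mem_set j1 _].
  by move/eqP: ji; apply; exact: J_inj j1 i1.
- rewrite big1// => i _; rewrite indicE memNset// => -[i1 i2].
  by apply: H; exists i; rewrite !ceilJ !mem_set.
Qed.

Let mJ i : measurable (J i). Proof. exact: measurable_itv. Qed.

Let msq i : measurable (sq i). Proof. exact: measurableX. Qed.

Let density_ge0 z : (0 <= (perm_density z)%:E)%E.
Proof. by rewrite lee_fin mulr_ge0// ler0n. Qed.

Let perm_measureE (A : set (R * R)) : measurable A ->
  perm_measure A = (\sum_i N%:E * leb2 (A `&` sq i))%E.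
Proof.
move=> mA; rewrite /perm_measure.
under eq_integral do rewrite perm_densityE -sumEFin.
rewrite ge0_integral_sum//=.
- apply: eq_bigr => i _; under eq_integral do rewrite EFinM.
  rewrite ge0_integralZl//=; last first.
  + by apply/measurable_EFinP; apply: measurable_indic; exact: msq.
  + by rewrite integral_indic// 1?setIC//; exact: msq.
- move=> i; apply/measurable_EFinP; apply: measurable_funM => //.
  by apply: measurable_indic; exact: msq.
Qed.

Let perm_measure0 : perm_measure set0 = 0%E.
Proof. by rewrite /perm_measure integral_set0. Qed.

Let perm_measure_ge0 A : (0 <= perm_measure A)%E.
Proof. by apply: integral_ge0 => z _; exact: density_ge0. Qed.
Let measurable_density D :
  measurable_fun D (perm_density : measurableTypeR R * measurableTypeR R -> R).
Proof.
rewrite (_ : perm_density = fun z => \sum_i N * \1_(sq i) z); last first.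
  by apply/funext => z; rewrite perm_densityE.
apply: measurable_sum => i; apply: measurable_funM => //.
by apply: measurable_indic; exact: msq.
Qed.

Let perm_measure_sigma_additive : semi_sigma_additive perm_measure.
Proof.
move=> F mF tF mUF; rewrite /perm_measure; apply: cvg_toP.
  apply: ereal_nondecreasing_is_cvgn => m k mk.
  apply: lee_sum_nneg_natr => // j _ _.
  by apply: integral_ge0 => z _; exact: density_ge0.
rewrite ge0_integral_bigcup//=.
apply/measurable_EFinP; exact: measurable_density.
Qed.

Let lebJ i : (@lebesgue_measure R (J i) = (N^-1)%:E)%E.
Proof.
rewrite /J lebesgue_measure_itv/= lte_fin ltr_pM2r ?invr_gt0// ltr_nat ltnSn.
by rewrite -EFinD -mulrBl -natrB// subSnn mul1r.
Qed.
Let sumJ (A : set R) : measurable A ->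
  (\sum_i @lebesgue_measure R (A `&` J i))%E =
  lebesgue_measure (A `&` `[0, 1]%classic).
Proof.
move=> mA; rewrite -measure_bigsetU_ord//; last 2 first.
- move=> i; apply: (@measurableI _ (measurableTypeR R)); [exact: mA|exact: mJ].
- move=> i j _ _ [x [[_ /mem_set xi] [_ /mem_set xj]]]; exact: J_inj xi xj.
have -> : \big[setU/set0]_(i < n.+1) (A `&` J i) = A `&` `]0, 1]%classic.
  rewrite -bigcup_seq; apply/seteqP; split => x /=.
    move=> [i _ [Ax]]; rewrite /J/= !in_itv/= => /andP[ix xi]; split=> //.
    rewrite (le_lt_trans _ ix) ?divr_ge0//= (le_trans xi)//.
    by rewrite ler_pdivrMr// mul1r ler_nat ltn_ord.
  rewrite in_itv/= => -[Ax /andP[x0 x1]].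
  have c0 : (0 < Num.ceil (x * N)) by rewrite ceil_gt0 mulr_gt0.
  have cN : (Num.ceil (x * N) <= n.+1%:Z).
    by rewrite ceil_le_int -pmulrn ler_piMl.
  case cE: (Num.ceil (x * N)) c0 cN => [[//|m]|//] _.
  rewrite lez_nat => mn; exists (Ordinal mn) => /=; first by rewrite mem_index_enum.
  by split=> //; apply: set_mem; rewrite -ceilJ cE.
rewrite (_ : `[0, 1]%classic = [set 0] `|` `]0, 1]%classic); last first.
  apply/seteqP; split => x /=; rewrite !in_itv/=.
    by move=> /andP[]; rewrite le_eqVlt => /predU1P[-> _|-> ->]; [left|right].
  by move=> [->|/andP[x0 ->]]; rewrite ?lexx ?ler01// ltW.
rewrite setIUr.
have mA' : @measurable _ (measurableTypeR R) A by exact: mA.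
have A0 : lebesgue_measure (A `&` [set 0]) = 0%E.
  apply: (@subset_measure0 _ _ _ lebesgue_measure _ [set 0]) => //.
  - exact: measurableI.
  - exact: lebesgue_measure_set1.
rewrite measureU//=.
- by rewrite -[LHS]add0e -A0.
- exact: measurableI.
- exact: measurableI.
- by apply/seteqP; split => x//= [[_ ->] [_]]; rewrite in_itv/= ltxx.
Qed.

Let leb2E (A B : set R) : measurable A -> measurable B ->
  leb2 (A `*` B) = (@lebesgue_measure R A * @lebesgue_measure R B)%E.
Proof. by move=> mA mB; exact: product_measure1E. Qed.

Let fstE (A : set R) : measurable A ->
  perm_measure (fst @^-1` A) = lebesgue_measure (A `&` `[0, 1]%classic).
Proof.
move=> mA; rewrite perm_measureE; last first.
  by rewrite -[fst @^-1` A]setTI; exact: measurable_fst.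
rewrite -sumJ//; apply: eq_bigr => i _.
rewrite (_ : fst @^-1` A `&` sq i = (A `&` J i) `*` J (s i)); last first.
  by apply/seteqP; split => -[x y]/=; [move=> [? []]|move=> [[? ?] ?]].
rewrite leb2E//; last exact: measurableI.
by rewrite lebJ muleCA -EFinM divff ?mule1// gt_eqF.
Qed.

Let sndE (A : set R) : measurable A ->
  perm_measure (snd @^-1` A) = lebesgue_measure (A `&` `[0, 1]%classic).
Proof.
move=> mA; rewrite perm_measureE; last first.
  by rewrite -[snd @^-1` A]setTI; exact: measurable_snd.
rewrite -sumJ// [RHS](reindex_inj (@perm_inj _ s))/=; apply: eq_bigr => i _.
rewrite (_ : snd @^-1` A `&` sq i = J i `*` (A `&` J (s i))); last first.
  by apply/seteqP; split => -[x y]/=; [move=> [? []]|move=> [? [? ?]]].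
rewrite leb2E//; last exact: measurableI.
by rewrite lebJ muleA -EFinM divff ?mul1e// gt_eqF.
Qed.

HB.instance Definition _ := isMeasure.Build _ (R * R)%type R perm_measure
  perm_measure0 perm_measure_ge0 perm_measure_sigma_additive.

Let perm_measureT : perm_measure setT = 1%E.
Proof.
rewrite -[setT](preimage_setT fst) fstE// setTI lebesgue_measure_itv/=.
by rewrite lte_fin ltr01 oppr0 adde0.
Qed.

HB.instance Definition _ :=
  Measure_isProbability.Build _ (R * R)%type R perm_measure perm_measureT.

Definition perm_permuton : permuton := @Permuton perm_measure fstE sndE.
End perm_permuton.

HB.instance Definition _ := isPointed.Build permuton (@perm_permuton 0 1%g).
End Permuton.

Section tuple_cons.
Context d (T : measurableType d) (k : nat).

Definition tuple_cons (z : T * k.-tuple T) : k.+1.-tuple T :=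
  [the k.+1.-tuple T of z.1 :: z.2].

Let tuple_cons_measurable : measurable_fun setT tuple_cons.
Proof. exact: measurable_cons. Qed.

HB.instance Definition _ := isMeasurableFun.Build _ _ (T * k.-tuple T)%type
  (k.+1.-tuple T) tuple_cons tuple_cons_measurable.

End tuple_cons.

(* The law of [k] independent points with law [P]. *)
Fixpoint power_prob (R : realType) d (T : measurableType d)
    (P : probability T R) (k : nat) : probability (k.-tuple T) R :=
  match k with
  | 0 => \d_([tuple] : 0.-tuple T)
  | k'.+1 => distribution (P \x power_prob P k')%E (@tuple_cons _ T k')
  end.

(* Relative order of the second coordinates, once the points are sorted by
   increasing first coordinate; arbitrary if two points share a coordinate. *)
Definition perm_of_points (R : realType) (k : nat) (m : k.-tuple (R * R)) : 'S_k :=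
  std (fun i : 'I_k =>
    (nth (0, 0) (sort (fun x y : R * R => x.1 <= y.1) m) i).2).

Definition occ_permuton (R : realType) (k : nat) (p : 'S_k) (mu : permuton R) : R :=
  fine (power_prob mu k [set m | perm_of_points m = p]).

Definition occ_permuton_vec (R : realType) (mu : permuton R) : {ptws perms -> R} :=
  fun p => occ_permuton (projT2 p) mu.

(* Conditionally on [mu], the points [m i] are independent with law [mu]. *)
Definition cond_iid (R : realType) d (Om : measurableType d)
    (P : probability Om R) (mu : {RV P >-> borel (permuton R)}) (k : nat)
    (m : 'I_k -> {RV P >-> (R * R)%type}) : Prop :=
  forall (B : set (borel (permuton R))) (A : 'I_k -> set (R * R)),
    measurable B -> (forall i, measurable (A i)) ->
  P (mu @^-1` B `&` \bigcap_(i in [set: 'I_k]) (m i @^-1` A i)) =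
    (\int[P]_(w in mu @^-1` B) \prod_(i < k) (mu w : permuton R) (A i))%E.
Arguments cond_iid {R d Om} P mu {k} m.

(* Main.v *)
Require Import Defs.
From HB Require Import structures.
From mathcomp Require Import all_boot all_order all_algebra all_fingroup.
From mathcomp Require Import all_classical all_reals all_analysis.
From mathcomp Require Import measurable_realfun ring lra zify.
Import Order.TTheory GRing.Theory Num.Theory.
Import numFieldNormedType.Exports.
Local Open Scope classical_set_scope.
Local Open Scope ring_scope.
Set Implicit Arguments.
Unset Strict Implicit.
Unset Printing Implicit Defensive.

(** A continuous functional of a permuton is almost determined by finitely many
    values of the distribution function ([permuton_modulus]), and everything
    rests on three comparisons that are uniform over permutations.

    - A large random pattern of a permutation is close to it as a permuton
      ([sampling_average], [sampling_uniform]): at the points of a fixed grid,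
      distribution functions of permutations are proportions of sets of
      positions, and the proportion seen in a uniform subset has a variance at
      most equal to the inverse of the size of the subset ([second_moment]).

    - The density of a pattern in a permuton is a continuous functional of the
      permuton ([continuous_occ_permuton]): up to a uniform error it can be read
      on a fine grid, because the uniform marginals make it unlikely that two
      sampled points share a row or a column ([grid_occ_approx]).

    - The densities of a pattern in a permutation and in its permuton differ by
      the effect of sampling with or without replacement, which vanishes with the
      size ([occ_permuton_perm]).

    Convergence of the random permutons gives convergence of the vectors of
    pattern densities by continuity ([occ_vec_cvg]). This gives the convergence
    of the expected densities, because densities are bounded. The expected
    densities are the probabilities of the patterns of a uniform subset
    ([prb_random_pat]), so their limits form the law of a random permutation
    ([occ_cvg_pattern]). Finally, if random patterns of every size converge in
    law, then the expectation of any continuous functional of the permuton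
    converges: it can be replaced with the expectation of the functional at a
    large pattern ([patterns_to_permuton]).

    The existence of the limiting random permuton is the compactness of the space
    of laws on a compact metrizable space. It is obtained by coding permutons by
    infinite binary words: along an ultrafilter the probabilities of the prefixes
    converge, the limits are the prefix probabilities of a random word built from
    a uniform variable ([unif_word]), and that word is almost surely the code of
    a permuton ([coding_limit]). The same coding of the unit square yields the
    compactness of the space of permutons itself ([permuton_compact]).

    The identities between the limits follow from the uniqueness of limits: the
    law of a random vector is determined by the expectations of bounded
    continuous functions ([vector_law_unique]), and the expected density in a
    random permuton is the probability that conditionally independent points
    have the given relative order ([cond_iid_occ]). *)

(** * Expectations of bounded random variables *)

Section Expectation.
Context (R : realType) d (Om : measurableType d) (P : probability Om R).

Definition bmeas (f : Om -> R) : Prop :=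
  measurable_fun setT f /\ exists M, forall w, `|f w| <= M.

Lemma bmeas_integrable f : bmeas f -> P.-integrable setT (EFin \o f).
Proof.
move=> [mf [M fM]]; apply: measurable_bounded_integrable => //.
  by rewrite [X in (X < _)%E](@probability_setT _ _ _ P) ltry.
exists M; split; first exact: num_real.
by move=> x Mx w _ /=; rewrite (le_trans (fM w))// ltW.
Qed.

Lemma expectationE f : bmeas f -> 'E_P[f]%E = (\int[P]_w f w)%:E.
Proof.
move=> bf; rewrite unlock /Rintegral fineK//.
by apply: integrable_fin_num => //; exact: bmeas_integrable.
Qed.

Lemma bmeas_cst c : bmeas (fun=> c).
Proof. by split; [exact: measurable_cst|exists `|c|]. Qed.

Lemma bmeasD f g : bmeas f -> bmeas g -> bmeas (fun w => f w + g w).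
Proof.
move=> [mf [M fM]] [mg [M' gM]]; split; first exact: measurable_funD.
by exists (M + M') => w; rewrite (le_trans (ler_normD _ _))// lerD.
Qed.

Lemma bmeasB f g : bmeas f -> bmeas g -> bmeas (fun w => f w - g w).
Proof.
move=> [mf [M fM]] [mg [M' gM]]; split; first exact: measurable_funB.
by exists (M + M') => w; rewrite (le_trans (ler_normB _ _))// lerD.
Qed.

Lemma bmeasM f g : bmeas f -> bmeas g -> bmeas (fun w => f w * g w).
Proof.
move=> [mf [M fM]] [mg [M' gM]]; split; first exact: measurable_funM.
by exists (M * M') => w; rewrite normrM ler_pM.
Qed.

Lemma bmeas_sum (I : Type) (s : seq I) (f : I -> Om -> R) :
  (forall i, bmeas (f i)) -> bmeas (fun w => \sum_(i <- s) f i w).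
Proof.
move=> bf; elim: s => [|i s IH].
  by under eq_fun do rewrite big_nil; exact: bmeas_cst.
by under eq_fun do rewrite big_cons; exact: bmeasD.
Qed.

Lemma bmeas_prod (I : Type) (s : seq I) (f : I -> Om -> R) :
  (forall i, bmeas (f i)) -> bmeas (fun w => \prod_(i <- s) f i w).
Proof.
move=> bf; elim: s => [|i s IH].
  by under eq_fun do rewrite big_nil; exact: bmeas_cst.
by under eq_fun do rewrite big_cons; exact: bmeasM.
Qed.

Lemma bmeas_indic A : measurable A -> bmeas (\1_A).
Proof.
move=> mA; split; first exact: measurable_indic.
by exists 1 => w; rewrite indicE; case: (_ \in _); rewrite ?normr1 ?normr0.
Qed.

Lemma Rint_indic A : measurable A -> \int[P]_w \1_A w = fine (P A).
Proof. by move=> mA; rewrite /Rintegral integral_indic// setIT. Qed.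

Lemma RintD f g : bmeas f -> bmeas g ->
  \int[P]_w (f w + g w) = \int[P]_w f w + \int[P]_w g w.
Proof. by move=> /bmeas_integrable bf /bmeas_integrable bg; rewrite RintegralD. Qed.

Lemma RintB f g : bmeas f -> bmeas g ->
  \int[P]_w (f w - g w) = \int[P]_w f w - \int[P]_w g w.
Proof. by move=> /bmeas_integrable bf /bmeas_integrable bg; rewrite RintegralB. Qed.

Lemma RintZ c f : bmeas f -> \int[P]_w (c * f w) = c * \int[P]_w f w.
Proof. by move=> /bmeas_integrable bf; rewrite RintegralZl. Qed.

Lemma Rint_cst c : \int[P]_w c = c.
Proof. by rewrite Rintegral_cst// [X in fine X](@probability_setT _ _ _ P)/= mulr1. Qed.

Lemma Rint_sum (I : Type) (s : seq I) (f : I -> Om -> R) :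
  (forall i, bmeas (f i)) ->
  \int[P]_w (\sum_(i <- s) f i w) = \sum_(i <- s) \int[P]_w f i w.
Proof.
move=> bf; elim: s => [|i s IH].
  by under eq_Rintegral do rewrite big_nil; rewrite Rint_cst big_nil.
under eq_Rintegral do rewrite big_cons.
by rewrite RintD ?IH ?big_cons//; exact: bmeas_sum.
Qed.

Lemma Rint_le f g : bmeas f -> bmeas g -> (forall w, f w <= g w) ->
  \int[P]_w f w <= \int[P]_w g w.
Proof.
by move=> /bmeas_integrable bf /bmeas_integrable bg fg; rewrite le_Rintegral.
Qed.

Lemma Rint_dist f g (e : R) : bmeas f -> bmeas g -> (forall w, `|f w - g w| <= e) ->
  `|\int[P]_w f w - \int[P]_w g w| <= e.
Proof.
move=> bf bg fge; rewrite -RintB//.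
have bfg := bmeasB bf bg.
rewrite ler_norml; apply/andP; split.
  rewrite -[- e]Rint_cst; apply: Rint_le => // [|w]; first exact: bmeas_cst.
  by have := fge w; rewrite ler_norml => /andP[].
rewrite -[e]Rint_cst; apply: Rint_le => // [|w]; first exact: bmeas_cst.
by have := fge w; rewrite ler_norml => /andP[].
Qed.

(** A function of a finitely valued variable is a combination of indicators,
    which turns its expectation into a finite sum. *)
Lemma finvalE (T : finType) (h : Om -> T) (r : T -> R) :
  (fun w => r (h w)) = (fun w => \sum_t r t * \1_(h @^-1` [set t]) w).
Proof.
apply/funext => w; rewrite (bigD1 (h w))//= big1 ?addr0.
  by rewrite indicE mem_set// mulr1.
by move=> t th; rewrite indicE memNset ?mulr0// => /= ht; rewrite ht eqxx in th.
Qed.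

Lemma bmeas_finval (T : finType) (h : Om -> T) (r : T -> R) :
  (forall t, measurable (h @^-1` [set t])) -> bmeas (fun w => r (h w)).
Proof.
move=> mh; rewrite finvalE; apply: bmeas_sum => t; apply: bmeasM.
  exact: bmeas_cst.
exact: bmeas_indic.
Qed.

Lemma Rint_finval (T : finType) (h : Om -> T) (r : T -> R) :
  (forall t, measurable (h @^-1` [set t])) ->
  \int[P]_w r (h w) = \sum_t r t * fine (P (h @^-1` [set t])).
Proof.
move=> mh; rewrite (finvalE h r) Rint_sum; last first.
  by move=> t; apply: bmeasM; [exact: bmeas_cst|exact: bmeas_indic].
apply: eq_bigr => t _; rewrite RintZ; last exact: bmeas_indic.
by rewrite Rint_indic.
Qed.

Lemma measurable_finval (T : finType) (h : Om -> T) (B : set T) :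
  (forall t, measurable (h @^-1` [set t])) -> measurable (h @^-1` B).
Proof.
move=> mh; rewrite [X in measurable X](_ : _ = \bigcup_(t in B) h @^-1` [set t]).
  by apply: fin_bigcup_measurable => //; exact: finite_finset.
by apply/seteqP; split => [w Bw|w [t Bt /= ->]//]; exists (h w).
Qed.

End Expectation.

(** * Random words with prescribed prefix probabilities *)

Section RandomWord.
Variable R : realType.

(** The interval is half-open so that the intervals of the words of a given
    length tile it. *)
Definition unif_meas : set (measurableTypeR R) -> \bar R :=
  mrestr (@lebesgue_measure R) (measurable_itv `[0%R, 1%R[).

HB.instance Definition _ := Measure.on unif_meas.

Lemma unif_measE A : unif_meas A = lebesgue_measure (A `&` `[0%R, 1%R[%classic).
Proof. by []. Qed.

Let unif_measT : unif_meas setT = 1%E.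
Proof.
by rewrite unif_measE setTI lebesgue_measure_itv/= lte_fin ltr01 oppr0 adde0.
Qed.

HB.instance Definition _ :=
  Measure_isProbability.Build _ _ _ unif_meas unif_measT.

Definition unif : probability (measurableTypeR R) R := unif_meas.

Variable p : seq bool -> R.
Hypothesis p_nil : p [::] = 1.
Hypothesis p_ge0 : forall s, 0 <= p s.
Hypothesis p_cons : forall s, p s = p (false :: s) + p (true :: s).

(** Sampling by inversion, one letter at a time: the words of length [m] cut
    [0, 1[ into consecutive intervals of lengths [p s], and [word_left s] is the
    left end of the interval of [s]. *)
Fixpoint word_left (s : seq bool) : R :=
  if s is b :: s' then word_left s' + (if b then p (false :: s') else 0) else 0.

Fixpoint word (u : R) (m : nat) : seq bool :=
  if m is m'.+1 then
    let s := word u m' in (word_left s + p (false :: s) <= u) :: s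
  else [::].

Lemma word_interval u s : 0 <= u < 1 ->
  (word u (size s) == s) = (word_left s <= u < word_left s + p s).
Proof.
move=> u01; elim: s => [|b s IH] /=; first by rewrite add0r p_nil eqxx u01.
rewrite eqseq_cons; have := p_cons s; have := p_ge0 (false :: s).
have := p_ge0 (true :: s).
have [ws|ws] := eqVneq (word u (size s)) s.
  rewrite ws eqxx in IH *; move/esym: IH => /andP[h1 h2] p1 p0 ps; rewrite andbT.
  by case: b => /=; rewrite ?eqb_id ?eqbF_neg -?ltNge; apply/idP/idP; lra.
rewrite (negPf ws) in IH *; move/esym/negbT: IH => IH p1 p0 ps; rewrite andbF; apply/esym/negbTE.
by apply: contra IH; case: b; lra.
Qed.

Lemma measurable_word m s :
  measurable ((fun u : measurableTypeR R => word u m) @^-1` [set s]).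
Proof.
elim: m s => [|m IH] [|b s].
- by rewrite [X in measurable X](_ : _ = setT)//; apply/seteqP; split.
- by rewrite [X in measurable X](_ : _ = set0)//; apply/seteqP; split.
- by rewrite [X in measurable X](_ : _ = set0)//; apply/seteqP; split.
rewrite [X in measurable X](_ : _ =
  (fun u : measurableTypeR R => word u m) @^-1` [set s] `&`
  [set u | (word_left s + p (false :: s) <= u) = b]).
  apply: measurableI => //.
  case: b.
    by rewrite -set_itvcy; exact: measurable_itv.
  rewrite [X in measurable X](_ : _ = `]-oo, word_left s + p (false :: s)[%classic).
    exact: measurable_itv.
  by apply/seteqP; split => u /=; rewrite in_itv/= leNgt; [move=> /negbFE|move=> ->].
by apply/seteqP; split => u /=; [move=> [<- <-]|move=> [<- <-]].
Qed.

Lemma unif_word s :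
  unif ((fun u : measurableTypeR R => word u (size s)) @^-1` [set s]) = (p s)%:E.
Proof.
have wl : forall s, 0 <= word_left s /\ word_left s + p s <= 1.
  elim=> [|b t [IH1 IH2]] /=; first by rewrite p_nil add0r.
  have := p_cons t; have := p_ge0 (false :: t); have := p_ge0 (true :: t).
  by case: b => /=; split; lra.
transitivity (@lebesgue_measure R `[word_left s, word_left s + p s[%classic); last first.
  rewrite lebesgue_measure_itv/= lte_fin ltrDl.
  case: ltP => h; first by rewrite -EFinD addrAC subrr add0r.
  by congr EFin; apply/eqP; rewrite eq_le h p_ge0.
have [w0 w1] := wl s; congr lebesgue_measure; apply/seteqP; split => u /=; rewrite !in_itv/=.
  by move=> [/eqP ws u01]; rewrite -word_interval.
move=> h; have u01 : 0 <= u < 1 by lra.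
by split=> //; apply/eqP; rewrite word_interval.
Qed.

End RandomWord.

(** * Codings of a space by binary words *)

Lemma cvg_near_dist (R : realType) (T : Type) (F : set_system T) {FF : Filter F}
    (u : T -> R) (l e : R) :
  u @ F --> l -> 0 < e -> \forall j \near F, `|l - u j| < e.
Proof. by move=> /cvgrPdist_lt ul e0; exact: ul. Qed.

Section Ultra.
Variables (R : realType) (F : set_system nat).
Hypothesis FU : UltraFilter F.

(** An ultrafilter decides every letter, so that sequences of words need no
    extraction of subsequences to converge. *)
Lemma ultra_code (om_ : nat -> nat -> bool) :
  exists om, forall m, \forall j \near F, om_ j m = om m.
Proof.
exists (fun m => `[< F [set j | om_ j m] >]) => m.
case: asboolP => [h|h]; first by apply: filterS h.
have [//|h'] := in_ultra_setVsetC [set j | om_ j m] FU.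
by apply: filterS h' => j /= /negP/negbTE.
Qed.

Lemma ultra_bounded_cvg (u : nat -> R) (M : R) : (forall j, `|u j| <= M) ->
  exists l : R, u @ F --> l.
Proof.
move=> uM.
have UU : UltraFilter (u @ F).
  split=> [|G GF sG]; first exact: fmap_proper_filter.
  rewrite predeqE => A; split=> [GA|/sG//].
  have [//|h] := in_ultra_setVsetC (u @^-1` A) FU.
  have : G (A `&` ~` A) by apply: filterI => //; apply: sG.
  by rewrite setICr => /filter_ex[].
have := @segment_compact R (- M) M; rewrite compact_ultra => /(_ _ UU)[].
  by apply: nearW => j /=; rewrite in_itv/= -ler_norml.
by move=> l [_ ul]; exists l.
Qed.

End Ultra.

Lemma ultra_eventually : exists F : set_system nat,
  UltraFilter F /\ (forall A, eventually A -> F A).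
Proof. by have [F [FU hF]] := ultraFilterLemma eventually_filter; exists F. Qed.

(** Infinite binary words are read through their finite prefixes, most recent
    letter first, which makes extending a prefix a [cons]. *)
Fixpoint pre (om : nat -> bool) (m : nat) : seq bool :=
  if m is m'.+1 then om m' :: pre om m' else [::].

Lemma size_pre om m : size (pre om m) = m.
Proof. by elim: m => //= m ->. Qed.

Lemma pre_eq om om' m i : pre om m = pre om' m -> (i < m)%N -> om i = om' i.
Proof.
elim: m => //= m IH [h1 h2]; rewrite ltnS leq_eqVlt => /predU1P[->//|].
exact: IH.
Qed.

(** Agreement on longer and longer prefixes forces the same limit word. *)
Lemma pre_diag_near (F : set_system nat) {FF : Filter F}
    (Foo : forall A, eventually A -> F A) om_ om'_ om :
  (forall m, \forall j \near F, om_ j m = om m) ->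
  (forall j, pre (om_ j) j = pre (om'_ j) j) ->
  forall m, \forall j \near F, om'_ j m = om m.
Proof.
move=> h e m; have mj : F [set j | (m < j)%N] by apply: Foo; exact: nbhs_infty_gt.
by apply: filterS2 (h m) mj => j /= <- mj; rewrite (pre_eq (e j)).
Qed.

Section Coding.
Variables (R : realType) (S : topologicalType).
Implicit Type om : nat -> bool.

(** What a continuous surjection from a closed set of binary words would
    provide, for a relation and along ultrafilters: the set of codes is closed,
    and a point depends continuously on its code. Several points may share a
    code, provided that the topology does not separate them. *)
Definition coding (rep : (nat -> bool) -> S -> Prop) :=
  forall (F : set_system nat) (om_ : nat -> nat -> bool) om (x_ : nat -> S), UltraFilter F ->
    (forall A, eventually A -> F A) ->
    (forall m, \forall j \near F, om_ j m = om m) ->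
    (forall j, rep (om_ j) (x_ j)) ->
  (exists x, rep om x) /\ forall x, rep om x -> x_ @ F --> x.

Variables (rep : (nat -> bool) -> S -> Prop) (repP : coding rep).

(** The set of codes is compact, hence continuity is uniform: the
    counterexamples for all prefix lengths would have a common limit code. *)
Lemma coding_modulus (f : S -> R) (e : R) : continuous f -> 0 < e ->
  exists m, forall om om' x x', rep om x -> rep om' x' ->
    pre om m = pre om' m -> `|f x - f x'| <= e.
Proof.
move=> cf e0; apply: contrapT => /forallNP H.
have {}H m : exists z : ((nat -> bool) * S) * ((nat -> bool) * S),
    [/\ rep z.1.1 z.1.2, rep z.2.1 z.2.2, pre z.1.1 m = pre z.2.1 m &
        e < `|f z.1.2 - f z.2.2|].
  apply: contrapT => /forallNP H'; apply: (H m) => om om' x x' h1 h2 h3.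
  rewrite leNgt; apply/negP => h4; exact: (H' ((om, x), (om', x'))).
have [z zP] := choice H.
have [F [FU Foo]] := ultra_eventually.
have [om omP] := ultra_code FU (fun j => (z j).1.1).
have omP' : forall m, \forall j \near F, (z j).2.1 m = om m.
  by apply: (pre_diag_near Foo omP) => j; case: (zP j).
have r1 j : rep (z j).1.1 (z j).1.2 by case: (zP j).
have r2 j : rep (z j).2.1 (z j).2.2 by case: (zP j).
have [[x rx] cx] := repP FU Foo omP r1.
have [_ cx'] := repP FU Foo omP' r2.
have h1 : f (z j).1.2 @[j --> F] --> f x by apply: continuous_cvg (cx _ rx); exact: cf.
have h2 : f (z j).2.2 @[j --> F] --> f x by apply: continuous_cvg (cx' _ rx); exact: cf.
have e2 : 0 < e / 2 by rewrite divr_gt0.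
have [j /= [d1 d2]] := filter_ex (filterI (cvg_near_dist h1 e2) (cvg_near_dist h2 e2)).
have [_ _ _] := zP j; apply/negP; rewrite -leNgt.
rewrite [e]splitr (le_trans (ler_distD (f x) _ _))// lerD// ltW//.
by rewrite distrC.
Qed.

Lemma coding_bounded (f : S -> R) : continuous f ->
  exists M, forall om x, rep om x -> `|f x| <= M.
Proof.
move=> cf; apply: contrapT => /forallNP H.
have {}H m : exists z : (nat -> bool) * S, rep z.1 z.2 /\ m%:R < `|f z.2|.
  apply: contrapT => /forallNP H'; apply: (H m%:R) => om x h1.
  rewrite leNgt; apply/negP => h4; exact: (H' (om, x)).
have [z zP] := choice H.
have [F [FU Foo]] := ultra_eventually.
have [om omP] := ultra_code FU (fun j => (z j).1).
have r1 j : rep (z j).1 (z j).2 by case: (zP j).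
have [[x rx] cx] := repP FU Foo omP r1.
have /cvg_near_dist/(_ ltr01) h1 : f (z j).2 @[j --> F] --> f x.
  by apply: continuous_cvg (cx _ rx); exact: cf.
have h2 : F [set j | (Num.truncn (`|f x| + 1)).+1 <= j]%N.
  by apply: Foo; exact: nbhs_infty_ge.
have [j /= [hj1 hj2]] := filter_ex (filterI h1 h2).
have := (zP j).2; apply/negP; rewrite -leNgt.
have h0 : `|f x| + 1 < (Num.truncn (`|f x| + 1)).+1%:R by exact: truncnS_gt.
have hj3 : (Num.truncn (`|f x| + 1)).+1%:R <= j%:R :> R by rewrite ler_nat.
have := ler_normB (f x) (f x - f (z j).2).
by rewrite opprB addrC subrK; lra.
Qed.

Lemma coding_open (O : set S) om x : open O -> rep om x -> O x ->
  exists m, forall om' x', rep om' x' -> pre om' m = pre om m -> O x'.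
Proof.
move=> oO rx Ox; apply: contrapT => /forallNP H.
have {}H m : exists z : (nat -> bool) * S,
    [/\ rep z.1 z.2, pre om m = pre z.1 m & ~ O z.2].
  apply: contrapT => /forallNP H'; apply: (H m) => om' x' h1 h2.
  by apply: contrapT => h4; exact: (H' (om', x')).
have [z zP] := choice H.
have [F [FU Foo]] := ultra_eventually.
have omP : forall m, \forall j \near F, (z j).1 m = om m.
  apply: (pre_diag_near Foo (om_ := fun=> om)) => j; first exact: nearW.
  by have [] := zP j.
have r1 j : rep (z j).1 (z j).2 by case: (zP j).
have [_ /(_ _ rx) cx] := repP FU Foo omP r1.
have /filter_ex[j /= Oj] : \forall j \near F, O (z j).2.
  by apply: cx; exact: open_nbhs_nbhs.
by have [] := zP j.
Qed.

Lemma coding_closed om :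
  (forall m, exists om' x', rep om' x' /\ pre om' m = pre om m) ->
  exists x, rep om x.
Proof.
move=> H.
have {}H m : exists z : (nat -> bool) * S, rep z.1 z.2 /\ pre om m = pre z.1 m.
  by have [om' [x' [h1 h2]]] := H m; exists (om', x').
have [z zP] := choice H.
have [F [FU Foo]] := ultra_eventually.
have omP : forall m, \forall j \near F, (z j).1 m = om m.
  apply: (pre_diag_near Foo (om_ := fun=> om)) => j; first exact: nearW.
  by have [] := zP j.
have r1 j : rep (z j).1 (z j).2 by case: (zP j).
by have [] := repP FU Foo omP r1.
Qed.

Section measurability.
Context d (Om : measurableType d) (X : Om -> S) (kap : Om -> nat -> bool).
Hypothesis kapP : forall w, rep (kap w) (X w).
Hypothesis mkap : forall m s, measurable [set w | pre (kap w) m = s].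

(** An open set is a union of cylinders, and there are countably many of
    these. *)
Lemma coding_measurable_open (O : set S) : open O -> measurable (X @^-1` O).
Proof.
move=> oO.
pose good s := forall om x, rep om x -> pre om (size s) = s -> O x.
rewrite [X in measurable X](_ : _ =
    \bigcup_(s in [set s | good s]) [set w | pre (kap w) (size s) = s]).
  rewrite bigcup_mkcond; apply: countable_bigcupT_measurable => // s.
  by case: ifP.
apply/seteqP; split => [w Ow|w [s sg ws]]; last exact: sg (kapP w) ws.
have [m mP] := coding_open oO (kapP w) Ow.
exists (pre (kap w) m); rewrite /= ?size_pre//.
by move=> om x rx; rewrite size_pre; exact: mP.
Qed.

Lemma coding_measurable_fun (f : S -> R) : continuous f ->
  measurable_fun setT (f \o X).
Proof.
move=> cf; apply: (measurability _ (RGenOInfty.measurableE R)).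
move=> _ [_ [x ->] <-]; rewrite setTI comp_preimage.
by apply: coding_measurable_open; apply: open_comp => // *; exact: cf.
Qed.

End measurability.
End Coding.
Lemma rcvg_unique (R : realType) (T : Type) (F : set_system T) {FF : ProperFilter F}
    (u : T -> R) (l l' : R) : u @ F --> l -> u @ F --> l' -> l = l'.
Proof. exact: (cvg_unique (@Rhausdorff R)). Qed.

Lemma rcvg_cst (R : realType) (T : Type) (F : set_system T) {FF : ProperFilter F}
    (u : T -> R) (l c : R) : u @ F --> l -> (forall n, u n = c) -> l = c.
Proof.
move=> ul uc; apply: (rcvg_unique ul); rewrite (_ : u = fun=> c); first exact: cvg_cst.
exact/funext.
Qed.

Lemma measure_bigcup_count0 (R : realType) d (Om : measurableType d)
    (mu : {measure set Om -> \bar R}) (T : countType) (D : set T) (A : T -> set Om) :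
  (forall t, measurable (A t)) -> (forall t, D t -> mu (A t) = 0%E) ->
  measurable (\bigcup_(t in D) A t) /\ mu (\bigcup_(t in D) A t) = 0%E.
Proof.
move=> mA A0; have mD : measurable (\bigcup_(t in D) A t).
  rewrite bigcup_mkcond; apply: countable_bigcupT_measurable => // t.
  by case: ifP => _; [exact: mA|exact: measurable0].
split=> //; apply: (measure_negligible mD).
rewrite (_ : \bigcup_(t in D) A t = \bigcup_k (if unpickle k is Some t then
      if `[< D t >] then A t else set0 else set0)).
  apply: negligible_bigcup => k.
  case: unpickle => [t|]; last exact: negligible_set0.
  case: asboolP => [Dt|_]; last exact: negligible_set0.
  by apply/negligibleP => //; exact: A0.
apply/seteqP; split => [w [t Dt Aw]|w [k _]].
  by exists (pickle t) => //; rewrite pickleK; case: asboolP.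
case: unpickle => // t; case: asboolP => // Dt Aw; by exists t.
Qed.

Lemma measure_eq_off_null (R : realType) d (Om : measurableType d)
    (mu : {measure set Om -> \bar R}) (N A B : set Om) :
  measurable N -> measurable A -> measurable B -> mu N = 0%E ->
  (forall w, ~ N w -> A w <-> B w) -> mu A = mu B.
Proof.
move=> mN mA mB N0.
suff H C D : measurable C -> measurable D ->
    (forall w, ~ N w -> C w -> D w) -> (mu C <= mu D)%E.
  by move=> h; apply/eqP; rewrite eq_le; apply/andP; split;
    apply: H => // w /h[].
move=> mC mD h; have -> : mu D = mu (D `|` N).
  by rewrite measureU0.
apply: le_measure; rewrite ?inE//; first exact: measurableU.
by move=> w Cw; have [Nw|Nw] := pselect (N w); [right|left; exact: h].
Qed.

Lemma rcvg_sum (R : realType) (T : Type) (F : set_system T) {FF : Filter F}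
    (I : Type) (s : seq I) (u : I -> T -> R) (l : I -> R) :
  (forall i, u i @ F --> l i) ->
  \sum_(i <- s) u i n @[n --> F] --> \sum_(i <- s) l i.
Proof.
move=> ul; elim: s => [|i s IH].
  by under eq_fun do rewrite big_nil; rewrite big_nil; exact: cvg_cst.
under eq_fun do rewrite big_cons; rewrite big_cons; exact: cvgD.
Qed.

Lemma rcvg_prod (R : realType) (T : Type) (F : set_system T) {FF : Filter F}
    (I : Type) (s : seq I) (u : I -> T -> R) (l : I -> R) :
  (forall i, u i @ F --> l i) ->
  \prod_(i <- s) u i n @[n --> F] --> \prod_(i <- s) l i.
Proof.
move=> ul; elim: s => [|i s IH].
  by under eq_fun do rewrite big_nil; rewrite big_nil; exact: cvg_cst.
under eq_fun do rewrite big_cons; rewrite big_cons; exact: cvgM.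
Qed.

(** * Limits of laws on a coded space *)

Section CodingLimit.
Variables (R : realType) (S : topologicalType).
Variables (rep : (nat -> bool) -> S -> Prop) (repP : coding rep).

Definition pre_tuple (om : nat -> bool) m : m.-tuple bool :=
  Tuple (introT eqP (size_pre om m)).

Lemma pre_tuple_preimage (T : Type) (kap : T -> nat -> bool) m (t : m.-tuple bool) :
  (fun w => pre_tuple (kap w) m) @^-1` [set t] = [set w | pre (kap w) m = t].
Proof.
apply/seteqP; split => [w /= <-//|w /= h].
by apply: val_inj.
Qed.

Section one_space.
Context d (Om : measurableType d) (P : probability Om R).
Variables (X : Om -> S) (kap : Om -> nat -> bool).
Hypothesis kapP : forall w, rep (kap w) (X w).
Hypothesis mkap : forall m s, measurable [set w | pre (kap w) m = s].

Lemma coding_bmeas (f : S -> R) : continuous f -> bmeas (f \o X).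
Proof.
move=> cf; split; first exact: (coding_measurable_fun repP kapP mkap cf).
by have [M MP] := coding_bounded repP cf; exists M => w; exact: MP (kapP w).
Qed.

(** When [f] is nearly constant on cylinders, its expectation nearly depends on
    finitely many prefix probabilities only. *)
Lemma coding_step (f : S -> R) (e : R) m (r : m.-tuple bool -> R) :
  continuous f ->
  (forall om x, rep om x -> `|f x - r (pre_tuple om m)| <= e) ->
  `|\int[P]_w f (X w) -
    \sum_t r t * fine (P [set w | pre (kap w) m = t])| <= e.
Proof.
move=> cf fr.
have mh t : measurable ((fun w => pre_tuple (kap w) m) @^-1` [set t]).
  by rewrite pre_tuple_preimage; exact: mkap.
have -> : \sum_t r t * fine (P [set w | pre (kap w) m = t]) =
    \int[P]_w r (pre_tuple (kap w) m).
  by rewrite Rint_finval//; apply: eq_bigr => t _; rewrite pre_tuple_preimage.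
apply: Rint_dist => [||w]; first exact: coding_bmeas.
  exact: (bmeas_finval r mh).
exact: fr.
Qed.

End one_space.

(** Weak compactness of the laws on a coded space, together with a
    representation of the limit on the unit interval: the masses of the
    cylinders converge along the ultrafilter, the limiting masses are those of
    a random word, and words that are the code of no point keep mass zero. *)
Theorem coding_limit (F : set_system nat)
    (d : nat -> measure_display) (Om : forall n, measurableType (d n))
    (P : forall n, probability (Om n) R) (X : forall n, Om n -> S)
    (kap : forall n, Om n -> nat -> bool) :
  UltraFilter F -> (forall A, eventually A -> F A) ->
  (forall n w, rep (kap n w) (X n w)) ->
  (forall n m s, measurable [set w | pre (kap n w) m = s]) ->
  exists (T : measurableTypeR R -> S) (K : measurableTypeR R -> nat -> bool),
  [/\ forall u, rep (K u) (T u),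
      forall m s, measurable [set u | pre (K u) m = s] &
      forall f : S -> R, continuous f ->
        (\int[P n]_w f (X n w)) @[n --> F] --> \int[unif R]_u f (T u)].
Proof.
move=> FU Foo kapP mkap.
pose pn n s := fine (P n [set w | pre (kap n w) (size s) = s]).
have pn01 n s : 0 <= pn n s <= 1.
  rewrite /pn fine_ge0//= -lee_fin fineK ?fin_num_measure//.
  exact: probability_le1.
have pP' s : exists l : R, pn n s @[n --> F] --> l.
  apply: (@ultra_bounded_cvg _ _ FU _ 1) => n.
  by have /andP[h1 h2] := pn01 n s; rewrite ger0_norm.
have [p pP] := choice pP'.
have p_nil : p [::] = 1.
  apply: (rcvg_cst (pP [::])) => n.
  rewrite /pn /= [X in P n X](_ : _ = setT); last by apply/seteqP; split.
  by rewrite [X in fine X](@probability_setT _ _ _ (P n)).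
have p_ge0 s : 0 <= p s.
  rewrite leNgt; apply/negP; rewrite -oppr_gt0 => p0.
  have [n /=] := filter_ex (cvg_near_dist (pP s) p0).
  by have := pn01 n s; rewrite ltr_norml; lra.
have p_cons s : p s = p (false :: s) + p (true :: s).
  apply: (rcvg_unique (pP s)).
  rewrite [X in X @ F](_ : _ = (fun n => pn n (false :: s) + pn n (true :: s))).
    exact: cvgD.
  apply/funext => n; rewrite /pn -fineD ?fin_num_measure//.
  rewrite -measureU//; last first.
    by apply/seteqP; split => // w [] /= -> [].
  congr (fine (P n _)); apply/seteqP; split => w /=.
    by case: (kap n w (size s)) => ->; [right|left].
  by move=> [] [_].
(* The word read on the unit interval with the limiting prefix probabilities. *)
pose Y u m := head false (word p u m.+1).
have preY u m : pre (Y u) m = word p u m by elim: m => //= m ->.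
have mY m s : measurable [set u : measurableTypeR R | pre (Y u) m = s].
  rewrite [X in measurable X](_ : _ = (fun u => word p u m) @^-1` [set s]).
    exact: measurable_word.
  by apply/seteqP; split => u /=; rewrite preY.
have lawY s : unif R [set u | pre (Y u) (size s) = s] = (p s)%:E.
  rewrite -(unif_word p_nil p_ge0 p_cons s); congr (unif R _).
  by apply/seteqP; split => u /=; rewrite preY.
(* A prefix is dead when no code has it; since the set of codes is closed, a
   word that is not a code has a dead prefix. *)
pose dead s := ~ exists om x, rep om x /\ pre om (size s) = s.
pose bad : set (measurableTypeR R) := [set u | ~ exists x, rep (Y u) x].
have badE : bad = \bigcup_(s in [set s | dead s]) [set u | pre (Y u) (size s) = s].
  apply/seteqP; split => [u bu|u [s ds us] [x rx]]; last first.
    by apply: ds; exists (Y u), x.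
  apply: contrapT => h; apply: bu; apply: (coding_closed repP) => m.
  apply: contrapT => h'; apply: h; exists (pre (Y u) m); rewrite /= ?size_pre//.
  by rewrite /dead size_pre.
have [mbad bad0] : measurable bad /\ unif R bad = 0%E.
  rewrite badE; apply: measure_bigcup_count0 => [s|s ds]; first exact: mY.
  rewrite [LHS]lawY; congr EFin; apply: (rcvg_cst (pP s)) => n.
  rewrite /pn [X in P n X](_ : _ = set0) ?measure0//.
  apply/seteqP; split => // w /= ws; apply: ds.
  by exists (kap n w), (X n w).
have [om0 [x0 r0]] : exists om x, rep om x.
  apply: contrapT => no; have := @probability_setT _ _ _ (P 0%N).
  rewrite [X in P _ X](_ : _ = set0); last first.
    apply/seteqP; split => // w _; apply: no; exists (kap 0%N w), (X 0%N w).
    exact: kapP.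
  by rewrite measure0 => /eqP; rewrite eqe eq_sym oner_eq0.
(* On the null set of words that are not codes, any fixed code will do. *)
pose K u := if `[< bad u >] then om0 else Y u.
have TP' u : exists x, rep (K u) x.
  by rewrite /K; case: asboolP => [_|/contrapT//]; exists x0.
have [T TP] := choice TP'.
have KE m s : [set u | pre (K u) m = s] =
    (bad `&` [set u | pre om0 m = s]) `|` (~` bad `&` [set u | pre (Y u) m = s]).
  apply/seteqP; split => u /=; rewrite /K; case: asboolP => ub.
  - by left.
  - by right.
  - by move=> [[]|[]].
  - by move=> [[]|[]].
have mcst m s : measurable [set u : measurableTypeR R | pre om0 m = s].
  have [h|h] := pselect (pre om0 m = s).
    by rewrite [X in measurable X](_ : _ = setT)//; apply/seteqP; split.
  by rewrite [X in measurable X](_ : _ = set0)//; apply/seteqP; split.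
have mK m s : measurable [set u | pre (K u) m = s].
  rewrite KE; apply: measurableU; apply: measurableI => //.
  exact: measurableC.
have lawK s : fine (unif R [set u | pre (K u) (size s) = s]) = p s.
  rewrite -[RHS]/(fine (p s)%:E) -lawY; congr fine.
  apply: (measure_eq_off_null mbad) => // u ub /=.
  by rewrite /K; case: asboolP.
exists T, K; split=> // f cf.
apply/cvgrPdist_le => e e0.
have e3 : 0 < e / 3 by rewrite divr_gt0.
(* One value of [f] per prefix of length [m] reduces all the expectations to
   the same finite combination of prefix probabilities. *)
have [m mP] := coding_modulus repP cf e3.
have rP' (t : m.-tuple bool) : exists rt : R, forall om x, rep om x ->
    pre om m = tval t -> `|f x - rt| <= e / 3.
  have [[om [x [rx xt]]]|no] := pselect (exists om x, rep om x /\ pre om m = t).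
    by exists (f x) => om' x' rx' xt'; apply: mP rx' rx _; rewrite xt' xt.
  by exists 0 => om x rx xt; exfalso; apply: no; exists om, x.
have [r rP0] := choice rP'.
have rP om x : rep om x -> `|f x - r (pre_tuple om m)| <= e / 3.
  by move=> rx; apply: (rP0 _ _ _ rx).
have : \sum_t r t * pn n (tval t) @[n --> F] --> \sum_t r t * p (tval t).
  apply: rcvg_sum => t; apply: cvgM; first exact: cvg_cst.
  exact: pP.
move=> /cvg_near_dist/(_ e3); apply: filterS => n /= hn.
have h1 := coding_step (P n) (kapP n) (mkap n) cf rP.
have h2 := coding_step (unif R) TP mK cf rP.
have eq1 : \sum_t r t * pn n (tval t) = \sum_t r t * fine (P n [set w | pre (kap n w) m = t]).
  by apply: eq_bigr => t _; rewrite /pn size_tuple.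
have eq2 : \sum_t r t * p (tval t) = \sum_t r t * fine (unif R [set u | pre (K u) m = t]).
  by apply: eq_bigr => t _; rewrite -lawK size_tuple.
rewrite eq1 eq2 in hn.
move: h1 h2 hn; rewrite !ler_norml !ltr_norml; lra.
Qed.
End CodingLimit.

(** * Binary expansions *)

Section RealCodes.
Variable R : realType.
Implicit Types (x y : R) (om : nat -> bool).

Fixpoint dyadic om (r : nat) : R :=
  if r is r'.+1 then dyadic om r' + (om r')%:R / 2 ^+ r else 0.

(** The enclosure form of binary expansion: it makes sense of both expansions
    of a dyadic number and passes to limits without any series. *)
Definition binary_rep om x := forall r, dyadic om r <= x <= dyadic om r + (2 ^+ r)^-1.

Fixpoint greedy x (r : nat) : R :=
  if r is r'.+1 then
    greedy x r' + (greedy x r' + (2 ^+ r)^-1 <= x)%R%:R / 2 ^+ r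
  else 0.

Definition bits x (r : nat) : bool := greedy x r + (2 ^+ r.+1)^-1 <= x.

Lemma dyadic_bits x r : dyadic (bits x) r = greedy x r.
Proof. by elim: r => //= r ->. Qed.

Lemma half_powS r : (2 ^+ r.+1)^-1 = (2 ^+ r)^-1 / 2 :> R.
Proof. by rewrite exprS invfM mulrC. Qed.

Lemma half_pow_gt0 r : 0 < (2 ^+ r)^-1 :> R.
Proof. by rewrite invr_gt0 exprn_gt0. Qed.

Lemma binary_rep_bits x : 0 <= x <= 1 -> binary_rep (bits x) x.
Proof.
move=> x01; elim=> [|r IH]; first by rewrite /= add0r expr0 invr1.
rewrite !dyadic_bits in IH *; rewrite [greedy x r.+1]/=.
have := half_pow_gt0 r; have := half_powS r.
case: (leP (greedy x r + (2 ^+ r.+1)^-1) x) => /= h; rewrite ?mul1r ?mul0r; lra.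
Qed.

Lemma binary_rep_01 om x : binary_rep om x -> 0 <= x <= 1.
Proof. by move=> /(_ 0%N); rewrite /= add0r expr0 invr1. Qed.

Lemma small_half_pow (e : R) : 0 < e -> exists r, (2 ^+ r)^-1 < e.
Proof.
move=> e0; exists (Num.truncn e^-1).+1.
rewrite -[X in _ < X]invrK ltf_pV2 ?posrE ?invr_gt0 ?exprn_gt0//.
rewrite (lt_le_trans (truncnS_gt _))// -natrX ler_nat.
by apply: (leq_trans (ltnSn _)); exact/ltnW/ltn_expl.
Qed.

Lemma binary_rep_close om x y r : binary_rep om x -> dyadic om r <= y <= dyadic om r + (2 ^+ r)^-1 ->
  `|x - y| <= (2 ^+ r)^-1.
Proof. by move=> /(_ r) h h'; rewrite ler_norml; lra. Qed.

Lemma binary_rep_inj om x y : binary_rep om x -> binary_rep om y -> x = y.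
Proof.
move=> hx hy; apply/eqP; rewrite -subr_eq0 -normr_le0 leNgt; apply/negP => h.
have [r hr] := small_half_pow h.
by have := binary_rep_close hx (hy r); rewrite leNgt hr.
Qed.

Lemma near_eq_dyadic (F : set_system nat) {FF : Filter F}
    (om_ : nat -> nat -> bool) om r :
  (forall m, \forall j \near F, om_ j m = om m) ->
  \forall j \near F, dyadic (om_ j) r = dyadic om r.
Proof.
move=> h; elim: r => [|r IH]; first exact: nearW.
by apply: filterS2 (h r) IH => j /= -> ->.
Qed.

Lemma binary_rep_limit (F : set_system nat) (om_ : nat -> nat -> bool) om (x_ : nat -> R) :
  UltraFilter F ->
  (forall m, \forall j \near F, om_ j m = om m) ->
  (forall j, binary_rep (om_ j) (x_ j)) ->
  exists l : R, binary_rep om l /\ x_ @ F --> l.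
Proof.
move=> FU omP rP.
have [|l lP] := @ultra_bounded_cvg R _ FU x_ 1.
  by move=> j; have := binary_rep_01 (rP j); rewrite ler_norml; lra.
exists l; split=> // r; have nd : \forall j \near F, dyadic (om_ j) r = dyadic om r by exact: near_eq_dyadic.
apply/andP; split.
  rewrite leNgt; apply/negP; rewrite -subr_gt0 => h.
  have [j /= [e hj]] := filter_ex (filterI nd (cvg_near_dist lP h)).
  by have := rP j r; rewrite e; move: hj; rewrite ltr_norml; lra.
rewrite leNgt; apply/negP; rewrite -subr_gt0 => h.
have [j /= [e hj]] := filter_ex (filterI nd (cvg_near_dist lP h)).
by have := rP j r; rewrite e; move: hj; rewrite ltr_norml; lra.
Qed.

Definition subcode (i : nat) om : nat -> bool := fun r => om (pickle (i, r)).

(** The expansion of the [i]-th coordinate occupies the positions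
    [pickle (i, r)]. *)
Definition vector_code (v : nat -> R) : nat -> bool :=
  fun n => if unpickle n is Some (i, r) then bits (v i) r else false.

Lemma subcode_vector v i : subcode i (vector_code v) = bits (v i).
Proof. by apply/funext => r; rewrite /subcode /vector_code pickleK. Qed.

Section measurability.
Context d (Om : measurableType d).

Lemma measurable_greedy (X : Om -> R) r :
  measurable_fun setT X -> measurable_fun setT (fun w => greedy (X w) r).
Proof.
move=> mX; elim: r => [|r IH] /=; first exact: measurable_cst.
apply: measurable_funD => //; apply: measurable_funM => //.
have mle : measurable_fun setT (fun w => greedy (X w) r + (2 ^+ r.+1)^-1 <= X w).
  by apply: measurable_fun_ler => //; apply: measurable_funD.
rewrite (_ : (fun w => _) = fun w =>
    if greedy (X w) r + (2 ^+ r.+1)^-1 <= X w then 1 else 0 : R).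
  exact: measurable_fun_ifT.
by apply/funext => w; case: ifP.
Qed.

Lemma measurable_bits (X : Om -> R) r :
  measurable_fun setT X -> measurable [set w | bits (X w) r].
Proof.
move=> mX; rewrite -[X in measurable X]setTI.
have : measurable_fun setT (fun w => bits (X w) r).
  apply: measurable_fun_ler => //; apply: measurable_funD => //.
  exact: measurable_greedy.
by move=> /(_ measurableT [set true]); apply.
Qed.

Lemma measurable_pre (om_ : Om -> nat -> bool) :
  (forall i, measurable [set w | om_ w i]) ->
  forall m s, measurable [set w | pre (om_ w) m = s].
Proof.
move=> mo; elim=> [|m IH] [|b s].
- by rewrite [X in measurable X](_ : _ = setT)//; apply/seteqP; split.
- by rewrite [X in measurable X](_ : _ = set0)//; apply/seteqP; split.
- by rewrite [X in measurable X](_ : _ = set0)//; apply/seteqP; split.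
rewrite [X in measurable X](_ : _ =
    [set w | om_ w m = b] `&` [set w | pre (om_ w) m = s]).
  apply: measurableI => //; case: b; first exact: mo.
  rewrite [X in measurable X](_ : _ = ~` [set w | om_ w m]).
    by apply: measurableC.
  by apply/seteqP; split => w /=; [move=> ->|move/negP/negbTE].
by apply/seteqP; split => w /=; [move=> [-> ->]|move=> [-> ->]].
Qed.

Lemma measurable_vector_code (V : Om -> nat -> R) :
  (forall i, measurable_fun setT (fun w => V w i)) ->
  forall m s, measurable [set w | pre (vector_code (V w)) m = s].
Proof.
move=> mV; apply: measurable_pre => n; rewrite /vector_code.
case: unpickle => [[i r]|]; first exact: measurable_bits (mV i).
by rewrite [X in measurable X](_ : _ = set0)//; apply/seteqP; split.
Qed.

End measurability.
End RealCodes.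

(** * Probabilities as real numbers and the coding of the square *)

Section RealProbability.
Context (R : realType) d (Om : measurableType d) (P : probability Om R).
Implicit Types A B N : set Om.

Definition prb A : R := fine (P A).

Lemma prbE A : measurable A -> P A = (prb A)%:E.
Proof. by move=> mA; rewrite /prb fineK// fin_num_measure. Qed.

Lemma prb_ge0 A : 0 <= prb A.
Proof. by rewrite /prb fine_ge0. Qed.

Lemma prb_le A B : measurable A -> measurable B -> A `<=` B -> prb A <= prb B.
Proof. by move=> mA mB AB; rewrite -lee_fin -!prbE// le_measure ?inE. Qed.

Lemma prbT : prb setT = 1.
Proof. by rewrite /prb [X in fine X](@probability_setT _ _ _ P). Qed.

Lemma prb_le1 A : measurable A -> prb A <= 1.
Proof. by move=> mA; rewrite -prbT prb_le. Qed.

Lemma prb0 : prb set0 = 0.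
Proof. by rewrite /prb measure0. Qed.

Lemma prbU A B : measurable A -> measurable B -> A `&` B = set0 ->
  prb (A `|` B) = prb A + prb B.
Proof.
by move=> mA mB AB; rewrite /prb measureU// fineD// fin_num_measure.
Qed.

Lemma prbU_le A B : measurable A -> measurable B -> prb (A `|` B) <= prb A + prb B.
Proof.
move=> mA mB; rewrite -lee_fin EFinD -!prbE//; last exact: measurableU.
exact: measureU2.
Qed.

Lemma prb_between A A' B : measurable A -> measurable A' -> measurable B ->
  A `<=` A' -> A' `<=` A `|` B -> prb A <= prb A' <= prb A + prb B.
Proof.
move=> mA mA' mB AA' A'AB; rewrite prb_le//= (le_trans _ (prbU_le mA mB))// prb_le//.
exact: measurableU.
Qed.

Lemma measurable_bigcup_fin (T : finType) (D : set T) (A : T -> set Om) :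
  (forall t, measurable (A t)) -> measurable (\bigcup_(t in D) A t).
Proof.
by move=> mA; apply: fin_bigcup_measurable => //; exact: finite_finset.
Qed.

Lemma prb_bigcup_le (T : finType) (A : T -> set Om) :
  (forall t, measurable (A t)) -> prb (\bigcup_t A t) <= \sum_t prb (A t).
Proof.
move=> mA.
have -> : \bigcup_t A t = \bigcup_(t in [set` (enum T)]) A t.
  by apply/seteqP; split => w [t _ Atw]; exists t => //=; rewrite mem_enum.
rewrite bigcup_seq -big_enum /=.
elim: (enum T) => [|t s IH]; first by rewrite !big_nil prb0.
rewrite !big_cons (le_trans (prbU_le _ _))//.
  by rewrite -bigcup_seq; exact: measurable_bigcup_fin.
by rewrite lerD2l.
Qed.

Lemma prb_dist A B N : measurable A -> measurable B -> measurable N ->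
  (forall w, ~ N w -> A w <-> B w) -> `|prb A - prb B| <= prb N.
Proof.
move=> mA mB mN AB.
suff H C D : measurable C -> measurable D ->
    (forall w, ~ N w -> C w -> D w) -> prb C - prb D <= prb N.
  have h1 := H _ _ mA mB (fun w nw => proj1 (AB w nw)).
  have h2 := H _ _ mB mA (fun w nw => proj2 (AB w nw)).
  by rewrite ler_norml; lra.
move=> mC mD h; rewrite lerBlDl (le_trans _ (prbU_le mD mN))// prb_le//.
  exact: measurableU.
by move=> w Cw; have [Nw|Nw] := pselect (N w); [right|left; exact: h].
Qed.

Lemma Rint_prb A : measurable A -> \int[P]_w \1_A w = prb A.
Proof. exact: Rint_indic. Qed.

End RealProbability.
Section Clamp.
Variable R : realType.

(** Retractions onto the unit interval and the unit square: they extend test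
    functions on the square to continuous functions on the plane. *)
Definition clamp (x : R) : R := Num.max 0 (Num.min 1 x).
Definition clamp2 (z : R * R) : R * R := (clamp z.1, clamp z.2).

Lemma clamp01 x : 0 <= clamp x <= 1.
Proof. by rewrite /clamp; apply/andP; split; rewrite maxEle minEle; do 2 case: ifP; lra. Qed.

Lemma clamp_id x : 0 <= x <= 1 -> clamp x = x.
Proof. by rewrite /clamp maxEle minEle; do 2 case: ifP; lra. Qed.

Lemma continuous_clamp : continuous clamp.
Proof.
move=> x; apply: continuous_max; first exact: cvg_cst.
by apply: continuous_min; [exact: cvg_cst|exact: cvg_id].
Qed.

Lemma clamp2_square z : unit_square (clamp2 z).
Proof. by split; rewrite /= in_itv/=; exact: clamp01. Qed.

Lemma clamp2_id z : unit_square z -> clamp2 z = z.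
Proof.
case: z => x y [/=]; rewrite !in_itv/= => hx hy.
by rewrite /clamp2/= !clamp_id.
Qed.

Lemma continuous_clamp2 : continuous clamp2.
Proof.
move=> z; rewrite /continuous_at /clamp2.
apply: (@cvg_pair _ _ _ _ (nbhs (clamp z.1)) (nbhs (clamp z.2))) => /=.
  by apply: continuous_comp; [exact: cvg_fst|exact: continuous_clamp].
by apply: continuous_comp; [exact: cvg_snd|exact: continuous_clamp].
Qed.

Lemma continuous_test_clamp (f : test_fun R) : continuous (sval f \o clamp2).
Proof.
case: f => f /= cf z.
have := (subspace_continuousP _ _).1 cf _ (clamp2_square z).
apply: cvg_comp.
move=> V; rewrite /within /= => h.
have hz : \forall w \near z, unit_square (clamp2 w) -> V (clamp2 w).
  exact: continuous_clamp2 h.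
by apply: filterS hz => w /= hw; apply: hw; exact: clamp2_square.
Qed.

Definition square_rep (om : nat -> bool) (z : R * R) :=
  binary_rep (subcode 0%N om) z.1 /\ binary_rep (subcode 1%N om) z.2.

Lemma coding_square_rep : coding square_rep.
Proof.
move=> F om_ om x_ FU Foo omP rP.
have [l1 [r1 c1]] := @binary_rep_limit R F (fun j => subcode 0%N (om_ j)) (subcode 0%N om)
  (fun j => (x_ j).1) FU (fun m => omP _) (fun j => proj1 (rP j)).
have [l2 [r2 c2]] := @binary_rep_limit R F (fun j => subcode 1%N (om_ j)) (subcode 1%N om)
  (fun j => (x_ j).2) FU (fun m => omP _) (fun j => proj2 (rP j)).
split; first by exists (l1, l2).
move=> [y1 y2] [/= q1 q2]; rewrite (binary_rep_inj q1 r1) (binary_rep_inj q2 r2).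
have -> : x_ = fun j => ((x_ j).1, (x_ j).2) by apply/funext => j; case: (x_ j).
exact: (@cvg_pair _ _ _ _ (nbhs l1) (nbhs l2) _ _ _ _ _ c1 c2).
Qed.

Definition square_code (z : R * R) : nat -> bool :=
  vector_code (fun i => if i is 0%N then clamp z.1 else clamp z.2).

Lemma square_rep_code z : square_rep (square_code z) (clamp2 z).
Proof.
by split; rewrite /square_code subcode_vector; apply: binary_rep_bits; exact: clamp01.
Qed.

Lemma measurable_clamp : measurable_fun setT clamp.
Proof. exact: continuous_measurable_fun continuous_clamp. Qed.

Lemma measurable_square_code m s :
  measurable [set z : (R * R)%type | pre (square_code z) m = s].
Proof.
apply: measurable_vector_code => -[|i].
  by apply: measurableT_comp; [exact: measurable_clamp|exact: measurable_fst].
by apply: measurableT_comp; [exact: measurable_clamp|exact: measurable_snd].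
Qed.

Lemma bmeas_continuous_clamp (f : R * R -> R) :
  continuous f -> bmeas (f \o clamp2).
Proof.
by move=> cf; exact: (coding_bmeas coding_square_rep square_rep_code measurable_square_code cf).
Qed.

End Clamp.
Lemma initial_cvg (S : choiceType) (T : topologicalType) (f : S -> T)
    (F : set_system S) (s : S) : Filter F ->
  F --> (s : initial_topology f) <-> f @ F --> f s.
Proof.
move=> FF; split => [Fs|Fs A].
  have := @initial_continuous _ _ f s.
  by apply: cvg_trans; exact: cvg_app.
move=> [_ [[B Bop <-] Bfs sBfA]].
have /Fs FB : nbhs (f s) B by apply: open_nbhs_nbhs.
exact: (filterS sBfA FB).
Qed.

Lemma ptws_cvg (I : Type) (T : topologicalType) (F : set_system {ptws I -> T})
    (f : {ptws I -> T}) : Filter F ->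
  F --> f <-> forall i, (fun g : {ptws I -> T} => g i) @ F --> f i.
Proof.
move=> FF; split => [/cvg_sup Ff i|Ff].
  by apply/(initial_cvg (fun g : {ptws I -> T} => g i)); exact: Ff.
by apply/cvg_sup => i; apply/(initial_cvg (fun g : {ptws I -> T} => g i)).
Qed.

Lemma ptws_proj_continuous (I : Type) (T : topologicalType) (i : I) :
  continuous (fun g : {ptws I -> T} => g i).
Proof.
move=> f; have h : nbhs f --> (f : {ptws I -> T}) by exact: cvg_id.
exact: (proj1 (ptws_cvg f (nbhs_filter f)) h i).
Qed.

(** * Distribution functions of permutons *)

Section PermutonBasics.
Variable R : realType.
Implicit Types (mu nu : permuton R) (a b x y e : R).

Definition quadrant a b : set (R * R)%type := `]-oo, a]%classic `*` `]-oo, b]%classic.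

Lemma measurable_quadrant a b : measurable (quadrant a b).
Proof. by apply: measurableX; exact: measurable_itv. Qed.

Definition pcdf mu a b : R := prb mu (quadrant a b).

Lemma measurable_fst_set (A : set R) : measurable A ->
  measurable (fst @^-1` A : set (R * R)%type).
Proof. by move=> mA; rewrite -[X in measurable X]setTI; exact: measurable_fst. Qed.

Lemma measurable_snd_set (A : set R) : measurable A ->
  measurable (snd @^-1` A : set (R * R)%type).
Proof. by move=> mA; rewrite -[X in measurable X]setTI; exact: measurable_snd. Qed.

Lemma prb_fst mu (A : set R) : measurable A ->
  prb mu (fst @^-1` A) = fine (lebesgue_measure (A `&` `[0%R, 1%R]%classic)).
Proof. by move=> mA; rewrite /prb; congr fine; exact: permuton_fst. Qed.

Lemma prb_snd mu (A : set R) : measurable A ->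
  prb mu (snd @^-1` A) = fine (lebesgue_measure (A `&` `[0%R, 1%R]%classic)).
Proof. by move=> mA; rewrite /prb; congr fine; exact: permuton_snd. Qed.

Lemma leb_strip a b : a <= b ->
  fine (@lebesgue_measure R (`]a, b]%classic `&` `[0%R, 1%R]%classic)) <= b - a.
Proof.
move=> ab; have le1 : (@lebesgue_measure R (`]a, b]%classic `&` `[0%R, 1%R]%classic)
    <= (b - a)%:E)%E.
  rewrite (@le_trans _ _ (@lebesgue_measure R `]a, b]%classic))//.
    by apply: le_measure; rewrite ?inE//; exact: measurableI.
  rewrite lebesgue_measure_itv/= lte_fin; case: ltP => // h.
  by rewrite lee_fin subr_ge0.
rewrite -lee_fin fineK// ge0_fin_numE//; exact: le_lt_trans le1 (ltry _).
Qed.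

Lemma prb_off_square mu : prb mu (~` @unit_square R) = 0.
Proof.
have m01 : measurable (~` `[0%R, 1%R]%classic : set R) by exact: measurableC.
have mus : measurable (@unit_square R) by apply: measurableX.
have h0 : fine (lebesgue_measure ((~` `[0%R, 1%R]%classic : set R) `&` `[0%R, 1%R]%classic)) = 0.
  by rewrite setICl measure0.
apply/eqP; rewrite eq_le prb_ge0 andbT.
rewrite (@le_trans _ _ (prb mu (fst @^-1` (~` `[0%R, 1%R]%classic) `|` snd @^-1` (~` `[0%R, 1%R]%classic))))//.
  apply: prb_le; first exact: measurableC.
    by apply: measurableU; [exact: measurable_fst_set|exact: measurable_snd_set].
  move=> [x y] /= /not_andP[]h; [left|right]; exact: h.
rewrite (le_trans (prbU_le _ _ _))//; [exact: measurable_fst_set|exact: measurable_snd_set|].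
by rewrite prb_fst// prb_snd// h0 addr0.
Qed.

Lemma measurable_square : measurable (@unit_square R : set (R * R)%type).
Proof. exact: measurableX. Qed.

Lemma integral_square mu (f : R * R -> R) : bmeas f ->
  \int[mu]_(z in @unit_square R) f z = \int[mu]_z f z.
Proof.
move=> bf; rewrite /Rintegral; congr fine.
have mC : measurable (~` @unit_square R : set (R * R)%type).
  exact: measurableC measurable_square.
have mu0 : mu (~` @unit_square R) = 0%E by rewrite prbE// prb_off_square.
rewrite (negligible_integral mC measurableT (bmeas_integrable mu bf) mu0).
by rewrite setTD setCK.
Qed.

Lemma bmeas_test (f : test_fun R) :
  bmeas (fun z : (R * R)%type => sval f (clamp2 z)).
Proof.
rewrite (_ : (fun z => _) = (sval f \o @clamp2 R) \o @clamp2 R).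
  exact: bmeas_continuous_clamp (@continuous_test_clamp R f).
by apply/funext => z /=; rewrite (clamp2_id (clamp2_square z)).
Qed.

Lemma permuton_evalE mu (f : test_fun R) :
  permuton_eval mu f = \int[mu]_z sval f (clamp2 z).
Proof.
rewrite -integral_square; last exact: bmeas_test.
by apply: eq_Rintegral => z; rewrite inE => zS; rewrite clamp2_id.
Qed.

Lemma pcdf01 mu a b : 0 <= pcdf mu a b <= 1.
Proof. by rewrite prb_ge0 prb_le1//; exact: measurable_quadrant. Qed.

Lemma pcdf_fst_le mu a a' b : a <= a' ->
  pcdf mu a b <= pcdf mu a' b <= pcdf mu a b + (a' - a).
Proof.
move=> aa; have ms : measurable (`]a, a']%classic : set R) by exact: measurable_itv.
have /andP[h1 h2] : pcdf mu a b <= pcdf mu a' b <=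
    pcdf mu a b + prb mu (fst @^-1` `]a, a']%classic).
  apply: prb_between; [exact: measurable_quadrant..|exact: measurable_fst_set| |].
    by move=> [x y] [/=]; rewrite !in_itv/= => xa yb; split; rewrite /= in_itv//= (le_trans xa).
  move=> [x y] [/=]; rewrite !in_itv/= => xa yb; have [xa'|xa'] := leP x a; [left|right].
    by split; rewrite /= in_itv.
  by [].
by rewrite h1 (le_trans h2)// lerD2l prb_fst// leb_strip.
Qed.

Lemma pcdf_snd_le mu a b b' : b <= b' ->
  pcdf mu a b <= pcdf mu a b' <= pcdf mu a b + (b' - b).
Proof.
move=> bb; have ms : measurable (`]b, b']%classic : set R) by exact: measurable_itv.
have /andP[h1 h2] : pcdf mu a b <= pcdf mu a b' <=
    pcdf mu a b + prb mu (snd @^-1` `]b, b']%classic).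
  apply: prb_between; [exact: measurable_quadrant..|exact: measurable_snd_set| |].
    by move=> [x y] [/=]; rewrite !in_itv/= => xa yb; split; rewrite /= in_itv//= (le_trans yb).
  move=> [x y] [/=]; rewrite !in_itv/= => xa yb; have [yb'|yb'] := leP y b; [left|right].
    by split; rewrite /= in_itv.
  by [].
by rewrite h1 (le_trans h2)// lerD2l prb_snd// leb_strip.
Qed.

(** Uniform marginals give a strip no more mass than its width. *)
Lemma pcdf_lipschitz mu a b a' b' :
  `|pcdf mu a b - pcdf mu a' b'| <= `|a - a'| + `|b - b'|.
Proof.
apply: le_trans (ler_distD (pcdf mu a' b) _ _) _; apply: lerD.
  case: (leP a a') => h.
    have := pcdf_fst_le mu b h; rewrite ler_norml ler0_norm ?subr_le0//; lra.
  have := pcdf_fst_le mu b (ltW h); rewrite ler_norml gtr0_norm ?subr_gt0//; lra.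
case: (leP b b') => h.
  have := pcdf_snd_le mu a' h; rewrite ler_norml ler0_norm ?subr_le0//; lra.
have := pcdf_snd_le mu a' (ltW h); rewrite ler_norml gtr0_norm ?subr_gt0//; lra.
Qed.

Lemma pcdf_neg mu a b : a < 0 \/ b < 0 -> pcdf mu a b = 0.
Proof.
move=> ab; apply/eqP; rewrite eq_le prb_ge0 andbT -(prb_off_square mu).
apply: prb_le; [exact: measurable_quadrant|exact: measurableC measurable_square|].
move=> [x y] [/=]; rewrite !in_itv/= => xa yb [/=]; rewrite !in_itv/= => xx yy.
by case: ab; lra.
Qed.

(** Continuous majorant of the indicator of a half-line, vanishing beyond
    distance [e]. *)
Definition ramp a (e : R) x : R := clamp ((a + e - x) / e).

Lemma ramp01 a e x : 0 <= ramp a e x <= 1.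
Proof. exact: clamp01. Qed.

Lemma ramp1 a e x : 0 < e -> x <= a -> ramp a e x = 1.
Proof.
move=> e0 xa; rewrite /ramp /clamp min_l; first by rewrite max_r.
by rewrite ler_pdivlMr// mul1r; lra.
Qed.

Lemma ramp0 a e x : 0 < e -> a + e <= x -> ramp a e x = 0.
Proof.
move=> e0 xa; have h : (a + e - x) / e <= 0 by rewrite ler_pdivrMr// mul0r; lra.
by rewrite /ramp /clamp min_r ?max_l//; lra.
Qed.

Lemma continuous_ramp a e : continuous (ramp a e).
Proof.
move=> x; rewrite /continuous_at /ramp.
have h : (a + e - y) / e @[y --> x] --> (a + e - x) / e.
  apply: cvgM; last exact: cvg_cst.
  by apply: cvgB; [exact: cvg_cst|exact: cvg_id].
by apply: (continuous_cvg _ _ h); exact: continuous_clamp.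
Qed.

Definition ramp2 a b e (z : R * R) : R := ramp a e z.1 * ramp b e z.2.

Lemma continuous_ramp2 a b e : continuous (ramp2 a b e).
Proof.
move=> z; rewrite /continuous_at /ramp2; apply: cvgM.
  by apply: (continuous_cvg _ _ cvg_fst); exact: continuous_ramp.
by apply: (continuous_cvg _ _ cvg_snd); exact: continuous_ramp.
Qed.

Lemma bmeas_ramp d (Om : measurableType d) a e (X : Om -> R) :
  measurable_fun setT X -> bmeas (fun w => ramp a e (X w)).
Proof.
move=> mX; split.
  apply: measurableT_comp => //.
  exact: (continuous_measurable_fun (@continuous_ramp a e)).
by exists 1 => w; have /andP[h1 h2] := ramp01 a e (X w); rewrite ger0_norm.
Qed.

Lemma bmeas_ramp2 a b e : bmeas (ramp2 a b e : (R * R)%type -> R).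
Proof. by apply: bmeasM; apply: bmeas_ramp. Qed.

Lemma ramp2_sandwich a b e z : 0 < e ->
  \1_(quadrant a b) z <= ramp2 a b e z <= \1_(quadrant (a + e) (b + e)) z.
Proof.
move=> e0; have /andP[x0 x1] := ramp01 a e z.1; have /andP[y0 y1] := ramp01 b e z.2.
rewrite !indicE; apply/andP; split.
  case: (boolP (z \in _)) => [|_]; last by rewrite mulr_ge0.
  rewrite inE => -[/=]; rewrite !in_itv/= => xa yb.
  by rewrite /ramp2 !ramp1// mulr1.
case: (boolP (z \in _)) => [_|]; first by rewrite mulr_ile1.
rewrite notin_setE => h; suff -> : ramp2 a b e z = 0 by [].
rewrite /ramp2; have [xa|xa] := leP (a + e) z.1; first by rewrite ramp0// mul0r.
have [yb|yb] := leP (b + e) z.2; first by rewrite [ramp b _ _]ramp0// mulr0.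
by exfalso; apply: h; split; rewrite /= in_itv/= ltW.
Qed.

Lemma ramp2_pcdf mu a b e : 0 < e ->
  `|pcdf mu a b - \int[mu]_z ramp2 a b e z| <= 2 * e.
Proof.
move=> e0.
have h1 : pcdf mu a b <= \int[mu]_z ramp2 a b e z.
  rewrite /pcdf -Rint_prb; last exact: measurable_quadrant.
  apply: Rint_le => [||z]; [by apply: bmeas_indic; exact: measurable_quadrant|exact: bmeas_ramp2|].
  by have /andP[] := ramp2_sandwich a b z e0.
have h2 : \int[mu]_z ramp2 a b e z <= pcdf mu (a + e) (b + e).
  rewrite /pcdf -Rint_prb; last exact: measurable_quadrant.
  apply: Rint_le => [||z]; [exact: bmeas_ramp2|by apply: bmeas_indic; exact: measurable_quadrant|].
  by have /andP[] := ramp2_sandwich a b z e0.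
have ae : a <= a + e by lra.
have be : b <= b + e by lra.
have := pcdf_fst_le mu b ae; have := pcdf_snd_le mu (a + e) be.
by rewrite ler_norml; lra.
Qed.

Lemma continuous_eval (f : test_fun R) : continuous (fun mu : permuton R => permuton_eval mu f).
Proof.
move=> mu; apply: (@continuous_comp _ _ _ (@permuton_eval R) (fun v : {ptws test_fun R -> R} => v f)).
  exact: initial_continuous.
exact: ptws_proj_continuous.
Qed.

Lemma continuous_uniform_approx (T : topologicalType) (f : T -> R) :
  (forall e : R, 0 < e -> exists2 g : T -> R, continuous g &
     forall t : T, `|f t - g t| <= e) -> continuous f.
Proof.
move=> H x; apply/cvgrPdist_le => e e0.
have e3 : 0 < e / 3 by rewrite divr_gt0.
have [g cg fg] := H _ e3.
have h : \forall y \near x, `|g x - g y| < e / 3 by exact: cvg_near_dist (cg x) e3.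
apply: (@filterS _ (nbhs x) _ _ _ _ h) => y gxy.
have := fg x; have := fg y.
by move: gxy; rewrite ltr_norml !ler_norml; lra.
Qed.

(** Indicators of quadrants are not continuous, but the uniform marginals bound
    the error of a continuous approximation, uniformly over permutons. *)
Lemma continuous_pcdf a b : continuous (fun mu : permuton R => pcdf mu a b).
Proof.
apply: continuous_uniform_approx => e e0.
have e2 : 0 < e / 2 by rewrite divr_gt0.
have cr : {within @unit_square R, continuous (ramp2 a b (e / 2))}.
  exact: (continuous_subspaceT (@continuous_ramp2 a b (e / 2))).
exists (fun mu => permuton_eval mu (exist _ _ cr)); first exact: continuous_eval.
move=> mu; rewrite /permuton_eval /= integral_square; last exact: bmeas_ramp2.
by have := ramp2_pcdf mu a b e2; rewrite [2 * _]mulrC divfK// pnatr_eq0.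
Qed.

End PermutonBasics.

(** * A permuton is determined by its distribution function *)

Section CdfUnique.
Variable R : realType.

Lemma ray_in_itv (z : R) : exists k : nat, z <= k%:R.
Proof. by exists (Num.truncn `|z|).+1; rewrite (le_trans (ler_norm z))// ltW// truncnS_gt. Qed.

Definition left_rays : set (set R) := [set A | exists a, A = `]-oo, a]%classic].

Lemma measurable_left_rays : @measurable _ (measurableTypeR R) = <<s left_rays >>.
Proof.
apply/seteqP; split=> [A mA|]; last first.
  apply: smallest_sub; first exact: sigma_algebra_measurable.
  by move=> _ [a ->]; exact: measurable_itv.
have : measurable_fun setT (id : g_sigma_algebraType left_rays -> R).
  apply: (measurability _ (RGenOInfty.measurableE R)).
  move=> _ [_ [x ->] <-]; rewrite setTI /= preimage_id -setCitvl.
  by apply: measurableC; apply: sub_sigma_algebra; exists x.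
by move=> /(_ measurableT A mA); rewrite setTI preimage_id.
Qed.

Lemma real_measure_unique (m1 m2 : {measure set (measurableTypeR R) -> \bar R}) :
  (m1 setT < +oo)%E ->
  (forall a : R, m1 `]-oo, a]%classic = m2 `]-oo, a]%classic) ->
  forall A : set (measurableTypeR R), measurable A -> m1 A = m2 A.
Proof.
move=> m1oo H.
apply: (@measure_unique _ R (measurableTypeR R) left_rays (fun k => `]-oo, k%:R]%classic)).
- exact: measurable_left_rays.
- move=> _ _ [x ->] [y ->]; exists (Num.min x y); apply/seteqP; split => z /=;
    rewrite !in_itv/= le_min; first by move=> [-> ->].
  by move=> /andP[-> ->].
- by move=> k; exists k%:R.
- apply/seteqP; split => // z _; have [k zk] := ray_in_itv z.
  by exists k => //=; rewrite in_itv.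
- by move=> _ [x ->]; exact: H.
- move=> k; apply: le_lt_trans m1oo; apply: le_measure; rewrite ?inE//.
Qed.

Definition quadrants : set (set (R * R)%type) :=
  [set A | exists a b, A = quadrant a b].

Lemma measurable_quadrants :
  @measurable _ (measurableTypeR R * measurableTypeR R)%type = <<s quadrants >>.
Proof.
apply/seteqP; split; last first.
  apply: smallest_sub; first exact: sigma_algebra_measurable.
  by move=> _ [a [b ->]]; exact: measurable_quadrant.
have q1 a : <<s quadrants >> (fst @^-1` `]-oo, a]%classic).
  rewrite (_ : fst @^-1` _ = \bigcup_k quadrant a k%:R).
    by apply: sigma_algebra_bigcup => k; apply: sub_sigma_algebra; exists a, k%:R.
  apply/seteqP; split => [[x y] /= xa|[x y] [k _ []]//].
  have [k yk] := ray_in_itv y; by exists k => //; split => //=; rewrite in_itv.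
have q2 a : <<s quadrants >> (snd @^-1` `]-oo, a]%classic).
  rewrite (_ : snd @^-1` _ = \bigcup_k quadrant k%:R a).
    by apply: sigma_algebra_bigcup => k; apply: sub_sigma_algebra; exists k%:R, a.
  apply/seteqP; split => [[x y] /= ya|[x y] [k _ []]//].
  have [k xk] := ray_in_itv x; by exists k => //; split => //=; rewrite in_itv.
have m1 : measurable_fun setT (fst : g_sigma_algebraType quadrants -> R).
  apply: (measurability _ measurable_left_rays).
  by move=> _ [_ [x ->] <-]; rewrite setTI; exact: q1.
have m2 : measurable_fun setT (snd : g_sigma_algebraType quadrants -> R).
  apply: (measurability _ measurable_left_rays).
  by move=> _ [_ [x ->] <-]; rewrite setTI; exact: q2.
apply: smallest_sub; first exact: smallest_sigma_algebra.
move=> _ [[A mA <-]|[A mA <-]].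
  by have := m1 measurableT A mA; rewrite setTI.
by have := m2 measurableT A mA; rewrite setTI.
Qed.

(** Quadrants form a pi-system that generates the Borel sets of the plane. *)
Lemma permuton_unique (mu nu : permuton R) :
  (forall a b, pcdf mu a b = pcdf nu a b) ->
  forall A : set (R * R)%type, measurable A -> mu A = nu A.
Proof.
move=> H.
apply: (@measure_unique _ R (R * R)%type quadrants (fun k => quadrant k%:R k%:R)).
- exact: measurable_quadrants.
- move=> _ _ [a [b ->]] [a' [b' ->]]; exists (Num.min a a'), (Num.min b b').
  apply/seteqP; split => -[x y]; rewrite /quadrant /= !in_itv/= !le_min.
    by move=> [[-> ->] [-> ->]].
  by move=> [/andP[-> ->] /andP[-> ->]].
- by move=> k; exists k%:R, k%:R.
- apply/seteqP; split => // -[x y] _.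
  have [k xk] := ray_in_itv x; have [l yl] := ray_in_itv y.
  exists (maxn k l) => //; split; rewrite /= in_itv/=.
    by rewrite (le_trans xk)// ler_nat leq_maxl.
  by rewrite (le_trans yl)// ler_nat leq_maxr.
- move=> _ [a [b ->]]; have mq := measurable_quadrant a b.
  exact: (etrans (prbE mu mq) (etrans (congr1 EFin (H a b)) (esym (prbE nu mq)))).
- move=> k; rewrite (@le_lt_trans _ _ 1%E) ?ltry//.
  by apply: probability_le1; exact: measurable_quadrant.
Qed.

Lemma permuton_eval_unique (mu nu : permuton R) :
  (forall a b, pcdf mu a b = pcdf nu a b) -> permuton_eval mu = permuton_eval nu.
Proof.
move=> /permuton_unique H; apply/funext => f; rewrite /permuton_eval.
congr fine; apply: eq_measure_integral => A mA _; exact: H.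
Qed.

End CdfUnique.

(** * Compactness of the space of permutons *)

Definition mfun_of d d' (T : measurableType d) (T' : measurableType d')
    (f : T -> T') (mf : measurable_fun setT f) : {mfun T >-> T'} :=
  HB.pack f (isMeasurableFun.Build _ _ _ _ f mf).

Section PermutonCompact.
Variable R : realType.

Lemma integral_clamp (mu : permuton R) (f : R * R -> R) :
  continuous f -> bmeas f ->
  \int[mu]_z f (clamp2 z) = \int[mu]_z f z.
Proof.
move=> cf bf; rewrite -[LHS]integral_square; last exact: bmeas_continuous_clamp.
rewrite -[RHS]integral_square//.
by apply: eq_Rintegral => z; rewrite inE => zS; rewrite clamp2_id.
Qed.

Lemma ramp_sandwich d (Om : measurableType d) (P : probability Om R)
    (X : Om -> R) (a e : R) : measurable_fun setT X -> 0 < e ->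
  prb P (X @^-1` `]-oo, a]%classic) <= \int[P]_w ramp a e (X w)
    <= prb P (X @^-1` `]-oo, a + e]%classic).
Proof.
move=> mX e0.
have mr b : measurable (X @^-1` `]-oo, b]%classic).
  by rewrite -[X in measurable X]setTI; exact: mX.
rewrite -!Rint_prb//; apply/andP; split; apply: Rint_le => //;
  try exact: bmeas_indic; try exact: bmeas_ramp.
  move=> w; rewrite indicE; case: (boolP (w \in _)) => [|_].
    by rewrite inE /= in_itv/= => h; rewrite ramp1.
  by have /andP[] := ramp01 a e (X w).
move=> w; rewrite indicE; case: (boolP (w \in _)) => [_|].
  by have /andP[] := ramp01 a e (X w).
by rewrite notin_setE /= in_itv/= => /negP; rewrite -ltNge => /ltW h; rewrite ramp0.
Qed.

Section marginal.
Variables (pr : R * R -> R) (cpr : continuous pr).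
Hypothesis mpr : measurable_fun setT (pr : (R * R)%type -> R).
Hypothesis prE : forall (mu : permuton R) (A : set R), measurable A ->
  prb mu (pr @^-1` A) = fine (lebesgue_measure (A `&` `[0%R, 1%R]%classic)).
Variables (F : set_system nat) (FU : UltraFilter F) (mu_ : nat -> permuton R).
Variables (T : measurableTypeR R -> R * R).
Hypothesis mT : measurable_fun setT (pr \o T : measurableTypeR R -> measurableTypeR R).
Hypothesis cT : forall f : R * R -> R, continuous f ->
  \int[mu_ n]_z f (clamp2 z) @[n --> F] --> \int[unif R]_u f (T u).

(** Half-lines are sandwiched between continuous ramps, and the uniform
    distribution function is Lipschitz, so that the error of the sandwich
    vanishes with the width of the ramps. *)
Lemma marginal_limit_cdf (a : R) :
  prb (unif R) ((pr \o T) @^-1` `]-oo, a]%classic) =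
  fine (lebesgue_measure (`]-oo, a]%classic `&` `[0%R, 1%R]%classic)).
Proof.
pose G (x : R) : R := fine (lebesgue_measure (`]-oo, x]%classic `&` `[0%R, 1%R]%classic)).
pose H x := prb (unif R) ((pr \o T) @^-1` `]-oo, x]%classic).
have mset (A : set R) : measurable A -> measurable (pr @^-1` A : set (R * R)%type).
  by move=> mA; rewrite -[X in measurable X]setTI; exact: mpr.
have Glip (x e : R) : 0 < e -> G (x + e) <= G x + e.
  move=> e0; rewrite /G -!(prE (mu_ 0%N))//.
  have xe : x <= x + e by lra.
  have := leb_strip xe; rewrite -(prE (mu_ 0%N))// addrAC subrr add0r => h.
  apply: le_trans (_ : _ <= prb (mu_ 0%N) (pr @^-1` `]-oo, x]%classic) +
     prb (mu_ 0%N) (pr @^-1` `]x, x + e]%classic)) _; last by rewrite lerD2l.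
  apply: le_trans _ (prbU_le _ _ _); [|exact: mset..].
  apply: prb_le; [exact: mset|by apply: measurableU; exact: mset|].
  move=> z /=; rewrite !in_itv/= => ze.
  by case: (leP (pr z) x) => zx; [left|right].
have L (x e : R) : 0 < e -> G x <= \int[unif R]_u ramp x e (pr (T u)) <= G (x + e).
  move=> e0.
  have crp : continuous (fun z : R * R => ramp x e (pr z)).
    by move=> z; apply: (continuous_cvg _ _ (@cpr z)); exact: continuous_ramp.
  have lim := cT crp.
  have nP n : G x <= \int[mu_ n]_z ramp x e (pr (clamp2 z)) <= G (x + e).
    rewrite (@integral_clamp (mu_ n) (fun z => ramp x e (pr z)))//; last first.
      exact: bmeas_ramp.
    have := ramp_sandwich (mu_ n) x mpr e0.
    by rewrite !prE.
  apply/andP; split; rewrite leNgt; apply/negP; rewrite -subr_gt0 => h.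
    have [n /=] := filter_ex (cvg_near_dist lim h).
    by have := nP n; rewrite ltr_norml; lra.
  have [n /=] := filter_ex (cvg_near_dist lim h).
  by have := nP n; rewrite ltr_norml; lra.
have HL (x e : R) : 0 < e -> H x <= \int[unif R]_u ramp x e (pr (T u)) <= H (x + e).
  by move=> e0; exact: (ramp_sandwich (unif R) x mT e0).
rewrite -/(G a) -/(H a); apply/eqP; rewrite -subr_eq0 -normr_le0 leNgt; apply/negP.
set e0 := Num.norm _ => e0_gt0.
pose e := e0 / 2; have e_gt0 : 0 < e by rewrite divr_gt0.
have := L a e e_gt0; have := HL a e e_gt0.
have := L (a - e) e e_gt0; have := HL (a - e) e e_gt0.
have := Glip a e e_gt0; have := Glip (a - e) e e_gt0.
rewrite !subrK => h1 h2 h3 h4 h5 h6.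
suff : e0 <= e by rewrite /e; lra.
by rewrite /e0 ler_norml; lra.
Qed.

Lemma marginal_limit (A : set R) : measurable A ->
  unif R ((pr \o T) @^-1` A) = lebesgue_measure (A `&` `[0%R, 1%R]%classic).
Proof.
move=> mA.
pose X := @mfun_of _ _ (measurableTypeR R) (measurableTypeR R) (pr \o T) mT.
pose m1 := distribution (unif R) X.
pose m2 := mrestr (@lebesgue_measure R) (measurable_itv `[0%R, 1%R]).
apply: (@real_measure_unique R m1 m2) => [|a|//].
  by rewrite (@le_lt_trans _ _ 1%E) ?ltry//; exact: probability_le1.
have h := marginal_limit_cdf a.
have mX : measurable ((pr \o T) @^-1` `]-oo, a]%classic).
  by rewrite -[X in measurable X]setTI; apply: mT => //; exact: measurable_itv.
transitivity (prb (unif R) ((pr \o T) @^-1` `]-oo, a]%classic))%:E.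
  exact: prbE.
rewrite h fineK// ge0_fin_numE// (@le_lt_trans _ _ (@lebesgue_measure R `[0%R, 1%R]%classic))//.
  by apply: le_measure; rewrite ?inE//; apply: measurableI; exact: measurable_itv.
by rewrite lebesgue_measure_itv/= lte_fin ltr01 ltry.
Qed.

End marginal.

(** Compactness of the space of permutons, along ultrafilters of indices: a
    limiting law on the square is produced on the unit interval by
    [coding_limit], and keeps uniform marginals. *)
Theorem permuton_compact (F : set_system nat) (mu_ : nat -> permuton R) :
  UltraFilter F -> (forall A, eventually A -> F A) ->
  exists nu : permuton R, mu_ @ F --> nu.
Proof.
move=> FU Foo.
have [T [K [TK mK cT]]] := coding_limit (@coding_square_rep R)
  (fun n => permuton_prob (mu_ n)) FU Foo
  (fun _ => @square_rep_code R) (fun _ => @measurable_square_code R).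
have cfst : continuous (fst : R * R -> R) by move=> z; exact: cvg_fst.
have csnd : continuous (snd : R * R -> R) by move=> z; exact: cvg_snd.
have m1 : measurable_fun setT (fst \o T : measurableTypeR R -> measurableTypeR R).
  exact: (coding_measurable_fun (@coding_square_rep R) TK mK cfst).
have m2 : measurable_fun setT (snd \o T : measurableTypeR R -> measurableTypeR R).
  exact: (coding_measurable_fun (@coding_square_rep R) TK mK csnd).
have mT : measurable_fun setT (T : measurableTypeR R -> (R * R)%type).
  exact/measurable_fun_pairP.
pose X := mfun_of mT.
pose nu0 : probability (R * R)%type R := distribution (unif R) X.
have n1 (A : set R) : measurable A ->
    pushforward nu0 fst A = lebesgue_measure (A `&` `[0%R, 1%R]%classic).
  by move=> mA; apply: (marginal_limit cfst _ (@prb_fst R) FU m1 cT mA) => //.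
have n2 (A : set R) : measurable A ->
    pushforward nu0 snd A = lebesgue_measure (A `&` `[0%R, 1%R]%classic).
  by move=> mA; apply: (marginal_limit csnd _ (@prb_snd R) FU m2 cT mA) => //.
exists (Permuton n1 n2).
apply/(initial_cvg (@permuton_eval R)); apply/ptws_cvg => f.
have -> : permuton_eval (Permuton n1 n2) f = \int[unif R]_u (sval f \o @clamp2 R) (T u).
  rewrite permuton_evalE /= /Rintegral; congr fine.
  rewrite integral_distribution//.
    by apply/measurable_EFinP; have [] := bmeas_test f.
  apply: (bmeas_integrable (unif R)); have := coding_bmeas (@coding_square_rep R) TK mK (@continuous_test_clamp R f).
  exact.
have e : (fun n => permuton_eval (mu_ n) f) =
    (fun n => \int[mu_ n]_z (sval f \o @clamp2 R) (clamp2 z)).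
  apply/funext => n; rewrite permuton_evalE.
  by apply: eq_Rintegral => z _ /=; rewrite (clamp2_id (clamp2_square z)).
change ((fun n => permuton_eval (mu_ n) f) @ F -->
  \int[unif R]_u (sval f \o @clamp2 R) (T u)).
by rewrite e; exact: cT _ (@continuous_test_clamp R f).
Qed.

End PermutonCompact.

(** * Coding of permutons *)

Lemma cvg_along (R : realType) (I : Type) (T : topologicalType) (f : T -> R)
    (F : set_system I) (x_ : I -> T) (l : T) :
  continuous f -> x_ @ F --> l -> f (x_ n) @[n --> F] --> f l.
Proof. by move=> cf xl; exact: (cvg_comp _ _ xl (cf l)). Qed.

Section PermutonCode.
Variable R : realType.
Implicit Types (mu nu : permuton R).

Lemma pcdf_clamp mu (a b : R) : pcdf mu a b = pcdf mu (Num.min 1 a) (Num.min 1 b).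
Proof.
apply/eqP; rewrite -subr_eq0 -normr_le0 -(prb_off_square mu).
apply: prb_dist; [exact: measurable_quadrant..|exact: measurableC (@measurable_square R)|].
move=> [x y] /contrapT [/=]; rewrite /quadrant /= !in_itv/= => /andP[_ x1] /andP[_ y1].
by rewrite !le_min x1 y1.
Qed.

Lemma pcdf_eq_square mu nu :
  (forall a b : R, 0 <= a <= 1 -> 0 <= b <= 1 -> pcdf mu a b = pcdf nu a b) ->
  forall a b : R, pcdf mu a b = pcdf nu a b.
Proof.
move=> H a b; have [a0|a0] := ltP a 0; first by rewrite !pcdf_neg//; left.
have [b0|b0] := ltP b 0; first by rewrite !pcdf_neg//; right.
rewrite pcdf_clamp [RHS]pcdf_clamp; apply: H.
  by rewrite minEle; case: ifP; lra.
by rewrite minEle; case: ifP; lra.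
Qed.

Definition gridpt (m i : nat) : R := i%:R / m.+1%:R.

Definition cell_index (n : nat) (a : R) : nat := Num.truncn (a * n.+1%:R).

Lemma cell_index_near n (a : R) : 0 <= a ->
  gridpt n (cell_index n a) <= a <= gridpt n (cell_index n a) + n.+1%:R^-1.
Proof.
move=> a0; rewrite /gridpt /cell_index.
have m0 : 0 < n.+1%:R :> R by rewrite ltr0n.
have am : 0 <= a * n.+1%:R by rewrite mulr_ge0.
rewrite -{3}[n.+1%:R^-1]mul1r -mulrDl ler_pdivrMr// ler_pdivlMr//.
by rewrite truncn_le natr1 am /= ltW// truncnS_gt.
Qed.

Lemma cell_index_le n (a : R) : 0 <= a <= 1 -> (cell_index n a <= n.+1)%N.
Proof.
move=> /andP[a0 a1]; have /andP[h _] := cell_index_near n a0.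
rewrite -(ler_nat R); have m0 : 0 < n.+1%:R :> R by rewrite ltr0n.
by move: h; rewrite /gridpt ler_pdivrMr// => h; apply: le_trans h _; rewrite ler_piMl// ltW.
Qed.

Lemma inv_nat_small (e : R) : 0 < e -> exists m : nat, m.+1%:R^-1 < e.
Proof.
move=> e0; exists (Num.truncn e^-1).
by rewrite -[X in _ < X]invrK ltf_pV2 ?posrE ?invr_gt0 ?ltr0n// truncnS_gt.
Qed.

Lemma pcdf_grid_close mu nu (m : nat) (del : R) :
  (forall i j : nat, (i <= m.+1)%N -> (j <= m.+1)%N ->
    `|pcdf mu (gridpt m i) (gridpt m j) - pcdf nu (gridpt m i) (gridpt m j)| <= del) ->
  forall a b : R, 0 <= a <= 1 -> 0 <= b <= 1 ->
    `|pcdf mu a b - pcdf nu a b| <= del + 4 * m.+1%:R^-1.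
Proof.
move=> H a b ha hb; have /andP[a0 _] := ha; have /andP[b0 _] := hb.
have ia := cell_index_near m a0; have jb := cell_index_near m b0.
have hi := cell_index_le m ha; have hj := cell_index_le m hb.
move: ia jb hi hj; set i := cell_index m a; set j := cell_index m b.
move=> ia jb hi hj.
have v0 : 0 < m.+1%:R^-1 :> R by rewrite invr_gt0 ltr0n.
move: H ia jb v0; set v : R := m.+1%:R^-1 => H ia jb v0.
have h1 := H i j hi hj.
have h2 := pcdf_lipschitz mu a b (gridpt m i) (gridpt m j).
have h3 := pcdf_lipschitz nu a b (gridpt m i) (gridpt m j).
have e1 : `|a - gridpt m i| <= v by rewrite ler_norml; lra.
have e2 : `|b - gridpt m j| <= v by rewrite ler_norml; lra.
have h2' := le_trans h2 (lerD e1 e2).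
have h3' := le_trans h3 (lerD e1 e2).
move: h1 h2' h3'; rewrite !ler_norml; lra.
Qed.

Lemma pcdf_eq_grid mu nu :
  (forall m i j : nat, pcdf mu (gridpt m i) (gridpt m j) = pcdf nu (gridpt m i) (gridpt m j)) ->
  forall a b : R, pcdf mu a b = pcdf nu a b.
Proof.
move=> H; apply: pcdf_eq_square => a b ha hb.
apply/eqP; rewrite -subr_eq0 -normr_le0 leNgt; apply/negP => h.
have h4 : 0 < `|pcdf mu a b - pcdf nu a b| / 4 by rewrite divr_gt0.
have [m hm] := inv_nat_small h4.
have := @pcdf_grid_close mu nu m 0 _ a b ha hb.
have H' : forall i j : nat, (i <= m.+1)%N -> (j <= m.+1)%N ->
    `|pcdf mu (gridpt m i) (gridpt m j) - pcdf nu (gridpt m i) (gridpt m j)| <= 0.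
  by move=> i j _ _; rewrite H subrr normr0.
by move=> /(_ H'); move: hm; move: (m.+1%:R^-1) => v; lra.
Qed.

(** Permutons that agree on measurable sets may differ elsewhere, so that the
    distribution function determines a permuton only up to topological
    inseparability. *)
Lemma permuton_cvg_indist (F : set_system nat) (mu_ : nat -> permuton R) mu nu :
  Filter F -> (forall a b : R, pcdf mu a b = pcdf nu a b) -> mu_ @ F --> mu -> mu_ @ F --> nu.
Proof.
move=> FF e /(initial_cvg (@permuton_eval R)) h.
by apply/(initial_cvg (@permuton_eval R)); rewrite -(permuton_eval_unique e).
Qed.

Lemma permuton_indist_cont (f : permuton R -> R) mu nu :
  continuous f -> (forall a b : R, pcdf mu a b = pcdf nu a b) -> f mu = f nu.
Proof.
move=> cf e.
have h : (fun _ : nat => mu) @ \oo --> nu.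
  by apply: permuton_cvg_indist e _; exact: cvg_cst.
have h2 : f ((fun _ : nat => mu) n) @[n --> \oo] --> f nu.
  exact: (cvg_along cf h).
by apply/esym/(rcvg_cst h2).
Qed.

(** A permuton is coded by the expansions of the values of its distribution
    function at all points with rational coordinates. *)
Definition permuton_rep (om : nat -> bool) mu := forall t : nat * nat * nat,
  binary_rep (subcode (pickle t) om) (pcdf mu (gridpt t.1.1 t.1.2) (gridpt t.1.1 t.2)).

Definition permuton_code mu : nat -> bool := vector_code (fun n =>
  if unpickle n is Some t then pcdf mu (gridpt t.1.1 t.1.2) (gridpt t.1.1 t.2) else 0).

Lemma permuton_rep_code mu : permuton_rep (permuton_code mu) mu.
Proof.
move=> [[m i] j]; rewrite /permuton_code subcode_vector pickleK /=.
by apply: binary_rep_bits; exact: pcdf01.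
Qed.

(** The set of codes is closed because the space of permutons is compact. *)
Lemma coding_permuton_rep : coding permuton_rep.
Proof.
move=> F om_ om mu_ FU Foo omP rP.
have [nu nuP] := permuton_compact mu_ FU Foo.
have cP (a b : R) : pcdf (mu_ n) a b @[n --> F] --> pcdf nu a b.
  exact: (cvg_along (@continuous_pcdf R a b) nuP).
have rnu : permuton_rep om nu.
  move=> t.
  have [l [rl cl]] := @binary_rep_limit R F (fun j => subcode (pickle t) (om_ j))
    (subcode (pickle t) om)
    (fun j => pcdf (mu_ j) (gridpt t.1.1 t.1.2) (gridpt t.1.1 t.2))
    FU (fun m => omP _) (fun j => rP j t).
  by rewrite -(rcvg_unique cl (cP _ _)).
split; first by exists nu.
move=> mu rmu; apply: permuton_cvg_indist nuP => // a b.
apply: pcdf_eq_grid => m i j.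
exact: binary_rep_inj (rnu (m, i, j)) (rmu (m, i, j)).
Qed.

Lemma permuton_continuous_bounded (f : permuton R -> R) :
  continuous f -> exists M : R, forall mu, `|f mu| <= M.
Proof.
move=> cf; have [M MP] := coding_bounded coding_permuton_rep cf.
by exists M => mu; exact: MP (permuton_rep_code mu).
Qed.

(** Permutons whose distribution functions agree more and more closely on finer
    and finer grids have inseparable limits, by compactness; hence no continuous
    [f] can tell them apart by a fixed amount. *)
Lemma permuton_modulus (f : permuton R -> R) (e : R) : continuous f -> 0 < e ->
  exists m : nat, forall mu nu,
    (forall i j : nat, (i <= m.+1)%N -> (j <= m.+1)%N ->
      `|pcdf mu (gridpt m i) (gridpt m j) - pcdf nu (gridpt m i) (gridpt m j)|
        <= m.+1%:R^-1) ->
    `|f mu - f nu| <= e.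
Proof.
move=> cf e0; apply: contrapT => /forallNP H.
have {}H m : exists z : permuton R * permuton R,
    (forall i j : nat, (i <= m.+1)%N -> (j <= m.+1)%N ->
      `|pcdf z.1 (gridpt m i) (gridpt m j) - pcdf z.2 (gridpt m i) (gridpt m j)|
        <= m.+1%:R^-1) /\ e < `|f z.1 - f z.2|.
  apply: contrapT => /forallNP H'; apply: (H m) => mu nu h.
  rewrite leNgt; apply/negP => h4; exact: (H' (mu, nu)).
have [z zP] := choice H.
have [F [FU Foo]] := ultra_eventually.
have [mu muP] := permuton_compact (fun m => (z m).1) FU Foo.
have [nu nuP] := permuton_compact (fun m => (z m).2) FU Foo.
have eqp : forall a b : R, pcdf mu a b = pcdf nu a b.
  apply: pcdf_eq_square => a b ha hb.
  apply/eqP; rewrite -subr_eq0 -normr_le0 leNgt; apply/negP => h.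
  set del := Num.norm _ in h.
  have d3 : 0 < del / 3 by rewrite divr_gt0.
  have d15 : 0 < del / 15 by rewrite divr_gt0.
  have c1 : pcdf (z n).1 a b @[n --> F] --> pcdf mu a b.
    exact: (cvg_along (@continuous_pcdf R a b) muP).
  have c2 : pcdf (z n).2 a b @[n --> F] --> pcdf nu a b.
    exact: (cvg_along (@continuous_pcdf R a b) nuP).
  have [m0 hm0] := inv_nat_small d15.
  have hF : F [set m | (m0 <= m)%N] by apply: Foo; exact: nbhs_infty_ge.
  have [m /= [h1 [h2 h3]]] := filter_ex (filterI (cvg_near_dist c1 d3)
    (filterI (cvg_near_dist c2 d3) hF)).
  have := pcdf_grid_close (zP m).1 ha hb.
  have hm : m.+1%:R^-1 <= m0.+1%:R^-1 :> R by rewrite lef_pV2 ?posrE ?ltr0n// ler_nat.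
  have : del <= `|pcdf mu a b - pcdf (z m).1 a b| +
      (`|pcdf (z m).1 a b - pcdf (z m).2 a b| + `|pcdf nu a b - pcdf (z m).2 a b|).
    rewrite (le_trans (ler_distD (pcdf (z m).1 a b) _ _))// lerD2l.
    rewrite (le_trans (ler_distD (pcdf (z m).2 a b) _ _))// lerD2l.
    by rewrite distrC.
  move: (m.+1%:R^-1) (m0.+1%:R^-1) hm0 hm h1 h2 => v v0; lra.
have l1 : f (z n).1 @[n --> F] --> f mu by exact: (cvg_along cf muP).
have l2 : f (z n).2 @[n --> F] --> f nu by exact: (cvg_along cf nuP).
rewrite -(permuton_indist_cont cf eqp) in l2.
have e2 : 0 < e / 2 by rewrite divr_gt0.
have [m /= [h1 h2]] := filter_ex (filterI (cvg_near_dist l1 e2) (cvg_near_dist l2 e2)).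
have := (zP m).2; apply/negP; rewrite -leNgt.
rewrite [e]splitr (le_trans (ler_distD (f mu) _ _))// lerD// ltW//.
by rewrite distrC.
Qed.

End PermutonCode.

(** * Random elements and convergence in distribution *)

Lemma measurable_fun_borel (S : ptopologicalType) d (Om : measurableType d)
    (f : Om -> borel S) :
  (forall O : set S, open O -> measurable (f @^-1` O)) -> measurable_fun setT f.
Proof.
move=> H; apply: (@measurability _ _ _ (borel S) _ _ (@open S)) => //.
by move=> _ [U oU <-]; rewrite setTI; exact: H.
Qed.

Section RandomElements.
Context (R : realType) (S : ptopologicalType).

Lemma rv_open d (Om : measurableType d) (P : probability Om R)
    (X : {RV P >-> borel S}) (O : set S) : open O -> measurable (X @^-1` O).
Proof.
move=> oO; rewrite -[X in measurable X]setTI; apply: measurable_funP => //.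
exact: sub_sigma_algebra.
Qed.

Lemma bmeas_rv d (Om : measurableType d) (P : probability Om R)
    (X : {RV P >-> borel S}) (f : S -> R) :
  continuous f -> (exists M, forall s, `|f s| <= M) -> bmeas (fun w => f (X w)).
Proof.
move=> cf [M fM]; split; last by exists M => w.
apply: (measurability _ (RGenOInfty.measurableE R)).
move=> _ [_ [x ->] <-]; rewrite setTI (_ : _ @^-1` _ = X @^-1` (f @^-1` `]x, +oo[%classic))//.
by apply: rv_open; apply: open_comp => // *; exact: cf.
Qed.

Lemma cvg_in_distP (d : nat -> measure_display) (Om : forall n, measurableType (d n))
    (P : forall n, probability (Om n) R) (X : forall n, {RV (P n) >-> borel S})
    (d' : measure_display) (Om' : measurableType d') (P' : probability Om' R)
    (Y : {RV P' >-> borel S}) :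
  cvg_in_dist P X P' Y <->
  forall f : S -> R, continuous f -> (exists M, forall s, `|f s| <= M) ->
  \int[P n]_w f (X n w) @[n --> \oo] --> \int[P']_w f (Y w).
Proof.
split=> H f cf bf; have := H f cf bf.
  rewrite (expectationE P' (bmeas_rv Y cf bf)).
  rewrite (_ : (fun n => 'E_(P n)[fun w => f (X n w)]%E) =
               EFin \o (fun n => \int[P n]_w f (X n w))).
    by move/fine_cvgP => [_].
  by apply/funext => n; rewrite (expectationE (P n) (bmeas_rv (X n) cf bf)).
rewrite (expectationE P' (bmeas_rv Y cf bf)).
rewrite (_ : (fun n => 'E_(P n)[fun w => f (X n w)]%E) =
               EFin \o (fun n => \int[P n]_w f (X n w))).
  by move=> h; apply/fine_cvgP; split => //; exact: nearW.
by apply/funext => n; rewrite (expectationE (P n) (bmeas_rv (X n) cf bf)).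
Qed.

End RandomElements.

Lemma discrete_rv_measurable (R : realType) (T : pdiscreteTopologicalType)
    d (Om : measurableType d) (P : probability Om R) (X : {RV P >-> borel T}) (B : set T) :
  measurable (X @^-1` B).
Proof. by apply: rv_open; exact: discrete_open. Qed.

Section LimitPermuton.
Context (R : realType) (d : nat -> measure_display) (Om : forall n, measurableType (d n))
  (P : forall n, probability (Om n) R) (sigma : forall n, {RV (P n) >-> borel 'S_n.+1}).

(** The limits of the expectations are those of an actual random permuton,
    because laws on the coded space of permutons have limits along
    ultrafilters. *)
Theorem permuton_limit_exists :
  (forall f : permuton R -> R, continuous f ->
     exists l : R, \int[P n]_w f (perm_permuton R (sigma n w)) @[n --> \oo] --> l) ->
  exists mu : {RV (unif R) >-> borel (permuton R)},
    cvg_in_dist P (fun n => discrete_comp (@perm_permuton R n) (sigma n)) (unif R) mu.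
Proof.
move=> H; have [F [FU Foo]] := ultra_eventually.
have mk n m s : measurable [set w : Om n | pre (permuton_code (perm_permuton R (sigma n w))) m = s].
  exact: (discrete_rv_measurable (sigma n) [set t | pre (permuton_code (perm_permuton R t)) m = s]).
have [T [K [TK mK cT]]] := coding_limit (@coding_permuton_rep R) P FU Foo
  (fun n w => permuton_rep_code (perm_permuton R (sigma n w))) mk.
have mT : measurable_fun setT (T : measurableTypeR R -> borel (permuton R)).
  apply: measurable_fun_borel => O oO.
  exact: (coding_measurable_open (@coding_permuton_rep R) TK mK oO).
exists (mfun_of mT); apply/cvg_in_distP => f cf _ /=.
have [l hl] := H f cf.
suff <- : l = \int[unif R]_w f (T w) by [].
apply: rcvg_unique (cT f cf).
by move=> A /hl; exact: Foo.
Qed.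

End LimitPermuton.

(** * The permuton of a permutation *)

Section PermPermuton.
Variables (R : realType) (n : nat) (s : 'S_n.+1).
Local Notation N := (n.+1%:R : R).
Local Notation mu := (perm_permuton R s).

Definition slab (i : nat) : set R := `]i%:R / N, i.+1%:R / N]%classic.
Definition graph_square (i : 'I_n.+1) : set (R * R)%type := slab i `*` slab (s i).

Let N0 : 0 < N. Proof. by rewrite ltr0n. Qed.

Lemma measurable_slab i : measurable (slab i).
Proof. exact: measurable_itv. Qed.

Lemma measurable_graph_square i : measurable (graph_square i).
Proof. by apply: measurableX; exact: measurable_slab. Qed.

Lemma ceil_slab (x : R) i : slab i x -> Num.ceil (x * N) = i.+1%:Z.
Proof.
rewrite /slab /= in_itv/= ltr_pdivrMr// ler_pdivlMr// => h.
apply/eqP; rewrite ceil_eq (_ : i.+1%:Z - 1 = i%:Z)//.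
by rewrite -addn1 PoszD addrK.
Qed.

Lemma slab_inj (x : R) (i j : nat) : slab i x -> slab j x -> i = j.
Proof. by move=> /ceil_slab h1 /ceil_slab; rewrite h1 => -[]. Qed.

Lemma leb_slab i : @lebesgue_measure R (slab i) = (N^-1)%:E.
Proof.
rewrite /slab lebesgue_measure_itv/= lte_fin ltr_pM2r ?invr_gt0// ltr_nat ltnSn.
by rewrite -EFinD -mulrBl -natrB// subSnn mul1r.
Qed.

Lemma prb_graph_square i : prb mu (graph_square i) = N^-1.
Proof.
have e : mu (graph_square i) = (\int[@lebesgue_measure R \x @lebesgue_measure R]_(z in graph_square i) (N)%:E)%E.
  apply: eq_integral => z; rewrite inE => -[z1 z2]; congr EFin.
  rewrite /perm_density (_ : [exists _, _] = true) ?mulr1//.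
  by apply/existsP; exists i; rewrite (ceil_slab z1) (ceil_slab z2) !eqxx.
rewrite /prb e integral_cst; last exact: measurable_graph_square.
rewrite [X in (_ * X)%E](_ : _ = (N^-1 * N^-1)%:E).
  by rewrite /= mulVKf// gt_eqF.
have := @product_measure1E _ _ _ _ R (@lebesgue_measure R) (@lebesgue_measure R) (slab i) (slab (s i)) (measurable_slab _) (measurable_slab _).
move=> e2; exact: (etrans e2 (congr2 mule (leb_slab i) (leb_slab (s i)))).
Qed.

Lemma prb_graph_ge (D : pred 'I_n.+1) (A : set (R * R)%type) : measurable A ->
  (forall i, D i -> graph_square i `<=` A) -> #|D|%:R / N <= prb mu A.
Proof.
move=> mA DA.
have mind i : bmeas (\1_(graph_square i) : (R * R)%type -> R).
  by apply: bmeas_indic; exact: measurable_graph_square.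
have -> : #|D|%:R / N = \int[mu]_z (\sum_(i <- enum D) \1_(graph_square i) z).
  rewrite Rint_sum// big_enum/=.
  rewrite (eq_bigr (fun=> N^-1)); last first.
    by move=> i _; rewrite Rint_prb ?prb_graph_square//; exact: measurable_graph_square.
  by rewrite sumr_const mulr_natl.
rewrite -Rint_prb//; apply: Rint_le => [||z]; [exact: bmeas_sum|exact: bmeas_indic|].
rewrite big_enum/=.
have [[i [Di iz]]|no] := pselect (exists i, D i /\ graph_square i z).
  rewrite (bigD1 i)//= big1 ?addr0; last first.
    move=> j /andP[_ ji]; rewrite indicE memNset// => -[jz _].
    by move/eqP: ji; apply; apply: ord_inj; exact: slab_inj jz (proj1 iz).
  by rewrite !indicE !mem_set//; exact: DA iz.
rewrite big1 => [|i Di]; first by rewrite indicE.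
by rewrite indicE memNset// => iz; apply: no; exists i.
Qed.

(** The squares of the graph carry all the mass, so that the lower bounds for
    [A] and for its complement add up to 1 and are equalities. *)
Lemma prb_graph (A : set (R * R)%type) (D : pred 'I_n.+1) : measurable A ->
  (forall i, D i -> graph_square i `<=` A) ->
  (forall i, ~~ D i -> graph_square i `&` A = set0) ->
  prb mu A = #|D|%:R / N.
Proof.
move=> mA DA DnA; apply/eqP; rewrite eq_le prb_graph_ge// andbT.
have h : #|[predC D]|%:R / N <= prb mu (~` A).
  apply: prb_graph_ge; first exact: measurableC.
  by move=> i /= Di z iz Az; have := DnA i Di; rewrite -subset0 => /(_ z); apply.
have := prbU mu mA (measurableC mA) (setICr A).
rewrite setUv prbT => e.
have := cardC D; rewrite card_ord => /(congr1 (fun k => k%:R / N : R)).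
rewrite natrD mulrDl divff ?gt_eqF// => e2.
rewrite -(lerD2r (#|[predC D]|%:R / N)).
apply: (@le_trans _ _ (prb mu A + prb mu (~` A))); first by rewrite lerD2l.
by rewrite -e -[X in X <= _]e2.
Qed.

Lemma pcdf_graph (i j : nat) : (i <= n.+1)%N -> (j <= n.+1)%N ->
  pcdf mu (i%:R / N) (j%:R / N) =
  #|[pred r : 'I_n.+1 | (r < i)%N && (s r < j)%N]|%:R / N.
Proof.
move=> iN jN; apply: prb_graph; first exact: measurable_quadrant.
  move=> r /andP[ri sj] [x y] [/=]; rewrite /slab /= !in_itv/= => /andP[_ h1] /andP[_ h2].
  split; rewrite /= in_itv/=.
    by rewrite (le_trans h1)// ler_pM2r ?invr_gt0// ler_nat.
  by rewrite (le_trans h2)// ler_pM2r ?invr_gt0// ler_nat.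
move=> r /= /nandP h; apply/seteqP; split => // -[x y] [[/=]].
rewrite /slab /= !in_itv/= => /andP[h1 _] /andP[h2 _] [/=]; rewrite !in_itv/= => h3 h4.
case: h; rewrite -leqNgt => h.
  by have := lt_le_trans h1 h3; rewrite ltr_pM2r ?invr_gt0// ltr_nat ltnNge h.
by have := lt_le_trans h2 h4; rewrite ltr_pM2r ?invr_gt0// ltr_nat ltnNge h.
Qed.

End PermPermuton.

(** * Ranks and patterns *)

Section Patterns.

(** The rank of an entry is the number of smaller entries. *)
Lemma std_lt (disp : Order.disp_t) (T : orderType disp) (k : nat) (v : 'I_k -> T) :
  injective v -> forall i j, (std v i < std v j)%N = (v i < v j)%O.
Proof.
move=> vi; rewrite /std; case: pickP => [s /= /forallP sP i j|no].
  by have /forallP/(_ j)/eqP := sP i.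
have rk_lt i : (#|[pred j | (v j < v i)%O]| < k)%N.
  rewrite -[X in (_ < X)%N](card_ord k); apply: proper_card; apply/properP; split.
    by apply/fintype.subsetP => t.
  by exists i => //; rewrite inE /= ltxx.
pose rk i := Ordinal (rk_lt i).
have rkP i j : (rk i < rk j)%N = (v i < v j)%O.
  have [ij|ji] := ltP (v i) (v j).
    apply: proper_card; apply/properP; split.
      by apply/fintype.subsetP => t; rewrite !inE /= => ti; exact: lt_trans ij.
    by exists i; rewrite !inE /= ?ltxx.
  apply/negbTE; rewrite -leqNgt; apply: subset_leq_card.
  by apply/fintype.subsetP => t; rewrite !inE /= => tj; exact: lt_le_trans ji.
have rki : injective rk.
  move=> i j e; apply: vi; apply/eqP; rewrite eq_le !leNgt -!rkP e.
  by rewrite ltnn.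
have /negP[] := no (perm rki).
by apply/forallP => i; apply/forallP => j; rewrite !permE rkP.
Qed.

Lemma card_ord_lt (k m : nat) : (m <= k)%N -> #|[pred t : 'I_k | (t < m)%N]| = m.
Proof.
move=> mk; rewrite -sum1_card (eq_bigl (fun t : 'I_k => (t < m)%N))//.
by rewrite (big_ord_narrow mk) sum1_card card_ord.
Qed.

Lemma card_perm_lt (k m : nat) (f : 'S_k) : (m <= k)%N ->
  #|[pred t : 'I_k | (f t < m)%N]| = m.
Proof.
move=> mk; rewrite -[RHS](card_ord_lt mk) -!sum1_card.
by rewrite [RHS](reindex_inj (@perm_inj _ f)).
Qed.

(** Values and ranks are ordered alike, so that the indices below a threshold in
    value are those below a threshold in rank, namely their number. *)
Lemma rank_threshold (k : nat) (f : 'S_k) (w : 'I_k -> nat) (j : nat) :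
  (forall t r, (f t < f r)%N = (w t < w r)%N) ->
  forall r, (f r < #|[pred t | (w t < j)%N]|)%N = (w r < j)%N.
Proof.
move=> fw r.
have fr : #|[pred t : 'I_k | (w t < w r)%N]| = f r.
  by rewrite -[RHS](card_perm_lt f (ltnW (ltn_ord (f r)))); apply: eq_card => t; rewrite !inE fw.
rewrite -fr; have [rj|jr] := ltnP (w r) j.
  apply: proper_card; apply/properP; split.
    by apply/fintype.subsetP => t; rewrite !inE => /ltn_trans; apply.
  by exists r; rewrite !inE ?ltnn.
apply/negbTE; rewrite -leqNgt; apply: subset_leq_card.
by apply/fintype.subsetP => t; rewrite !inE => /leq_trans; apply.
Qed.

Section Pattern.
Variables (n k : nat) (I : {set 'I_n.+1}) (s : 'S_n.+1).
Hypothesis cI : #|I| = k.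

Definition elt (i : 'I_k) : 'I_n.+1 := nth ord0 (enum I) i.

Lemma size_enumI : size (enum I) = k. Proof. by rewrite -cardE. Qed.

Lemma elt_lt (i j : 'I_k) : (elt i < elt j)%N = (i < j)%N.
Proof.
pose lto (x y : 'I_n.+1) := (x < y)%N.
have ltT : transitive lto by move=> x y z; exact: ltn_trans.
have srt : sorted lto (enum I).
  have -> : enum I = [seq x <- enum 'I_n.+1 | x \in I] by rewrite enumT.
  apply: sorted_filter => //.
  by have := iota_ltn_sorted 0 n.+1; rewrite -val_enum_ord sorted_map.
have mono := sorted_ltn_nth ltT ord0 srt.
have mono' (a b : 'I_k) : (a < b)%N -> (elt a < elt b)%N.
  by move=> ab; apply: mono; rewrite // inE size_enumI.
have [ij|ji] := ltnP i j; first exact: mono'.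
apply/negbTE; rewrite -leqNgt; move: ji; rewrite leq_eqVlt => /predU1P[/val_inj->//|ji].
exact/ltnW/mono'.
Qed.

Lemma elt_inj : injective elt.
Proof.
move=> i j e; apply/val_inj/eqP; rewrite /= eqn_leq.
by rewrite leqNgt -elt_lt e ltnn leqNgt -elt_lt e ltnn.
Qed.

Lemma card_elt (Q : pred 'I_n.+1) : #|[pred i | Q (elt i)]| = #|[pred x in I | Q x]|.
Proof.
rewrite -(card_imset _ elt_inj); apply: eq_card => x; rewrite !inE.
apply/imsetP/andP.
  move=> [i]; rewrite inE => Qi ->; split=> //.
  by rewrite -mem_enum mem_nth// size_enumI.
move=> [xI Qx]; have xs : (index x (enum I) < k)%N by rewrite -size_enumI index_mem mem_enum.
have e : x = elt (Ordinal xs) by rewrite /elt nth_index// mem_enum.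
by exists (Ordinal xs) => //; rewrite inE -e.
Qed.

Lemma pat_lt (i j : 'I_k) :
  (pat k I s i < pat k I s j)%N = (s (elt i) < s (elt j))%N.
Proof.
have vE (t : 'I_k) : nth 0%N [seq val (s j) | j <- enum I] t = val (s (elt t)).
  by rewrite (nth_map ord0)// size_enumI.
rewrite /pat std_lt ?vE//.
move=> a b; rewrite !vE => /val_inj/perm_inj; exact: elt_inj.
Qed.

(** Position and value thresholds of the permutation turn into numbers of
    sampled points in the pattern. *)
Lemma pat_count (i j : nat) :
  #|[pred r : 'I_k | (r < #|[pred x in I | (x < i)%N]|)%N &&
     (pat k I s r < #|[pred x in I | (s x < j)%N]|)%N]| =
  #|[pred x in I | (x < i)%N && (s x < j)%N]|.
Proof.
rewrite -(card_elt (fun x => (x < i)%N && (s x < j)%N)).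
rewrite -(card_elt (fun x => (x < i)%N)) -(card_elt (fun x => (s x < j)%N)).
apply: eq_card => r; rewrite !inE; congr (_ && _).
  have := @rank_threshold k 1%g (fun t => elt t) i _ r.
  by rewrite perm1; apply => t u; rewrite !perm1 elt_lt.
by apply: (@rank_threshold k (pat k I s) (fun t => s (elt t))) => t u; rewrite pat_lt.
Qed.

End Pattern.
End Patterns.

(** * Second moments of uniform subsets *)

Section Hypergeometric.

Lemma card_supersets (T : finType) (B : {set T}) (K : nat) : (#|B| <= K)%N ->
  #|[set I : {set T} | (#|I| == K) && (B \subset I)]%SET| = 'C(#|T| - #|B|, K - #|B|).
Proof.
move=> BK; have -> : (#|T| - #|B|)%N = #|finset.setC B| by rewrite -(cardsC B) addKn.
rewrite -cards_draws -[RHS](@card_in_imset _ _ (fun J : {set T} => B :|: J)%SET).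
  apply: eq_card => I; rewrite inE; apply/andP/imsetP.
    move=> [/eqP cI BI]; exists (I :\: B)%SET; last first.
      by rewrite -{1}(finset.setIidPr BI) finset.setID.
    rewrite inE cardsD (finset.setIidPr BI) cI eqxx andbT.
    by apply/fintype.subsetP => x; rewrite !inE => /andP[].
  move=> [J]; rewrite inE => /andP[JB /eqP cJ] ->; split; last exact: finset.subsetUl.
  have dis : (B :&: J = finset.set0)%SET.
    by apply/eqP; rewrite finset.setI_eq0 disjoint_sym finset.disjoints_subset.
  by rewrite cardsU dis cards0 subn0 cJ subnKC.
move=> J J'; rewrite !inE => /andP[JB _] /andP[JB' _] e.
have D (L : {set T}) : L \subset finset.setC B -> ((B :|: L) :\: B = L)%SET.
  move=> LB; rewrite finset.setDUl finset.setDv finset.set0U.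
  by apply/finset.setDidPl; rewrite finset.disjoints_subset.
by rewrite -(D _ JB) e D.
Qed.

Lemma sum_bool_card (T : finType) (Q Q' : pred T) :
  (\sum_(t | Q t) (Q' t : nat))%N = #|[set t | Q t && Q' t]%SET|.
Proof.
rewrite -sum1dep_card big_mkcondr; apply: eq_bigr => t _; by case: (Q' t).
Qed.

Lemma second_moment_algebra (R : realType) (S a k M c : R) : 0 < k -> 0 < M -> 0 <= c ->
  a <= M -> S <= a * (c * k / M) + a ^+ 2 * (c * (k / M) ^+ 2) ->
  S / k ^+ 2 - 2 * (a / M) / k * (a * (c * k / M)) + (a / M) ^+ 2 * c <= c / k.
Proof.
move=> k0 M0 c0 aM hS.
have kn : k != 0 by rewrite gt_eqF.
have Mn : M != 0 by rewrite gt_eqF.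
have K2 : 0 < k ^+ 2 by rewrite exprn_gt0.
have h : S / k ^+ 2 <= (a / M) * (c / k) + (a / M) ^+ 2 * c.
  rewrite ler_pdivrMr//; apply: le_trans hS _.
  by rewrite le_eqVlt; apply/orP; left; apply/eqP; field; rewrite Mn kn.
have h2 : a / M * (c / k) <= c / k.
  by rewrite ler_piMl// ?ler_pdivrMr ?mul1r// divr_ge0// ltW.
have -> : 2 * (a / M) / k * (a * (c * k / M)) = 2 * ((a / M) ^+ 2 * c).
  by field; rewrite Mn kn.
by move: h h2; lra.
Qed.

Variables (R : realType) (n K : nat).
Hypothesis K0 : (0 < K)%N.
Hypothesis KN : (K <= n.+1)%N.
Local Notation N := (n.+1%:R : R).

Definition nsub : R := ('C(n.+1, K))%:R.

Lemma sum_mem1 (x : 'I_n.+1) :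
  \sum_(I : {set 'I_n.+1} | #|I| == K) ((x \in I)%:R : R) = nsub * K%:R / N.
Proof.
rewrite -natr_sum sum_bool_card.
have -> : #|[set I : {set 'I_n.+1} | (#|I| == K) && (x \in I)]%SET| = 'C(n, K.-1).
  have := @card_supersets 'I_n.+1 [set x]%SET K.
  rewrite cards1 card_ord => /(_ K0); rewrite subn1 /= subn1 => <-.
  by apply: eq_card => I; rewrite !inE finset.sub1set.
apply: (mulIf (x := N)); first by rewrite pnatr_eq0.
rewrite divfK ?pnatr_eq0// /nsub -!natrM; congr (_%:R).
have := mul_bin_diag n.+1 K.-1; rewrite prednK//= => e.
by rewrite [LHS]mulnC e mulnC.
Qed.

(** Two given points are sampled together less often than by independent
    draws. *)
Lemma sum_mem2 (x y : 'I_n.+1) : x != y ->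
  \sum_(I : {set 'I_n.+1} | #|I| == K) (((x \in I) && (y \in I))%:R : R)
    <= nsub * (K%:R / N) ^+ 2.
Proof.
move=> xy; rewrite -natr_sum sum_bool_card.
have [K1|K1] := leqP K 1.
  rewrite (_ : [set I : {set 'I_n.+1} | _]%SET = finset.set0).
    by rewrite cards0 mulr_ge0 ?exprn_ge0 ?divr_ge0.
  apply/finset.setP => I; rewrite !inE; apply/negP => /and3P[/eqP cI xI yI].
  have : ([set x; y] \subset I)%SET by apply/fintype.subsetP => z; rewrite !inE => /orP[]/eqP->.
  by move=> /subset_leq_card; rewrite cards2 xy cI leqNgt /= ltnS K1.
have -> : #|[set I : {set 'I_n.+1} | (#|I| == K) && ((x \in I) && (y \in I))]%SET| = 'C(n.-1, K.-2).
  have := @card_supersets 'I_n.+1 [set x; y]%SET K.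
  rewrite cards2 xy card_ord => /(_ K1); rewrite subn2 /= subn2 => <-.
  by apply: eq_card => I; rewrite !inE finset.subUset !finset.sub1set.
have n1 : (0 < n)%N by rewrite -ltnS (leq_trans K1 KN).
have n1R : 0 < n%:R :> R by rewrite ltr0n.
have NR : 0 < N by rewrite ltr0n.
have e1 : (n.+1 * 'C(n, K.-1) = K * 'C(n.+1, K))%N.
  by have := mul_bin_diag n.+1 K.-1; rewrite prednK.
have e2 : (n * 'C(n.-1, K.-2) = K.-1 * 'C(n, K.-1))%N.
  by have := mul_bin_diag n K.-2; rewrite prednK// -ltnS prednK.
have {}e1 : ('C(n, K.-1))%:R = K%:R / N * nsub.
  apply: (mulfI (x := N)); first by rewrite gt_eqF.
  by rewrite -natrM e1 /nsub natrM mulrA mulrCA divff ?mulr1// gt_eqF.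
have {}e2 : ('C(n.-1, K.-2))%:R = K.-1%:R / n%:R * (K%:R / N * nsub).
  apply: (mulfI (x := n%:R)); first by rewrite gt_eqF.
  by rewrite -natrM e2 natrM e1 [RHS]mulrA [n%:R * (_ / _)]mulrCA divff ?gt_eqF// mulr1.
rewrite e2 expr2.
have h : K.-1%:R / n%:R <= K%:R / N.
  rewrite ler_pdivrMr// mulrAC ler_pdivlMr// -!natrM ler_nat.
  by move: K1 KN; case: (K) => // k' _; rewrite ltnS => h /=; rewrite mulnS mulSn mulnC; lia.
have -> : nsub * (K%:R / N * (K%:R / N)) = K%:R / N * (K%:R / N * nsub) by ring.
by rewrite ler_wpM2r// mulr_ge0// divr_ge0.
Qed.

Lemma sum_draws : \sum_(I : {set 'I_n.+1} | #|I| == K) (1 : R) = nsub.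
Proof.
rewrite /nsub; have <- : #|[set I : {set 'I_n.+1} | #|I| == K]%SET| = 'C(n.+1, K).
  by rewrite card_draws card_ord.
by rewrite -sum1dep_card natr_sum.
Qed.

(** Negative correlation bounds the variance of a hypergeometric count by that
    of independent draws. *)
Lemma second_moment (A : {set 'I_n.+1}) :
  \sum_(I : {set 'I_n.+1} | #|I| == K) (#|I :&: A|%:R / K%:R - #|A|%:R / N) ^+ 2
    <= nsub / K%:R.
Proof.
pose m (I : {set 'I_n.+1}) (x : 'I_n.+1) : R := (x \in I)%:R.
have XE (I : {set 'I_n.+1}) : #|I :&: A|%:R = \sum_(x in A) m I x.
  rewrite -sum1_card natr_sum big_mkcond [RHS]big_mkcond; apply: eq_bigr => x _.
  by rewrite /m !inE; case: (x \in I); case: (x \in A).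
have S1 : \sum_(I : {set 'I_n.+1} | #|I| == K) (#|I :&: A|%:R : R) = #|A|%:R * (nsub * K%:R / N).
  under eq_bigr do rewrite XE.
  rewrite exchange_big/= (eq_bigr (fun=> nsub * K%:R / N)).
    by rewrite sumr_const mulr_natl.
  by move=> x _; exact: sum_mem1.
have SC (c : R) : \sum_(x in A) c = #|A|%:R * c by rewrite sumr_const mulr_natl.
have S2 : \sum_(I : {set 'I_n.+1} | #|I| == K) ((#|I :&: A|%:R : R) ^+ 2) <=
    #|A|%:R * (nsub * K%:R / N) + #|A|%:R ^+ 2 * (nsub * (K%:R / N) ^+ 2).
  have -> : \sum_(I : {set 'I_n.+1} | #|I| == K) ((#|I :&: A|%:R : R) ^+ 2) =
    \sum_(x in A) \sum_(y in A) \sum_(I : {set 'I_n.+1} | #|I| == K) ((x \in I) && (y \in I))%:R.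
    under eq_bigr => I _ do rewrite XE expr2 big_distrlr/=.
    rewrite exchange_big/=; apply: eq_bigr => x _.
    rewrite exchange_big/=; apply: eq_bigr => y _.
    by apply: eq_bigr => I _; rewrite /m -natrM mulnb.
  have -> : #|A|%:R * (nsub * K%:R / N) + #|A|%:R ^+ 2 * (nsub * (K%:R / N) ^+ 2) =
     \sum_(x in A) (nsub * K%:R / N + \sum_(y in A) nsub * (K%:R / N) ^+ 2).
    by rewrite big_split/= !SC [#|A|%:R ^+ 2]expr2 -[in LHS](mulrA #|A|%:R #|A|%:R).
  apply: ler_sum => x xA; rewrite (bigD1 x)//= [X in X + _](eq_bigr (fun I : {set 'I_n.+1} => (x \in I)%:R)); last first.
    by move=> I _; rewrite andbb.
  rewrite sum_mem1 lerD2l [leRHS](bigD1 x)//= ler_wpDl//.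
    by rewrite mulr_ge0// ?exprn_ge0// divr_ge0.
  by apply: ler_sum => y /andP[_ yx]; apply: sum_mem2; rewrite eq_sym.
have S0 := sum_draws.
have -> : \sum_(I : {set 'I_n.+1} | #|I| == K) (#|I :&: A|%:R / K%:R - #|A|%:R / N) ^+ 2 =
  (\sum_(I : {set 'I_n.+1} | #|I| == K) (#|I :&: A|%:R ^+ 2)) / K%:R ^+ 2
  - 2 * (#|A|%:R / N) / K%:R * (\sum_(I : {set 'I_n.+1} | #|I| == K) #|I :&: A|%:R)
  + (#|A|%:R / N) ^+ 2 * \sum_(I : {set 'I_n.+1} | #|I| == K) 1.
  rewrite mulr_suml !mulr_sumr -sumrB -big_split/=; apply: eq_bigr => I _.
  by rewrite sqrrB expr_div_n; ring.
rewrite S0 S1.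
have aN : #|A|%:R <= N.
  by rewrite ler_nat -[X in (_ <= X)%N](card_ord n.+1) max_card.
by apply: second_moment_algebra => //; rewrite ltr0n.
Qed.

End Hypergeometric.

(** * A large pattern is close to its permutation *)

Section Sampling.
Variable R : realType.

Definition dev (n k : nat) (I A : {set 'I_n.+1}) : R :=
  #|I :&: A|%:R / k%:R - #|A|%:R / n.+1%:R.

Definition low_pos (n i : nat) : {set 'I_n.+1} := [set x : 'I_n.+1 | (x < i)%N]%SET.
Definition low_val (n : nat) (s : 'S_n.+1) (j : nat) : {set 'I_n.+1} :=
  [set x : 'I_n.+1 | (s x < j)%N]%SET.

Lemma cdf_triangle (p q a b x y u v w z N K : R) :
  `|p - w| <= `|a - u| + `|b - v| -> `|q - z| <= `|a - x| + `|b - y| ->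
  x <= a <= x + N -> y <= b <= y + N -> N <= K ->
  `|p - q| <= 4 * K + (`|u - x| + `|v - y| + `|w - z|).
Proof.
move=> l1 l2 ha hb NK.
have t1 := ler_distD x a u; have t2 := ler_distD y b v.
have h1 : `|a - x| <= N by rewrite ler_norml; lra.
have h2 : `|b - y| <= N by rewrite ler_norml; lra.
rewrite (distrC x u) in t1; rewrite (distrC y v) in t2.
have t3 := ler_distD w p q; have t4 := ler_distD z w q.
rewrite (distrC z q) in t4.
lra.
Qed.

(** At the thresholds given by the empirical proportions of sampled points, the
    distribution function of the permuton of a pattern is itself an empirical
    proportion; the Lipschitz property absorbs the change of thresholds. *)
Lemma pattern_pcdf (n k : nat) (s : 'S_n.+1) (I : {set 'I_n.+1}) (a b : R) :
  #|I| = k.+1 -> (k <= n)%N -> 0 <= a <= 1 -> 0 <= b <= 1 ->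
  `|pcdf (perm_permuton R (pat k.+1 I s)) a b - pcdf (perm_permuton R s) a b| <=
  4 / k.+1%:R + (`|dev k.+1 I (low_pos n (cell_index n a))|
    + `|dev k.+1 I (low_val s (cell_index n b))|
    + `|dev k.+1 I (low_pos n (cell_index n a) :&: low_val s (cell_index n b))|).
Proof.
move=> cI kn a01 b01.
have /andP[a0 _] := a01; have /andP[b0 _] := b01.
have ha := cell_index_near n a0; have hb := cell_index_near n b0.
have ia := cell_index_le n a01; have jb := cell_index_le n b01.
move: ha hb ia jb; set i := cell_index n a; set j := cell_index n b.
move=> ha hb ia jb.
have cA : #|low_pos n i| = i by rewrite cardsE card_ord_lt.
have cB : #|low_val s j| = j by rewrite cardsE card_perm_lt.
have uE : #|[pred x in I | (x < i)%N]| = #|I :&: low_pos n i|.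
  by apply: eq_card => x; rewrite !inE.
have vE : #|[pred x in I | (s x < j)%N]| = #|I :&: low_val s j|.
  by apply: eq_card => x; rewrite !inE.
have := pat_count s cI i j; rewrite uE vE.
have -> : #|[pred x in I | (x < i)%N && (s x < j)%N]| = #|I :&: (low_pos n i :&: low_val s j)|.
  by apply: eq_card => x; rewrite !inE.
move=> cE.
have uk : (#|I :&: low_pos n i| <= k.+1)%N by rewrite -cI subset_leq_card// finset.subsetIl.
have vk : (#|I :&: low_val s j| <= k.+1)%N by rewrite -cI subset_leq_card// finset.subsetIl.
have e1 := pcdf_graph R (pat k.+1 I s) uk vk.
rewrite [in RHS]cE in e1.
have e2 := pcdf_graph R s ia jb.
have c2 : #|[pred r : 'I_n.+1 | (r < i)%N && (s r < j)%N]| = #|low_pos n i :&: low_val s j|.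
  by apply: eq_card => x; rewrite !inE.
rewrite c2 in e2.
rewrite /dev cA cB.
have l1 := pcdf_lipschitz (perm_permuton R (pat k.+1 I s)) a b
  (#|I :&: low_pos n i|%:R / k.+1%:R) (#|I :&: low_val s j|%:R / k.+1%:R).
have l2 := pcdf_lipschitz (perm_permuton R s) a b (i%:R / n.+1%:R) (j%:R / n.+1%:R).
rewrite e1 in l1; rewrite e2 in l2.
have kN : n.+1%:R^-1 <= k.+1%:R^-1 :> R by rewrite lef_pV2 ?posrE ?ltr0n// ler_nat.
exact: (cdf_triangle l1 l2 ha hb kN).
Qed.

Lemma large_deviation_squares (v t x y z : R) : t * v = 1 -> 0 < v -> 0 <= x -> 0 <= y -> 0 <= z ->
  v < v / 4 + (x + y + z) -> 1 <= 16 * t ^+ 2 * (x ^+ 2 + y ^+ 2 + z ^+ 2).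
Proof.
move=> tv v0 x0 y0 z0 h.
have h1 : (3 / 4 * v) ^+ 2 <= (x + y + z) ^+ 2.
  by rewrite ler_sqr ?nnegrE; lra.
have h2 : (x + y + z) ^+ 2 <= 3 * (x ^+ 2 + y ^+ 2 + z ^+ 2).
  have := sqr_ge0 (x - y); have := sqr_ge0 (y - z); have := sqr_ge0 (x - z).
  by rewrite !expr2; nra.
have h3 : 3 / 16 * v ^+ 2 <= x ^+ 2 + y ^+ 2 + z ^+ 2 by move: h1 h2; rewrite exprMn; lra.
apply: (@le_trans _ _ (16 * t ^+ 2 * (3 / 16 * v ^+ 2))); last first.
  by rewrite ler_wpM2l// mulr_ge0// sqr_ge0.
have -> : 16 * t ^+ 2 * (3 / 16 * v ^+ 2) = 3 * (t * v) ^+ 2 by rewrite exprMn; field.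
by rewrite tv expr1n; lra.
Qed.

(** When the distribution functions of a pattern and of the permutation are far
    apart at some grid point, the squares of the deviations on the grid have a
    sum bounded below. The second moment bound then makes such subsets rare, and
    they contribute at most [2 * M] each. *)
Lemma sampling_average (f : permuton R -> R) (e M : R) (m n k : nat) (s : 'S_n.+1) :
  0 <= e ->
  (forall mu, `|f mu| <= M) ->
  (forall mu nu,
    (forall i j : nat, (i <= m.+1)%N -> (j <= m.+1)%N ->
      `|pcdf mu (gridpt R m i) (gridpt R m j) - pcdf nu (gridpt R m i) (gridpt R m j)|
        <= m.+1%:R^-1) ->
    `|f mu - f nu| <= e) ->
  (k <= n)%N -> (16 * m.+1 <= k.+1)%N ->
  \sum_(I : {set 'I_n.+1} | #|I| == k.+1)
     `|f (perm_permuton R (pat k.+1 I s)) - f (perm_permuton R s)| <=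
  nsub R n k.+1 * (e + 2 * M * (16 * m.+1%:R ^+ 2 * (m.+2%:R ^+ 2 * (3 / k.+1%:R)))).
Proof.
move=> e0 fM fe kn mk.
pose A (i : 'I_m.+2) := low_pos n (cell_index n (gridpt R m i)).
pose B (j : 'I_m.+2) := low_val s (cell_index n (gridpt R m j)).
pose D I i j := dev k.+1 I (A i) ^+ 2 + dev k.+1 I (B j) ^+ 2 + dev k.+1 I (A i :&: B j) ^+ 2 : R.
have M0 : 0 <= M by apply: le_trans (fM (perm_permuton R s)).
have D0 I i j : 0 <= D I i j by rewrite !addr_ge0// sqr_ge0.
have gp01 (i : nat) : (i <= m.+1)%N -> 0 <= gridpt R m i <= 1.
  by move=> im; rewrite /gridpt divr_ge0//= ler_pdivrMr ?mul1r ?ler_nat// ltr0n.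
have point (I : {set 'I_n.+1}) : #|I| == k.+1 ->
    `|f (perm_permuton R (pat k.+1 I s)) - f (perm_permuton R s)| <=
    e + 2 * M * (16 * m.+1%:R ^+ 2 * \sum_i \sum_j D I i j).
  move=> /eqP cI.
  have [good|bad] := pselect (forall i j : nat, (i <= m.+1)%N -> (j <= m.+1)%N ->
      `|pcdf (perm_permuton R (pat k.+1 I s)) (gridpt R m i) (gridpt R m j) - pcdf (perm_permuton R s) (gridpt R m i) (gridpt R m j)|
        <= m.+1%:R^-1).
    apply: le_trans (fe _ _ good) _; rewrite lerDl !mulr_ge0// ?exprn_ge0//.
    by apply: sumr_ge0 => i _; apply: sumr_ge0 => j _.
  suff h : 1 <= 16 * m.+1%:R ^+ 2 * \sum_i \sum_j D I i j.
    apply: le_trans (ler_normB _ _) _.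
    have h1 := fM (perm_permuton R (pat k.+1 I s)); have h2 := fM (perm_permuton R s).
    have h3 : 2 * M * 1 <= 2 * M * (16 * m.+1%:R ^+ 2 * \sum_i \sum_j D I i j).
      by rewrite ler_wpM2l// mulr_ge0.
    by move: h1 h2 h3; lra.
  move/existsNP: bad => [i /existsNP[j /not_implyP[im /not_implyP[jm /negP]]]].
  rewrite -ltNge => big.
  have hi : (i < m.+2)%N by []. have hj : (j < m.+2)%N by [].
  apply: (@le_trans _ _ (16 * m.+1%:R ^+ 2 * D I (Ordinal hi) (Ordinal hj))); last first.
    rewrite ler_wpM2l ?mulr_ge0 ?exprn_ge0//.
    rewrite (bigD1 (Ordinal hi))//= (bigD1 (Ordinal hj))//= -addrA lerDl addr_ge0//.
      by apply: sumr_ge0 => ? _.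
    by apply: sumr_ge0 => ? _; apply: sumr_ge0 => ? _.
  have := pattern_pcdf s cI kn (gp01 i im) (gp01 j jm).
  rewrite -/(A (Ordinal hi)) -/(B (Ordinal hj)) /D /=.
  move/(lt_le_trans big).
  have mR : 0 < m.+1%:R :> R by rewrite ltr0n.
  (* The lower bound on [k] makes the Lipschitz error a quarter of the
     tolerance [m.+1%:R^-1]. *)
  have kR : 4 / k.+1%:R <= m.+1%:R^-1 / 4 :> R.
    rewrite ler_pdivrMr ?ltr0n//.
    have : m.+1%:R^-1 * (16 * m.+1%:R) <= m.+1%:R^-1 * k.+1%:R :> R.
      by rewrite ler_wpM2l ?invr_ge0 ?(ltW mR)// -natrM ler_nat.
    by rewrite mulrCA mulVf ?gt_eqF// mulr1; move: (m.+1%:R^-1) (k.+1%:R) => v K; lra.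
  set x := dev _ _ _; set y := dev _ _ _; set z := dev _ _ _.
  move=> h; rewrite -(real_normK (num_real x)) -(real_normK (num_real y)) -(real_normK (num_real z)).
  apply: (@large_deviation_squares (m.+1%:R^-1)) => //; first by rewrite mulfV ?gt_eqF.
  by apply: lt_le_trans h _; rewrite lerD2r.
apply: le_trans (ler_sum _ point) _.
have sD i j : \sum_(I : {set 'I_n.+1} | #|I| == k.+1) D I i j <= 3 * (nsub R n k.+1 / k.+1%:R).
  rewrite !big_split/=.
  have h1 := second_moment R (ltn0Sn k) (kn : (k.+1 <= n.+1)%N) (A i).
  have h2 := second_moment R (ltn0Sn k) (kn : (k.+1 <= n.+1)%N) (B j).
  have h3 := second_moment R (ltn0Sn k) (kn : (k.+1 <= n.+1)%N) (A i :&: B j).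
  have -> : 3 * (nsub R n k.+1 / k.+1%:R) = nsub R n k.+1 / k.+1%:R +
      nsub R n k.+1 / k.+1%:R + nsub R n k.+1 / k.+1%:R by move: (nsub _ _ _ / _) => v; lra.
  exact: lerD (lerD h1 h2) h3.
rewrite big_split/= -!mulr_sumr.
have -> : \sum_(I : {set 'I_n.+1} | #|I| == k.+1) e = nsub R n k.+1 * e.
  by rewrite -(sum_draws R n k.+1) mulr_suml; apply: eq_bigr => I _; rewrite mul1r.
rewrite mulrDr lerD2l.
rewrite [leRHS]mulrCA ler_wpM2l ?mulr_ge0// [leRHS]mulrCA ler_wpM2l ?mulr_ge0 ?exprn_ge0//.
rewrite exchange_big/=.
apply: (@le_trans _ _ (\sum_(i < m.+2) \sum_(j < m.+2) 3 * (nsub R n k.+1 / k.+1%:R))).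
  by apply: ler_sum => i _; rewrite exchange_big/=; apply: ler_sum => j _; exact: sD.
have SC (c : R) : \sum_(i < m.+2) c = m.+2%:R * c by rewrite sumr_const card_ord mulr_natl.
rewrite !SC le_eqVlt; apply/orP; left.
by apply/eqP; move: (nsub _ _ _) (k.+1%:R^-1) (m.+2%:R) => u v w; ring.
Qed.

End Sampling.

(** * Patterns of independent uniform subsets *)

Section RandomPattern.
Context (R : realType) d (Om : measurableType d) (P : probability Om R).
Variables (n k : nat).
Variables (sigma : {RV P >-> borel 'S_n.+1}) (I : {RV P >-> borel {set 'I_n.+1}}).
Hypothesis kn : (k.+1 <= n.+1)%N.
Hypothesis unifI : uniform_subset P k.+1 I.
Hypothesis indepI : independent_rv P sigma I.

Lemma expectation_uniform_subset (g : 'S_n.+1 -> {set 'I_n.+1} -> R) :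
  \int[P]_w g (sigma w) (I w) =
  \sum_s prb P (sigma @^-1` [set s]) *
    ((\sum_(J : {set 'I_n.+1} | #|J| == k.+1) g s J) / nsub R n k.+1).
Proof.
have pre2 (t : 'S_n.+1 * {set 'I_n.+1}) :
    (fun w => (sigma w : 'S_n.+1, I w : {set 'I_n.+1})) @^-1` [set t] =
    sigma @^-1` [set t.1] `&` I @^-1` [set t.2].
  by case: t => s J; apply/seteqP; split => w /= [-> ->].
rewrite (@Rint_finval _ _ _ P _ (fun w => (sigma w : 'S_n.+1, I w : {set 'I_n.+1}))
  (fun t => g t.1 t.2)); last first.
  by move=> t; rewrite pre2; apply: measurableI; exact: discrete_rv_measurable.
transitivity (\sum_(s : 'S_n.+1) \sum_(J : {set 'I_n.+1})
    g s J * fine (P (sigma @^-1` [set s] `&` I @^-1` [set J]))).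
  by rewrite pair_bigA; apply: eq_bigr => t _; rewrite pre2.
apply: eq_bigr => s _; rewrite mulr_suml mulr_sumr [RHS]big_mkcond/=.
apply: eq_bigr => J _; rewrite indepI; last 2 first.
- by apply: sub_sigma_algebra; exact: discrete_open.
- by apply: sub_sigma_algebra; exact: discrete_open.
rewrite fineM ?fin_num_measure//; [|exact: discrete_rv_measurable..].
rewrite -/(prb P _) unifI; case: ifP => _ /=; last by rewrite mulr0 mulr0.
by rewrite mulrCA mulrA.
Qed.

(** Averaging over the independent uniform subset turns the probability of a
    pattern into its expected density. *)
Lemma prb_random_pat (p : 'S_k.+1) :
  prb P (random_pat k.+1 I sigma @^-1` [set p]) = \int[P]_w occ R p (sigma w).
Proof.
have mr (t : 'S_k.+1) : measurable (random_pat k.+1 I sigma @^-1` [set t]).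
  exact: (discrete_rv_measurable (random_pat k.+1 I sigma : {RV P >-> borel 'S_k.+1})).
rewrite -Rint_prb//.
transitivity (\int[P]_w ((pat k.+1 (I w) (sigma w) == p)%:R : R)).
  apply: eq_Rintegral => w _; rewrite indicE; congr (nat_of_bool _)%:R.
  by apply/idP/eqP => [|h]; rewrite inE.
rewrite (expectation_uniform_subset (fun s J => (pat k.+1 J s == p)%:R)).
rewrite (@Rint_finval _ _ _ P _ (fun w => sigma w : 'S_n.+1) (fun s => occ R p s)); last first.
  by move=> t; exact: discrete_rv_measurable.
apply: eq_bigr => s _; rewrite mulrC; congr (_ * _); rewrite /occ; congr (_ / _).
by rewrite -natr_sum sum_bool_card.
Qed.

Lemma random_pat_dist (f : permuton R -> R) (B : R) :
  (forall s : 'S_n.+1,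
    \sum_(J : {set 'I_n.+1} | #|J| == k.+1)
       `|f (perm_permuton R (pat k.+1 J s)) - f (perm_permuton R s)| <= nsub R n k.+1 * B) ->
  `|\int[P]_w f (perm_permuton R (random_pat k.+1 I sigma w)) -
    \int[P]_w f (perm_permuton R (sigma w))| <= B.
Proof.
move=> H.
have ms t : measurable (sigma @^-1` [set t]) by exact: discrete_rv_measurable.
have c0 : 0 < nsub R n k.+1 by rewrite ltr0n bin_gt0.
rewrite (expectation_uniform_subset (fun s J => f (perm_permuton R (pat k.+1 J s)))).
rewrite (@Rint_finval _ _ _ P _ (fun w => sigma w : 'S_n.+1) (fun s => f (perm_permuton R s)))//.
rewrite -sumrB.
have tot : \sum_(s : 'S_n.+1) prb P (sigma @^-1` [set s]) = 1.
  have := @Rint_finval _ _ _ P _ (fun w => sigma w : 'S_n.+1) (fun=> 1 : R) ms.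
  by rewrite Rint_cst => ->; apply: eq_bigr => s _; rewrite mul1r.
rewrite (le_trans (ler_norm_sum _ _ _))//.
rewrite -[leRHS]mul1r -tot mulr_suml; apply: ler_sum => s _.
rewrite [f _ * _]mulrC -mulrBr normrM ger0_norm ?prb_ge0// ler_wpM2l ?prb_ge0//.
have -> : f (perm_permuton R s) =
    (\sum_(J : {set 'I_n.+1} | #|J| == k.+1) f (perm_permuton R s)) / nsub R n k.+1.
  apply: (mulIf (x := nsub R n k.+1)); first by rewrite gt_eqF.
  rewrite divfK ?gt_eqF// -(sum_draws R n k.+1) mulr_sumr.
  by apply: eq_bigr => J _; rewrite mulr1.
rewrite -mulrBl -sumrB normrM [`|_^-1|]gtr0_norm ?invr_gt0// ler_pdivrMr//.
by rewrite mulrC; exact: le_trans (ler_norm_sum _ _ _) (H s).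
Qed.

End RandomPattern.

(** * From convergence of patterns to convergence of permutons *)

Lemma continuous_discrete (T : pdiscreteTopologicalType) (S : topologicalType)
  (f : T -> S) : continuous f.
Proof. by apply/continuousP => A _; exact: discrete_open. Qed.

Section PatternsToPermuton.
Context (R : realType)
  (d : nat -> measure_display) (Om : forall n, measurableType (d n))
  (P : forall n, probability (Om n) R)
  (sigma : forall n, {RV (P n) >-> borel 'S_n.+1})
  (I : forall n k : nat, {RV (P n) >-> borel {set 'I_n.+1}}).
Hypothesis unifI : forall n k : nat, (k <= n.+1)%N -> uniform_subset (P n) k (I n k).
Hypothesis indepI : forall n k : nat, (k <= n.+1)%N ->
  independent_rv (P n) (sigma n) (I n k).

(** A law of large numbers: the bound of [sampling_average] does not depend on
    the permutation and becomes small for large patterns. *)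
Lemma sampling_uniform (f : permuton R -> R) (e : R) : continuous f -> 0 < e ->
  exists k0 : nat, forall k n, (k0 <= k)%N -> (k <= n)%N ->
    `|\int[P n]_w f (perm_permuton R (random_pat k.+1 (I n k.+1) (sigma n) w)) -
      \int[P n]_w f (perm_permuton R (sigma n w))| <= e.
Proof.
move=> cf e0.
have e2 : 0 < e / 2 by rewrite divr_gt0.
have [m mP] := permuton_modulus cf e2.
have [M0 M0P] := permuton_continuous_bounded cf.
pose M := `|M0| + 1; have Mgt : 0 < M by rewrite ltr_wpDl.
have MP mu : `|f mu| <= M by rewrite (le_trans (M0P mu))// ler_wpDr// ler_norm.
pose C : R := 2 * M * (16 * m.+1%:R ^+ 2 * (m.+2%:R ^+ 2 * 3)).
have C0 : 0 < C by rewrite !mulr_gt0// exprn_gt0// ltr0n.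
have eC : 0 < e / 2 / C by rewrite divr_gt0.
have [k1 hk1] := inv_nat_small eC.
exists (maxn k1 (16 * m.+1)) => k n kk kn.
have k1k : (k1 <= k)%N by rewrite (leq_trans _ kk)// leq_maxl.
have mk : (16 * m.+1 <= k.+1)%N by rewrite (leq_trans _ (leqnSn k))// (leq_trans _ kk)// leq_maxr.
apply: (random_pat_dist _ (unifI _) (indepI _)) => // s.
apply: le_trans (sampling_average s (ltW e2) MP mP kn mk) _.
rewrite ler_wpM2l//.
have h1 : k.+1%:R^-1 <= k1.+1%:R^-1 :> R by rewrite lef_pV2 ?posrE ?ltr0n// ler_nat.
have h2 : C * k.+1%:R^-1 <= e / 2.
  by rewrite mulrC -ler_pdivlMr//; apply: le_trans h1 (ltW hk1).
have -> : 2 * M * (16 * m.+1%:R ^+ 2 * (m.+2%:R ^+ 2 * (3 / k.+1%:R))) = C * k.+1%:R^-1.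
  by rewrite /C; move: (k.+1%:R^-1) (m.+1%:R) (m.+2%:R) => u v w; ring.
by rewrite [leRHS]splitr lerD2l.
Qed.

(** Up to a small error, [f] of the permutation may be replaced by [f] of a large
    random pattern, whose expectation converges by hypothesis; the expectations
    of [f] thus form a Cauchy sequence. *)
Theorem patterns_to_permuton :
  (forall k : nat, exists (dr : measure_display) (Or : measurableType dr)
      (Pr : probability Or R) (rho : {RV Pr >-> borel 'S_k.+1}),
      cvg_in_dist P (fun n => random_pat k.+1 (I n k.+1) (sigma n)) Pr rho) ->
  exists mu : {RV (unif R) >-> borel (permuton R)},
    cvg_in_dist P (fun n => discrete_comp (@perm_permuton R n) (sigma n)) (unif R) mu.
Proof.
move=> H; apply: permuton_limit_exists => f cf.
have [M MP] := permuton_continuous_bounded cf.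
pose a n := \int[P n]_w f (perm_permuton R (sigma n w)).
have ba n : `|a n| <= M.
  rewrite -[X in `|X|]subr0 -(Rint_cst (P n) 0); apply: Rint_dist.
  - apply: (@bmeas_finval _ _ _ _ (fun w => sigma n w : 'S_n.+1) (fun s => f (perm_permuton R s))) => t.
    exact: discrete_rv_measurable.
  - exact: bmeas_cst.
  - by move=> w; rewrite subr0.
have [F [FU Foo]] := ultra_eventually.
have [l lP] := ultra_bounded_cvg FU ba.
exists l; apply/cvgrPdist_le => e e0.
have e4 : 0 < e / 4 by rewrite divr_gt0.
have [k kP] := sampling_uniform cf e4.
have [dr [Or [Pr [rho /cvg_in_distP rhoP]]]] := H k.
have fd : continuous (fun s : 'S_k.+1 => f (perm_permuton R s)).
  exact: continuous_discrete.
have := rhoP _ fd (ex_intro _ M (fun s => MP _)).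
set b := \int[Pr]_w _ => /cvg_near_dist/(_ e4) hb.
have near1 : \forall n \near \oo, `|b - a n| <= e / 2.
  have hk : \forall n \near \oo, (k <= n)%N by exact: nbhs_infty_ge.
  apply: filterS2 hb hk => n /= h1 kn.
  have := kP k n (leqnn k) kn; rewrite -/(a n).
  by move: h1; rewrite ltr_norml !ler_norml; lra.
have lb : `|l - b| <= e / 2.
  rewrite leNgt; apply/negP; rewrite -subr_gt0 => h.
  have [n /= [h1 h2]] := filter_ex (filterI (Foo _ near1) (cvg_near_dist lP h)).
  have := ler_distD (a n) l b; rewrite (distrC (a n) b); lra.
apply: filterS near1 => n h; have := ler_distD b l (a n); lra.
Qed.

End PatternsToPermuton.

(** * Relative order of independent points *)

Section PermOfPoints.

Lemma std_eq (d1 d2 : Order.disp_t) (T1 : orderType d1) (T2 : orderType d2) (k : nat)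
    (v : 'I_k -> T1) (v' : 'I_k -> T2) :
  (forall i j, (v i < v j)%O = (v' i < v' j)%O) -> std v = std v'.
Proof.
move=> H; rewrite /std; congr (odflt _ _); apply: eq_pick => s /=.
by apply: eq_forallb => i; apply: eq_forallb => j; rewrite H.
Qed.

Variables (R : realType) (k : nat).
Implicit Type m : k.-tuple (R * R).

Lemma sort_points (I : eqType) (f : I -> R * R) (l : seq I) (le_I : rel I) :
  (forall i j, le_I i j = ((f i).1 <= (f j).1)) ->
  sort (fun x y : R * R => x.1 <= y.1) [seq f i | i <- l] = [seq f i | i <- sort le_I l].
Proof.
move=> H; rewrite sort_map; congr map; congr (sort _ _).
by apply/funext => i; apply/funext => j /=; rewrite H.
Qed.

(** Sorting commutes with any replacement of the points that preserves the
    comparisons of first coordinates. *)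
Lemma perm_of_points_eq m m' :
  (forall i j, ((tnth m i).1 <= (tnth m j).1) = ((tnth m' i).1 <= (tnth m' j).1)) ->
  (forall i j, ((tnth m i).2 < (tnth m j).2) = ((tnth m' i).2 < (tnth m' j).2)) ->
  perm_of_points m = perm_of_points m'.
Proof.
move=> H1 H2; rewrite /perm_of_points.
rewrite -(map_tnth_enum m) -(map_tnth_enum m').
pose le_I (i j : 'I_k) := (tnth m i).1 <= (tnth m j).1.
rewrite (@sort_points _ (tnth m) _ le_I)// (@sort_points _ (tnth m') _ le_I)//.
set L := sort le_I _.
have sL : size L = k by rewrite size_sort size_enum_ord.
apply: std_eq => i j.
have i0 : 'I_k := i.
by rewrite !(nth_map i0) ?sL.
Qed.

(** The comparisons between the coordinates have finitely many outcomes. *)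
Lemma measurable_perm_of_points d (Om : measurableType d)
    (Z : 'I_k -> Om -> R * R) (p : 'S_k) :
  (forall i, measurable_fun setT (Z i : Om -> (R * R)%type)) ->
  measurable [set w | perm_of_points [tuple Z i w | i < k] = p].
Proof.
move=> mZ.
pose T := {ffun 'I_k * 'I_k -> bool * bool}.
pose h (w : Om) : T := [ffun ij => ((Z ij.1 w).1 <= (Z ij.2 w).1, (Z ij.1 w).2 < (Z ij.2 w).2)].
have m1 i : measurable_fun setT (fun w => (Z i w).1) by apply: measurableT_comp.
have m2 i : measurable_fun setT (fun w => (Z i w).2) by apply: measurableT_comp.
have mh (t : T) : measurable (h @^-1` [set t]).
  rewrite (_ : h @^-1` [set t] = \bigcap_(ij in [set: 'I_k * 'I_k])
      ([set w | ((Z ij.1 w).1 <= (Z ij.2 w).1) = (t ij).1] `&`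
       [set w | ((Z ij.1 w).2 < (Z ij.2 w).2) = (t ij).2])).
    apply: fin_bigcap_measurable => [|ij _]; first exact: finite_finset.
    apply: measurableI.
      have := @measurable_fun_ler _ _ _ setT _ _ (m1 ij.1) (m1 ij.2) measurableT [set (t ij).1] Logic.I.
      by rewrite setTI.
    have := @measurable_fun_ltr _ _ _ setT _ _ (m2 ij.1) (m2 ij.2) measurableT [set (t ij).2] Logic.I.
    by rewrite setTI.
  apply/seteqP; split => w /=.
    by move=> <- ij _; rewrite /h ffunE.
  by move=> H; apply/ffunP => ij; rewrite /h ffunE; have [/= -> ->] := H ij Logic.I; case: (t ij).
rewrite (_ : [set w | _] = h @^-1` [set t | exists w, h w = t /\ perm_of_points [tuple Z i w | i < k] = p]).
  exact: measurable_finval.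
apply/seteqP; split => w /=; first by move=> e; exists w.
move=> [w' [hw' <-]]; apply: perm_of_points_eq => i j; rewrite !tnth_mktuple.
  by have := congr1 (fun t : T => (t (i, j)).1) hw'; rewrite /h !ffunE/= => ->.
by have := congr1 (fun t : T => (t (i, j)).2) hw'; rewrite /h !ffunE/= => ->.
Qed.

End PermOfPoints.

Section PowerProb.
Context (R : realType) d (T : measurableType d) (P : probability T R).

Lemma measurable_tnth_set (k : nat) (A : 'I_k -> set T) : (forall i, measurable (A i)) ->
  measurable [set m : k.-tuple T | forall i, A i (tnth m i)].
Proof.
move=> mA; rewrite (_ : [set m | _] = \bigcap_(i in [set: 'I_k]) (fun m : k.-tuple T => tnth m i) @^-1` A i).
  apply: fin_bigcap_measurable => [|i _]; first exact: finite_finset.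
  rewrite -[X in measurable X]setTI; exact: measurable_tnth.
by apply/seteqP; split => [m /= H i _|m /= H i]; [exact: H|exact: (H i Logic.I)].
Qed.

(** This exhibits points sampled from a permuton as a case of conditionally
    independent points, where the permuton is constant. *)
Lemma power_prob_box (k : nat) (A : 'I_k -> set T) : (forall i, measurable (A i)) ->
  prb (power_prob P k) [set m | forall i, A i (tnth m i)] = \prod_i prb P (A i).
Proof.
elim: k A => [|k IH] A mA.
  by rewrite big_ord0 (_ : [set m | _] = setT) ?prbT//; apply/seteqP; split => // m _ [].
rewrite big_ord_recl -IH//.
have e : power_prob P k.+1 [set m | forall i, A i (tnth m i)] =
    (P \x power_prob P k)%E (A ord0 `*` [set m | forall i, A (lift ord0 i) (tnth m i)]).
  rewrite /= /distribution /pushforward; congr ((P \x power_prob P k)%E _).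
  apply/seteqP; split => -[z m] /= H.
    split => /=; first by have := H ord0; rewrite /tnth/=.
    by move=> i; have := H (lift ord0 i); rewrite tnthS.
  case: H => H0 H1 i; case: (unliftP ord0 i) => [j ->|->].
    by rewrite tnthS; exact: H1.
  by rewrite /tnth/=.
rewrite /prb e.
have := @product_measure1E _ _ _ _ R P (power_prob P k) (A ord0) _ (mA ord0)
  (measurable_tnth_set (fun i => mA (lift ord0 i))).
move=> /= ->; rewrite fineM// fin_num_measure//.
exact: (measurable_tnth_set (fun i => mA (lift ord0 i))).
Qed.

End PowerProb.

(** * Relative orders read on a grid *)

Section Discretize.
Variables (R : realType) (n : nat).
Local Notation N := (n.+1%:R : R).

Let N0 : 0 < N. Proof. by rewrite ltr0n. Qed.

(** The points outside ]0, 1] have no slab. *)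
Definition slab_of (x : R) : option 'I_n.+1 :=
  [pick r : 'I_n.+1 | r%:R / N < x <= r.+1%:R / N].

Lemma slab_ofP x (r : 'I_n.+1) : slab_of x = Some r <-> slab n r x.
Proof.
rewrite /slab_of; case: pickP => [r' /= h|/(_ r) /= h].
  have h' : slab n r' x by rewrite /slab /= in_itv.
  split=> [[<-//]|hr]; congr Some; apply: ord_inj; exact: slab_inj h' hr.
by split => //; rewrite /slab /= in_itv/= h.
Qed.

Lemma slab_of_none x : 0 < x <= 1 -> slab_of x <> None.
Proof.
move=> /andP[x0 x1].
have c0 : 0 < Num.ceil (x * N) by rewrite ceil_gt0 mulr_gt0.
have cN : Num.ceil (x * N) <= n.+1%:Z by rewrite ceil_le_int -pmulrn ler_piMl// ltW.
case cE: (Num.ceil (x * N)) c0 cN => [[//|m]|//] _ cN.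
have mn : (m < n.+1)%N by [].
have : slab_of x = Some (Ordinal mn).
  apply/slab_ofP; rewrite /slab /= in_itv/= ltr_pdivrMr// ler_pdivlMr//.
  move/eqP: cE; rewrite ceil_eq (_ : m.+1%:Z - 1 = m%:Z)//.
  by rewrite -addn1 PoszD addrK.
by move=> ->.
Qed.

Definition slab_set (o : option 'I_n.+1) : set R := [set x | slab_of x = o].

Lemma slab_setS r : slab_set (Some r) = slab n r.
Proof. by apply/seteqP; split => x; rewrite /slab_set /= slab_ofP. Qed.

Lemma measurable_slab_set o : measurable (slab_set o).
Proof.
case: o => [r|]; first by rewrite slab_setS; exact: measurable_slab.
rewrite (_ : slab_set None = ~` \bigcup_(r in [set: 'I_n.+1]) slab n r).
  by apply: measurableC; apply: measurable_bigcup_fin => r; exact: measurable_slab.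
apply/seteqP; split => x; rewrite /slab_set /=.
  by move=> e [r _ /slab_ofP]; rewrite e.
by move=> h; case e : (slab_of x) => [r|//]; exfalso; apply: h; exists r => //; apply/slab_ofP.
Qed.

Lemma leb_slab_none :
  fine (@lebesgue_measure R (slab_set None `&` `[0%R, 1%R]%classic)) = 0.
Proof.
rewrite (@subset_measure0 _ _ _ (@lebesgue_measure R) _ [set 0])//.
- by apply: measurableI => //; exact: measurable_slab_set.
- move=> x [/= e]; rewrite in_itv/= => /andP[x0 x1]; apply/eqP.
  rewrite eq_le x0 andbT leNgt; apply/negP => x0'.
  by apply: (slab_of_none _ e); rewrite x0'.
- exact: lebesgue_measure_set1.
Qed.

Lemma leb_slab_some (r : 'I_n.+1) :
  fine (@lebesgue_measure R (slab n r `&` `[0%R, 1%R]%classic)) = N^-1.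
Proof.
rewrite (_ : _ `&` _ = slab n r); first by rewrite leb_slab.
apply/seteqP; split => [x []//|x h]; split => //; move: h.
rewrite /slab /= !in_itv/= => /andP[h1 h2]; apply/andP; split.
  by rewrite (le_trans _ (ltW h1))// divr_ge0.
by rewrite (le_trans h2)// ler_pdivrMr// mul1r ler_nat.
Qed.

Definition slab_val (o : option 'I_n.+1) : R := if o is Some r then r%:R else 0.

Lemma slab_lt (x y : R) (r t : 'I_n.+1) : slab_of x = Some r -> slab_of y = Some t ->
  (r < t)%N -> x < y.
Proof.
move=> /slab_ofP; rewrite /slab /= in_itv/= => /andP[_ h1].
move=> /slab_ofP; rewrite /slab /= in_itv/= => /andP[h2 _] rt.
by rewrite (le_lt_trans h1)// (le_lt_trans _ h2)// ler_pM2r ?invr_gt0// ler_nat.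
Qed.

Lemma slab_compare (x y : R) (r t : 'I_n.+1) : slab_of x = Some r -> slab_of y = Some t ->
  r != t -> (x < y) = (slab_val (Some r) < slab_val (Some t)) /\
  (x <= y) = (slab_val (Some r) <= slab_val (Some t)).
Proof.
move=> hx hy rt; rewrite /slab_val ltr_nat ler_nat.
have [h|h|h] := ltngtP r t.
- by have xy := slab_lt hx hy h; split; [rewrite xy|rewrite ltW].
- by have xy := slab_lt hy hx h; split; [rewrite ltNge (ltW xy)|rewrite leNgt xy].
- by move/eqP: rt; case; exact: ord_inj.
Qed.

End Discretize.

Section Mixture.
Variables (R : realType) (k n : nat).
Local Notation N := (n.+1%:R : R).
Local Notation cell := (option 'I_n.+1 * option 'I_n.+1)%type.

Definition cell_set (c : cell) : set (R * R)%type :=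
  slab_set (n := n) c.1 `*` slab_set (n := n) c.2.

Lemma measurable_cell_set c : measurable (cell_set c).
Proof. by apply: measurableX; exact: measurable_slab_set. Qed.

Definition cell_pt (c : cell) : R * R := (slab_val R c.1, slab_val R c.2).

(** The probability that [k] independent points are in the relative order [p],
    computed with the slabs of the points in place of the points. *)
Definition grid_occ (p : 'S_k) (mu : permuton R) : R :=
  \sum_(c : {ffun 'I_k -> cell})
    (perm_of_points [tuple cell_pt (c i) | i < k] == p)%:R * \prod_i prb mu (cell_set (c i)).

(** The points [Z i] are conditionally independent with law [mu], a random
    permuton that may live on another probability space: this covers both points
    sampled from a random permuton and, when [mu] is constant, the points of the
    definition of pattern densities. *)
Context d (Om : measurableType d) (Q : probability Om R) (Z : 'I_k -> Om -> R * R)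
  d' (Om' : measurableType d') (P' : probability Om' R) (mu : Om' -> permuton R).
Hypothesis mZ : forall i, measurable_fun setT (Z i : Om -> (R * R)%type).
Hypothesis hbox : forall A : 'I_k -> set (R * R)%type, (forall i, measurable (A i)) ->
  prb Q [set w | forall i, A i (Z i w)] = \int[P']_w \prod_i prb (mu w) (A i).
Hypothesis hm : forall c : cell, bmeas (fun w => prb (mu w) (cell_set c)).

Section coincidence.
Variable pr : R * R -> R.
Hypothesis mpr : measurable_fun setT (pr : (R * R)%type -> R).
Hypothesis prE : forall (nu : permuton R) (A : set R), measurable A ->
  prb nu (pr @^-1` A) = fine (lebesgue_measure (A `&` `[0%R, 1%R]%classic)).

Let mset (A : set R) : measurable A -> measurable (pr @^-1` A : set (R * R)%type).
Proof. by move=> mA; rewrite -[X in measurable X]setTI; exact: mpr. Qed.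

Let mZset i (A : set R) : measurable A -> measurable [set w | A (pr (Z i w))].
Proof.
move=> mA; rewrite -[X in measurable X]setTI.
exact: (mZ i measurableT (mset mA)).
Qed.

(** Two points in a common slab; the diagonal stands for a point without
    slab. *)
Definition clash (ij : 'I_k * 'I_k) : set Om :=
  if ij.1 == ij.2 then [set w | slab_set (n := n) None (pr (Z ij.1 w))]
  else \bigcup_(r in [set: 'I_n.+1])
    ([set w | slab n r (pr (Z ij.1 w))] `&` [set w | slab n r (pr (Z ij.2 w))]).

Lemma measurable_clash ij : measurable (clash ij).
Proof.
rewrite /clash; case: ifP => _; first by apply: mZset; exact: measurable_slab_set.
apply: measurable_bigcup_fin => r; apply: measurableI; apply: mZset; exact: measurable_slab.
Qed.

(** Each slab has mass [1 / n.+1] by uniformity of the marginals, and there are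
    [n.+1] slabs for two points to share. *)
Lemma prb_clash ij : prb Q (clash ij) <= N^-1.
Proof.
rewrite /clash; case: (eqVneq ij.1 ij.2) => [_|ne].
  have := @hbox (fun i => if i == ij.1 then pr @^-1` slab_set (n := n) None else setT) _.
  rewrite (_ : [set w | _] = [set w | slab_set (n := n) None (pr (Z ij.1 w))]); last first.
    apply/seteqP; split => w /= H; first by have := H ij.1; rewrite eqxx.
    by move=> i; case: eqP => // ->.
  move=> ->; last by move=> i; case: eqP => _ //; apply: mset; exact: measurable_slab_set.
  rewrite (@eq_Rintegral _ _ _ _ _ (fun=> 0)).
    by rewrite Rint_cst.
  move=> w _; rewrite (bigD1 ij.1)//= eqxx prE; last exact: measurable_slab_set.
  by rewrite leb_slab_none mul0r.
apply: (le_trans (prb_bigcup_le _ _)).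
  by move=> r; apply: measurableI; apply: mZset; exact: measurable_slab.
apply: (@le_trans _ _ (\sum_(r < n.+1) N^-1 * N^-1)); last first.
  by rewrite sumr_const card_ord -[leLHS]mulr_natl mulrA divff ?mul1r// pnatr_eq0.
apply: ler_sum => r _.
have := @hbox (fun i => if (i == ij.1) || (i == ij.2) then pr @^-1` slab n r else setT) _.
rewrite (_ : [set w | _] = [set w | slab n r (pr (Z ij.1 w))] `&` [set w | slab n r (pr (Z ij.2 w))]); last first.
  apply/seteqP; split => w /= H.
    by split; [have := H ij.1|have := H ij.2]; rewrite eqxx ?orbT.
  by move=> i; case: (eqVneq i ij.1) => [->|_] /=; [case: H|case: eqP => // ->; case: H].
move=> ->; last by move=> i; case: ifP => _ //; apply: mset; exact: measurable_slab.
rewrite (@eq_Rintegral _ _ _ _ _ (fun=> N^-1 * N^-1)); first by rewrite Rint_cst.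
move=> w _; rewrite (bigD1 ij.1)//= (bigD1 ij.2) 1?eq_sym//= !eqxx orbT big1 ?mulr1.
  by rewrite prE ?leb_slab_some//; exact: measurable_slab.
by move=> i /andP[/negbTE-> /negbTE->]; rewrite prbT.
Qed.

Lemma no_clash w (i j : 'I_k) : (forall ij, ~ clash ij w) ->
  ((pr (Z i w) < pr (Z j w)) =
   (slab_val R (slab_of n (pr (Z i w))) < slab_val R (slab_of n (pr (Z j w))))) /\
  ((pr (Z i w) <= pr (Z j w)) =
   (slab_val R (slab_of n (pr (Z i w))) <= slab_val R (slab_of n (pr (Z j w))))).
Proof.
move=> H; case: (eqVneq i j) => [->|ne]; first by rewrite !ltxx !lexx.
have some l : exists r, slab_of n (pr (Z l w)) = Some r.
  have := H (l, l); rewrite /clash eqxx /= /slab_set /=.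
  by case: slab_of => [r _|//]; exists r.
have [r hr] := some i; have [t ht] := some j.
rewrite hr ht; apply: (slab_compare hr ht); apply/eqP => rt.
apply: (H (i, j)); rewrite /clash (negbTE ne) /=; exists r => //.
by split; apply/slab_ofP => //; rewrite rt.
Qed.

End coincidence.

(** Relative orders are correctly read on the grid unless two points fall in the
    same row or the same column. *)
Theorem grid_occ_approx (p : 'S_k) :
  `|prb Q [set w | perm_of_points [tuple Z i w | i < k] = p] -
    \int[P']_w grid_occ p (mu w)| <= 2 * (k ^ 2)%:R / N.
Proof.
pose cells w : {ffun 'I_k -> cell} := [ffun i => (slab_of n (Z i w).1, slab_of n (Z i w).2)].
have cellsE c : cells @^-1` [set c] = [set w | forall i, cell_set (c i) (Z i w)].
  apply/seteqP; split => w /=; first by move=> <- i; rewrite /cells ffunE.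
  by move=> H; apply/ffunP => i; rewrite /cells ffunE; have [/= -> ->] := H i; case: (c i).
have mcells c : measurable (cells @^-1` [set c]).
  rewrite cellsE (_ : [set w | _] = \bigcap_(i in [set: 'I_k]) (Z i @^-1` cell_set (c i))).
    apply: fin_bigcap_measurable => [|i _]; first exact: finite_finset.
    by rewrite -[X in measurable X]setTI; apply: mZ => //; exact: measurable_cell_set.
  by apply/seteqP; split => [w /= H i _|w /= H i]; [exact: H|exact: (H i Logic.I)].
pose G := [set w | perm_of_points [tuple cell_pt (cells w i) | i < k] = p].
have mG : measurable G.
  by apply: (@measurable_finval _ _ _ cells [set c | perm_of_points [tuple cell_pt (c i) | i < k] = p]).
have mu_c c : bmeas (fun w => \prod_i prb (mu w) (cell_set (c i))).
  by apply: bmeas_prod => i; exact: hm.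
have GE : prb Q G = \int[P']_w grid_occ p (mu w).
  transitivity (\int[Q]_w ((perm_of_points [tuple cell_pt (cells w i) | i < k] == p)%:R : R)).
    rewrite -Rint_prb//; apply: eq_Rintegral => w _; rewrite indicE; congr (nat_of_bool _)%:R.
    by apply/idP/eqP => [|h]; rewrite inE.
  rewrite (@Rint_finval _ _ _ Q _ cells (fun c => (perm_of_points [tuple cell_pt (c i) | i < k] == p)%:R))//.
  rewrite /grid_occ Rint_sum; last by move=> c; apply: bmeasM => //; exact: bmeas_cst.
  apply: eq_bigr => c _; rewrite RintZ//; congr (_ * _).
  by rewrite cellsE -hbox// => i; exact: measurable_cell_set.
rewrite -GE.
pose B := \bigcup_(ij in [set: 'I_k * 'I_k]) (clash fst ij `|` clash snd ij).
have mfs : measurable_fun setT (fst : (R * R)%type -> R) by exact: measurable_fst.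
have msn : measurable_fun setT (snd : (R * R)%type -> R) by exact: measurable_snd.
have mcl ij : measurable (clash fst ij `|` clash snd ij).
  by apply: measurableU; exact: measurable_clash.
have mB : measurable B by exact: measurable_bigcup_fin.
apply: (@le_trans _ _ (prb Q B)).
  apply: prb_dist => //; first exact: measurable_perm_of_points.
  move=> w nB.
  have c1 ij : ~ clash fst ij w by move=> h; apply: nB; exists ij => //; left.
  have c2 ij : ~ clash snd ij w by move=> h; apply: nB; exists ij => //; right.
  suff e : perm_of_points [tuple Z i w | i < k] =
      perm_of_points [tuple cell_pt (cells w i) | i < k] by rewrite /G /= e.
  apply: perm_of_points_eq => i j; rewrite !tnth_mktuple /cell_pt /cells !ffunE /=.
    by have [_ ->] := no_clash i j c1.
  by have [-> _] := no_clash i j c2.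
apply: (le_trans (prb_bigcup_le _ mcl)).
apply: (@le_trans _ _ (\sum_(ij : 'I_k * 'I_k) (N^-1 + N^-1))).
  apply: ler_sum => ij _; apply: le_trans (prbU_le _ _ _) _; try exact: measurable_clash.
  by apply: lerD; apply: prb_clash => //; [exact: prb_fst|exact: prb_snd].
rewrite sumr_const card_prod card_ord -[leLHS]mulr_natl mulnn.
by rewrite le_eqVlt; apply/orP; left; apply/eqP; ring.
Qed.

End Mixture.

(** * Continuity of pattern densities *)

Section OccContinuous.
Variable R : realType.
Implicit Types (mu : permuton R).

Lemma continuous_rsum (S : topologicalType) (I : Type) (s : seq I) (u : I -> S -> R) :
  (forall i, continuous (u i)) -> continuous (fun x => \sum_(i <- s) u i x).
Proof.
by move=> cu x; exact: (@rcvg_sum R S (nbhs x) _ I s u (u^~ x) (fun i => cu i x)).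
Qed.

Lemma continuous_rprod (S : topologicalType) (I : Type) (s : seq I) (u : I -> S -> R) :
  (forall i, continuous (u i)) -> continuous (fun x => \prod_(i <- s) u i x).
Proof.
by move=> cu x; exact: (@rcvg_prod R S (nbhs x) _ I s u (u^~ x) (fun i => cu i x)).
Qed.

Lemma prb_rectangle mu (a a' b b' : R) : a <= a' -> b <= b' ->
  prb mu (`]a, a']%classic `*` `]b, b']%classic) =
  pcdf mu a' b' - pcdf mu a b' - pcdf mu a' b + pcdf mu a b.
Proof.
move=> aa bb.
have split_itv (c c' : R) : c <= c' -> forall x : R,
    (x \in `]-oo, c']) = (x \in `]-oo, c]) || (x \in `]c, c']).
  by move=> cc x; rewrite !in_itv/=; case: (leP x c) => //= h; rewrite (le_trans h cc).
have mr (s s' : interval R) : measurable ([set` s] `*` [set` s'] : set (R * R)%type).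
  by apply: measurableX; exact: measurable_itv.
have H y : pcdf mu a' y = pcdf mu a y + prb mu (`]a, a']%classic `*` `]-oo, y]%classic).
  rewrite /pcdf -prbU; [|exact: measurable_quadrant|exact: mr|]; last first.
    apply/seteqP; split => // -[x z] [[/= h1 _] [/= h2 _]].
    by move: h1 h2; rewrite !in_itv/= => h1 /andP[h2 _]; rewrite leNgt h2 in h1.
  congr prb; apply/seteqP; split => -[x z] /=.
    by move=> [/=]; rewrite (split_itv _ _ aa) => /orP[] h1 h2; [left|right].
  by move=> [[/= h1 h2]|[/= h1 h2]]; split => //=; rewrite (split_itv _ _ aa) h1 ?orbT.
have H2 : prb mu (`]a, a']%classic `*` `]-oo, b']%classic) =
    prb mu (`]a, a']%classic `*` `]-oo, b]%classic) + prb mu (`]a, a']%classic `*` `]b, b']%classic).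
  rewrite -prbU; [|exact: mr|exact: mr|]; last first.
    apply/seteqP; split => // -[x z] [[_ /= h1] [_ /= h2]].
    by move: h1 h2; rewrite !in_itv/= => h1 /andP[h2 _]; rewrite leNgt h2 in h1.
  congr prb; apply/seteqP; split => -[x z] /=.
    by move=> [/=] h2; rewrite (split_itv _ _ bb) => /orP[] h1; [left|right].
  by move=> [[/= h1 h2]|[/= h1 h2]]; split => //=; rewrite (split_itv _ _ bb) h2 ?orbT.
have := H b; have := H b'; lra.
Qed.

Lemma continuous_cell_mass n (c : option 'I_n.+1 * option 'I_n.+1) :
  continuous (fun mu : permuton R => prb mu (cell_set c)).
Proof.
have N0 : 0 < n.+1%:R :> R by rewrite ltr0n.
have null mu (A : set (R * R)%type) : measurable A -> prb mu A = 0 ->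
    forall B : set (R * R)%type, measurable B -> B `<=` A -> prb mu B = 0.
  by move=> mA A0 B mB BA; apply/eqP; rewrite eq_le prb_ge0 andbT -A0; exact: prb_le.
have mnone : measurable (slab_set (R := R) (n := n) None) by exact: measurable_slab_set.
have zero_cont (f : permuton R -> R) : (forall mu, f mu = 0) -> continuous f.
  by move=> f0; rewrite (_ : f = fun=> 0); [exact: cst_continuous|exact/funext].
case: c => [[r|] [t|]].
- pose e (i : nat) : R := i%:R / n.+1%:R.
  have ee i : e i <= e i.+1 by rewrite ler_pM2r ?invr_gt0// ler_nat.
  rewrite (_ : (fun mu => _) = fun mu : permuton R =>
    pcdf mu (e r.+1) (e t.+1) - pcdf mu (e r) (e t.+1) - pcdf mu (e r.+1) (e t) + pcdf mu (e r) (e t)).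
    have cB (f g : permuton R -> R) : continuous f -> continuous g ->
        continuous (fun mu => f mu - g mu).
      by move=> cf cg x; exact: (cvgB (cf x) (cg x)).
    have cD (f g : permuton R -> R) : continuous f -> continuous g ->
        continuous (fun mu => f mu + g mu).
      by move=> cf cg x; exact: (cvgD (cf x) (cg x)).
    by apply: (cD _ _ (cB _ _ (cB _ _ _ _) _) _); exact: continuous_pcdf.
  apply/funext => mu; rewrite /cell_set /= !slab_setS.
  exact: (prb_rectangle mu (ee r) (ee t)).
all: apply: zero_cont => mu.
- by apply: (null _ (snd @^-1` slab_set (R := R) (n := n) None));
    [exact: measurable_snd_set|rewrite prb_snd// leb_slab_none|exact: measurable_cell_set|move=> z []].
- by apply: (null _ (fst @^-1` slab_set (R := R) (n := n) None));
    [exact: measurable_fst_set|rewrite prb_fst// leb_slab_none|exact: measurable_cell_set|move=> z []].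
- by apply: (null _ (fst @^-1` slab_set (R := R) (n := n) None));
    [exact: measurable_fst_set|rewrite prb_fst// leb_slab_none|exact: measurable_cell_set|move=> z []].
Qed.

Lemma continuous_grid_occ (k n : nat) (p : 'S_k) : continuous (grid_occ (R := R) n p).
Proof.
apply: continuous_rsum => c mu.
have cp : continuous (fun mu : permuton R => \prod_i prb mu (cell_set (c i))).
  by apply: continuous_rprod => i; exact: continuous_cell_mass.
exact: (cvgM (cvg_cst _) (cp mu)).
Qed.

Lemma occ_permuton_grid (k n : nat) (p : 'S_k) mu :
  `|occ_permuton p mu - grid_occ n p mu| <= 2 * (k ^ 2)%:R / n.+1%:R.
Proof.
have := @grid_occ_approx R k n _ _ (power_prob mu k) (fun i m => tnth m i) _ _ (unif R)
  (fun=> mu) (fun i => measurable_tnth i) _ _ p.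
rewrite Rint_cst; set A := [set m | _]; rewrite (_ : A = [set m | perm_of_points m = p]).
  apply.
  - by move=> B mB; rewrite power_prob_box// Rint_cst.
  - by move=> c; exact: bmeas_cst.
apply/seteqP; rewrite /A; split => m /=.
  by congr (perm_of_points _ = _); apply: eq_from_tnth => i; rewrite tnth_mktuple.
by move=> <-; congr perm_of_points; apply: eq_from_tnth => i; rewrite tnth_mktuple.
Qed.

Lemma vanish_inv (C e : R) : 0 < e -> exists n0 : nat, forall n, (n0 <= n)%N ->
  C / n.+1%:R <= e.
Proof.
move=> e0; have d0 : 0 < e / (`|C| + 1) by rewrite divr_gt0// ltr_wpDl.
have [n0 h] := inv_nat_small d0; exists n0 => n nn.
have h1 : n.+1%:R^-1 <= n0.+1%:R^-1 :> R by rewrite lef_pV2 ?posrE ?ltr0n// ler_nat.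
apply: (@le_trans _ _ ((`|C| + 1) * n.+1%:R^-1)).
  by rewrite ler_wpM2r// (le_trans (ler_norm C))// lerDl.
rewrite mulrC -ler_pdivlMr ?ltr_wpDl//.
exact: le_trans h1 (ltW h).
Qed.

(** A pattern density is a uniform limit of polynomials in finitely many cell
    masses, each of which is continuous. *)
Theorem continuous_occ_permuton (k : nat) (p : 'S_k) :
  continuous (fun mu : permuton R => occ_permuton p mu).
Proof.
apply: continuous_uniform_approx => e e0.
have [n hn] := vanish_inv (2 * (k ^ 2)%:R) e0.
exists (grid_occ n p); first exact: continuous_grid_occ.
by move=> mu; apply: le_trans (occ_permuton_grid n p mu) (hn n (leqnn n)).
Qed.

Lemma measurable_perm_event (k : nat) (p : 'S_k) :
  measurable [set m : k.-tuple (R * R)%type | perm_of_points m = p].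
Proof.
have := @measurable_perm_of_points R k _ (k.-tuple (R * R)%type)
  (fun i m => tnth m i) p (fun i => measurable_tnth i).
rewrite (_ : [set w | _] = [set m | perm_of_points m = p])//.
apply/seteqP; split => m /=.
  by congr (perm_of_points _ = _); apply: eq_from_tnth => i; rewrite tnth_mktuple.
by move=> <-; congr perm_of_points; apply: eq_from_tnth => i; rewrite tnth_mktuple.
Qed.

Lemma occ_permuton01 (k : nat) (p : 'S_k) mu : 0 <= occ_permuton p mu <= 1.
Proof.
rewrite /occ_permuton -/(prb _ _) prb_ge0 prb_le1//.
exact: measurable_perm_event.
Qed.

Lemma bmeas_permuton_rv d (Om : measurableType d) (P : probability Om R)
    (mu : {RV P >-> borel (permuton R)}) (f : permuton R -> R) :
  continuous f -> bmeas (fun w => f (mu w)).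
Proof.
by move=> cf; apply: bmeas_rv => //; exact: permuton_continuous_bounded.
Qed.

(** Both sides are within the same grid error of the expectation of [grid_occ],
    and the grid can be refined. *)
Lemma cond_iid_occ d (Om : measurableType d) (P : probability Om R)
    (mu : {RV P >-> borel (permuton R)}) (k : nat) (m : 'I_k -> {RV P >-> (R * R)%type})
    (p : 'S_k) : cond_iid P mu m ->
  \int[P]_w occ_permuton p (mu w) =
  prb P [set w | perm_of_points [tuple m i w | i < k] = p].
Proof.
move=> iid.
have hbox (A : 'I_k -> set (R * R)%type) : (forall i, measurable (A i)) ->
    prb P [set w | forall i, A i (m i w)] = \int[P]_w \prod_i prb (mu w : permuton R) (A i).
  move=> mA; have := iid setT A measurableT mA.
  rewrite preimage_setT setTI (_ : \bigcap_(i in _) _ = [set w | forall i, A i (m i w)]); last first.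
    by apply/seteqP; split => [w /= H i|w /= H i _]; [exact: (H i Logic.I)|exact: H].
  rewrite /prb => ->; rewrite /Rintegral; congr fine; apply: eq_integral => w _.
  by rewrite -prodEFin; apply: eq_bigr => i _; rewrite fineK// fin_num_measure.
have mm i : measurable_fun setT (m i : Om -> (R * R)%type) by [].
apply/eqP; rewrite -subr_eq0 -normr_le0 leNgt; apply/negP => h.
set del := Num.norm _ in h.
have d4 : 0 < del / 4 by rewrite divr_gt0.
have [n hn] := vanish_inv (2 * (k ^ 2)%:R) d4.
have h1 := grid_occ_approx mm hbox
  (fun c => bmeas_permuton_rv mu (@continuous_cell_mass n c)) p.
have h2 : `|\int[P]_w occ_permuton p (mu w) - \int[P]_w grid_occ n p (mu w)| <=
    2 * (k ^ 2)%:R / n.+1%:R.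
  apply: Rint_dist.
  - exact: (bmeas_permuton_rv mu (@continuous_occ_permuton k p)).
  - exact: (bmeas_permuton_rv mu (@continuous_grid_occ k n p)).
  - by move=> w; exact: occ_permuton_grid.
have := hn n (leqnn n).
have := ler_distD (\int[P]_w grid_occ n p (mu w)) (\int[P]_w occ_permuton p (mu w))
  (prb P [set w | perm_of_points [tuple m i w | i < k] = p]).
rewrite -/del [X in _ <= _ + X]distrC.
move: h1 h2; move: (2 * _ / _) => v; lra.
Qed.

End OccContinuous.

(** * Pattern densities of a permutation and of its permuton *)

Section FiniteSampling.

(** Among [k] draws there are at most [k ^ 2] pairs, each equal with probability
    [1 / N]. *)
Lemma ffact_gap (N k : nat) : (N * (N ^ k - N ^_ k) <= k ^ 2 * N ^ k)%N.
Proof.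
have gap j : (N * N ^_ j - j * N ^_ j <= N ^_ j.+1)%N.
  by rewrite ffactnSr -mulnBl mulnC.
have le j : (N ^_ j <= N ^ j)%N.
  by elim: j => [//|j IH]; rewrite ffactnSr expnSr leq_mul// leq_subr.
elim: k => [|k IH]; first by rewrite ffactn0 expn0 subnn muln0.
move: IH (gap k) (le k); rewrite [(N ^ k.+1)%N]expnS.
move: (N ^_ k.+1)%N (N ^_ k)%N (N ^ k)%N => f' f e IH h1 h2.
have h4 : (N * e - f' <= k ^ 2 * e + k * e)%N.
  have : (N * e <= N * f + k ^ 2 * e)%N by rewrite -leq_subLR -mulnBr.
  have : (k * f <= k * e)%N by rewrite leq_mul2l h2 orbT.
  by move: h1; move: (N * f)%N (N * e)%N (k ^ 2 * e)%N (k * f)%N (k * e)%N; lia.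
have h5 : (k ^ 2 * e + k * e <= k.+1 ^ 2 * e)%N.
  by rewrite -mulnDl leq_mul2r; apply/orP; right; rewrite -mulnn -[X in (_ <= X)%N]mulnn; nia.
by rewrite mulnCA leq_mul2l (leq_trans h4 h5) orbT.
Qed.

Lemma card_inj_with_image (n k : nat) (J : {set 'I_n}) : #|J| = k ->
  #|[set t : {ffun 'I_k -> 'I_n} | injectiveb t && ([set t i | i in 'I_k]%SET == J)]%SET| = k`!.
Proof.
move=> cJ; have := card_inj_ffuns_on 'I_k (mem J).
rewrite card_ord cJ ffactnn => <-; apply: eq_card => t; rewrite !inE andbC.
case: (boolP (injectiveb t)) => ti; rewrite ?andbF// !andbT.
apply/eqP/ffun_onP.
  by move=> tJ i; rewrite -tJ; apply/imsetP; exists i.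
move=> tJ; apply/eqP; rewrite eqEcard; apply/andP; split.
  by apply/fintype.subsetP => x /imsetP[i _ ->]; exact: tJ.
by rewrite card_imset ?card_ord ?cJ//; exact/injectiveP.
Qed.

Variables (R : realType) (n k : nat) (s : 'S_n.+1).
Local Notation N := (n.+1%:R : R).
Local Notation mu := (perm_permuton R s).

Definition graph_pt (r : 'I_n.+1) : R * R := (r%:R, (s r)%:R).

(** Sorting points of a graph by abscissa lists the sampled positions in
    increasing order, as the definition of a pattern does. *)
Lemma perm_of_graph_points (t : {ffun 'I_k -> 'I_n.+1}) : injective t ->
  perm_of_points [tuple graph_pt (t i) | i < k] = pat k [set t i | i in 'I_k]%SET s.
Proof.
move=> ti; set J := [set t i | i in 'I_k]%SET.
pose le_I (x y : 'I_n.+1) := (x <= y)%N.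
rewrite /perm_of_points.
have -> : [tuple graph_pt (t i) | i < k] = [seq graph_pt x | x <- [seq t i | i <- enum 'I_k]] :> seq (R * R).
  by rewrite /= -map_comp.
rewrite (@sort_points _ _ graph_pt _ le_I); last first.
  by move=> x y; rewrite ler_nat.
have leT : transitive le_I by move=> x y z; exact: leq_trans.
have leA : antisymmetric le_I.
  by move=> x y /andP[h1 h2]; apply/val_inj/eqP; rewrite eqn_leq; apply/andP.
have -> : sort le_I [seq t i | i <- enum 'I_k] = enum J.
  apply: (sorted_eq leT leA).
  - by apply: sort_sorted => x y; exact: leq_total.
  - have -> : enum J = [seq x <- enum 'I_n.+1 | x \in J] by rewrite enumT.
    apply: sorted_filter => //.
    by have := iota_sorted 0 n.+1; rewrite -val_enum_ord sorted_map.
  - rewrite perm_sort; apply: uniq_perm.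
    + by rewrite map_inj_uniq// enum_uniq.
    + exact: enum_uniq.
    + move=> x; rewrite mem_enum; apply/mapP/imsetP => -[i _ ->]; exists i => //.
      by rewrite mem_enum.
have cJ : #|J| = k by rewrite card_imset// card_ord.
apply: std_eq => i j.
have lt_enum (l : 'I_k) : (l < size (enum J))%N by rewrite -cardE cJ.
by rewrite !(nth_map ord0)//= ltr_nat.
Qed.

Definition graph_cell (r : 'I_n.+1) : option 'I_n.+1 * option 'I_n.+1 :=
  (Some r, Some (s r)).

Lemma graph_cell_inj : injective graph_cell.
Proof. by move=> r r' []. Qed.

Lemma prb_graph_cell (c : option 'I_n.+1 * option 'I_n.+1) :
  prb mu (cell_set c) = [exists r, graph_cell r == c]%:R / N.
Proof.
rewrite (@prb_graph R n s _ [pred r | graph_cell r == c]).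
- congr (_%:R / _); case: existsP => [[r rc]|no].
    rewrite -[RHS]/(1%N) -(card1 r); apply: eq_card => r'; rewrite !inE; apply/eqP/eqP => [|->]; last exact/eqP.
    by move: rc => /eqP <-; exact: graph_cell_inj.
  by rewrite eq_card0// => r; rewrite inE; apply/negP => h; apply: no; exists r.
- exact: measurable_cell_set.
- move=> r /= /eqP <- z [z1 z2]; split; rewrite /graph_cell /= slab_setS//.
- move=> r /= rc; apply/seteqP; split => // z [[z1 z2] [w1 w2]].
  move/eqP: rc; apply; move: c w1 w2 => [c1 c2] /= w1 w2.
  by move: z1 z2; rewrite -!slab_setS => z1 z2; rewrite /graph_cell -w1 -w2 z1 z2.
Qed.

Lemma grid_occ_graph (p : 'S_k) : grid_occ n p mu =
  #|[set t : {ffun 'I_k -> 'I_n.+1} | perm_of_points [tuple graph_pt (t i) | i < k] == p]%SET|%:R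
    / N ^+ k.
Proof.
pose h (t : {ffun 'I_k -> 'I_n.+1}) := [ffun i => graph_cell (t i)].
have hi : injective h.
  move=> t t' e; apply/ffunP => i; apply: graph_cell_inj.
  by have := congr1 (fun f : {ffun 'I_k -> _} => f i) e; rewrite !ffunE.
rewrite /grid_occ (bigID (fun c => c \in [set h t | t in finset.setTfor {ffun 'I_k -> 'I_n.+1}]%SET))/= [X in _ + X]big1 ?addr0.
  rewrite big_imset/=; last by move=> ? ? _ _; exact: hi.
  rewrite (eq_bigr (fun t : {ffun 'I_k -> 'I_n.+1} => (perm_of_points [tuple graph_pt (t i) | i < k] == p)%:R * N^-1 ^+ k)).
    rewrite -big_distrl/= exprVn -sum1dep_card natr_sum; congr (_ / _).
    rewrite [RHS]big_mkcond/=; apply: eq_big => [t|t _]; first by rewrite inE.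
    by case: eqP.
  move=> t _; congr ((perm_of_points _ == p)%:R * _).
    by apply: eq_from_tnth => i; rewrite !tnth_mktuple ffunE.
  rewrite (eq_bigr (fun=> N^-1)) ?prodr_const ?card_ord// => i _.
  rewrite prb_graph_cell ffunE (_ : [exists r, _]) ?mul1r//.
  by apply/existsP; exists (t i).
move=> c cn; rewrite [\prod_i _](_ : _ = 0) ?mulr0//.
have [all_c|] := boolP [forall i, exists r, graph_cell r == c i].
  case/negP: cn; have H i : {r | graph_cell r == c i}.
    by apply: sigW; have /forallP/(_ i)/existsP := all_c.
  apply/imsetP; exists [ffun i => sval (H i)]; first by rewrite finset.in_setT.
  apply/ffunP => i.
  by rewrite !ffunE; apply/esym/eqP; exact: (svalP (H i)).
move=> /forallPn[i /negbTE hi0]; rewrite (bigD1 i)//= prb_graph_cell hi0.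
by rewrite !mul0r.
Qed.

(** Each subset that carries the pattern is enumerated by [k`!] injective
    tuples. *)
Lemma card_graph_tuples (p : 'S_k) :
  #|[set t : {ffun 'I_k -> 'I_n.+1} | injectiveb t &&
     (perm_of_points [tuple graph_pt (t i) | i < k] == p)]%SET| =
  (#|[set J : {set 'I_n.+1} | (#|J| == k) && (pat k J s == p)]%SET| * k`!)%N.
Proof.
rewrite -sum1dep_card.
rewrite (partition_big (fun t : {ffun 'I_k -> 'I_n.+1} => [set t i | i in 'I_k]%SET)
  (fun J : {set 'I_n.+1} => (#|J| == k) && (pat k J s == p)))/=; last first.
  move=> t /andP[/injectiveP ti /eqP <-].
  by rewrite perm_of_graph_points// eqxx card_imset// card_ord eqxx.
rewrite (eq_bigr (fun=> k`!)); first by rewrite sum_nat_const; congr (_ * _)%N; apply: eq_card => J; rewrite !inE.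
move=> J /andP[/eqP cJ /eqP pJ]; rewrite -(card_inj_with_image cJ) -sum1dep_card.
apply: eq_bigl => t; have [ti|] := boolP (injectiveb t) => //=.
apply/andP/idP => [[]//|/eqP tJ]; split; last exact/eqP.
by rewrite perm_of_graph_points ?tJ ?pJ//; exact/injectiveP.
Qed.

(** Sampling with and without replacement differ by the probability of a
    repetition. *)
Lemma grid_occ_occ (p : 'S_k) : `|grid_occ n p mu - occ R p s| <= (k ^ 2)%:R / N.
Proof.
rewrite grid_occ_graph /occ.
set T := [set t : {ffun 'I_k -> 'I_n.+1} | perm_of_points _ == p]%SET.
set S := [set J : {set 'I_n.+1} | _]%SET.
pose V := [set t : {ffun 'I_k -> 'I_n.+1} | injectiveb t]%SET.
have cV : #|V| = (n.+1 ^_ k)%N by rewrite card_inj_ffuns !card_ord.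
have cTV : #|T :&: V| = (#|S| * k`!)%N.
  by rewrite -card_graph_tuples; apply: eq_card => t; rewrite !inE andbC.
have cVC : #|T :\: V| = (#|T| - #|T :&: V|)%N by rewrite -(cardsID V T) addKn.
have leV : (#|T :\: V| <= n.+1 ^ k - n.+1 ^_ k)%N.
  have := cardsC V; rewrite cV card_ffun !card_ord => <-; rewrite addKn.
  by apply: subset_leq_card; apply/fintype.subsetP => t; rewrite !inE => /andP[].
have leA : (#|S| * k`! <= n.+1 ^_ k)%N.
  by rewrite -cTV -cV; apply: subset_leq_card; exact: finset.subsetIr.
have leT : (#|S| * k`! <= #|T|)%N by rewrite -cTV; apply: subset_leq_card; exact: finset.subsetIl.
have leF : (n.+1 ^_ k <= n.+1 ^ k)%N.
  by have := max_card (mem V); rewrite cV card_ffun !card_ord.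
have eC : ('C(n.+1, k) * k`! = n.+1 ^_ k)%N by rewrite bin_ffact.
have gap : N * ((n.+1 ^ k)%:R - (n.+1 ^_ k)%:R) <= (k ^ 2)%:R * (n.+1 ^ k)%:R :> R.
  by rewrite -natrB// -!natrM ler_nat ffact_gap.
have eS : #|S|%:R / ('C(n.+1, k))%:R = (#|S| * k`!)%:R / (n.+1 ^_ k)%:R :> R.
  rewrite -eC !natrM -mulf_div divff ?mulr1// pnatr_eq0 -lt0n fact_gt0//.
rewrite eS -natrX.
have N0 : 0 < N by rewrite ltr0n.
have E0 : 0 < (n.+1 ^ k)%:R :> R by rewrite ltr0n expn_gt0.
have h1 : #|T|%:R - (#|S| * k`!)%:R <= (n.+1 ^ k)%:R - (n.+1 ^_ k)%:R :> R.
  by rewrite -!natrB// ler_nat -cTV -cVC.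
have h0 : (#|S| * k`!)%:R <= #|T|%:R :> R by rewrite ler_nat.
have h2 : (#|S| * k`!)%:R <= (n.+1 ^_ k)%:R :> R by rewrite ler_nat.
have h3 : (n.+1 ^_ k)%:R <= (n.+1 ^ k)%:R :> R by rewrite ler_nat.
have h4 : 0 <= (#|S| * k`!)%:R :> R by [].
have B : ((n.+1 ^ k)%:R - (n.+1 ^_ k)%:R) / (n.+1 ^ k)%:R <= (k ^ 2)%:R / N.
  by rewrite ler_pdivrMr// mulrAC ler_pdivlMr// mulrC.
apply: le_trans B.
move: h0 h1 h2 h3 h4; move: (#|T|%:R : R) ((#|S| * k`!)%:R : R) ((n.+1 ^_ k)%:R : R).
move: ((n.+1 ^ k)%:R : R) E0 => E E0 t a f h0 h1 h2 h3 h4.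
have [f0|f0] := eqVneq f 0.
  have a0 : a = 0 by apply/eqP; rewrite eq_le h4 andbT -f0.
  have t0 : 0 <= t by rewrite -a0.
  rewrite f0 a0 mul0r !subr0 ger0_norm; last exact: (divr_ge0 t0 (ltW E0)).
  by rewrite ler_pM2r ?invr_gt0//; move: h1; rewrite f0 a0 !subr0.
have fp : 0 < f by rewrite lt_def f0 (le_trans h4).
have a1 : a / f <= 1 by rewrite ler_pdivrMr// mul1r.
have a2 : 0 <= a / f by rewrite divr_ge0// ltW.
have ea : a / f * f = a by rewrite divfK.
rewrite ler_norml -(ler_pM2r E0) -[X in _ && X](ler_pM2r E0) mulNr !mulrBl !divfK ?gt_eqF//.
move: (a / f) a1 a2 ea => x a1 a2 ea; apply/andP; split; nra.
Qed.

Theorem occ_permuton_perm (p : 'S_k) :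
  `|occ_permuton p mu - occ R p s| <= 3 * (k ^ 2)%:R / N.
Proof.
have := ler_distD (grid_occ n p mu) (occ_permuton p mu) (occ R p s).
have := occ_permuton_grid n p mu; have := grid_occ_occ p.
rewrite -!mulrA; move: ((k ^ 2)%:R / N) => v; lra.
Qed.

End FiniteSampling.

(** * Laws of random infinite vectors *)

Section InfiniteVectors.
Variables (R : realType) (I : countType).
Local Notation V := {ptws I -> R}.

(** Vectors with entries in [0, 1] form a compact set, on which continuity is
    uniform. *)
Lemma ptws_uniform (f : V -> R) (c : I -> R) (e : R) : continuous f -> 0 < e ->
  exists n0 : nat, forall n (u v : V), (n0 <= n)%N ->
    (forall i, 0 <= u i <= 1) -> (forall i, `|u i - v i| <= c i / n.+1%:R) ->
    `|f u - f v| <= e.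
Proof.
move=> cf e0; apply: contrapT => no.
have /choice[uv uvP] : forall n0 : nat, exists uv : V * V,
    [/\ forall i, 0 <= uv.1 i <= 1,
      forall i, exists2 n, (n0 <= n)%N & `|uv.1 i - uv.2 i| <= c i / n.+1%:R &
      e < `|f uv.1 - f uv.2|].
  move=> n0; apply: contrapT => h; apply: no; exists n0 => n u v n0n hu huv.
  rewrite leNgt; apply/negP => he; apply: h; exists (u, v); split => // i.
  by exists n.
have [F [FU Foo]] := ultra_eventually.
have /choice[l lP] : forall i, exists l : R, (uv j).1 i @[j --> F] --> l.
  move=> i; apply: (@ultra_bounded_cvg _ _ FU _ 1) => j.
  by have [/(_ i)/andP[h0 h1] _ _] := uvP j; rewrite ger0_norm.
have lP2 i : (uv j).2 i @[j --> F] --> l i.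
  apply/cvgrPdist_le => eps eps0.
  have eps2 : 0 < eps / 2 by rewrite divr_gt0.
  have [n0 hn0] := vanish_inv (c i) eps2.
  have hF : \forall j \near F, (n0 <= j)%N by apply: Foo; exact: nbhs_infty_ge.
  apply: filterS2 hF (cvg_near_dist (lP i) eps2) => j nj h1.
  have [_ /(_ i)[n jn h2] _] := uvP j.
  have := hn0 n (leq_trans nj jn).
  move: h1 h2; have := ler_distD ((uv j).1 i) (l i) ((uv j).2 i).
  move: (c i / _) => w; lra.
pose L : V := l.
have c1 : (fun j => (uv j).1) @ F --> L by apply/ptws_cvg => i; exact: lP.
have c2 : (fun j => (uv j).2) @ F --> L by apply/ptws_cvg => i; exact: lP2.
have e2 : 0 < e / 2 by rewrite divr_gt0.
have [j /= [h1 h2]] := filter_ex (filterI (cvg_near_dist (cvg_along cf c1) e2)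
  (cvg_near_dist (cvg_along cf c2) e2)).
have [_ _] := uvP j; have := ler_distD (f L) (f (uv j).1) (f (uv j).2).
rewrite [X in _ <= X + _]distrC; lra.
Qed.

Definition orthant (s : seq (I * R)) : set V := [set g | all (fun q => g q.1 <= q.2) s].

Definition orthants : set (set V) := [set A | exists s, A = orthant s].

Lemma measurable_orthant s : measurable (orthant s : set (borel V)).
Proof.
elim: s => [|q s IH].
  by rewrite (_ : orthant _ = setT); [exact: measurableT|apply/seteqP; split].
rewrite (_ : orthant _ = ~` [set g : V | q.2 < g q.1] `&` orthant s); last first.
  apply/seteqP; split => g /=; rewrite /orthant /=.
    by move=> /andP[h1 h2]; split => //; rewrite ltNge h1.
  by move=> [/negP h1 ->]; rewrite andbT leNgt.
apply: measurableI => //; apply: measurableC; apply: sub_sigma_algebra.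
rewrite (_ : [set _ | _] = (fun g : V => g q.1) @^-1` `]q.2, +oo[%classic); last first.
  by apply/seteqP; split => g /=; rewrite in_itv/= andbT.
by apply: open_comp => // g _; exact: ptws_proj_continuous.
Qed.

Definition rational_box (s : seq (I * (rat * rat))) : set V :=
  [set g | all (fun q => ratr q.2.1 < g q.1 < ratr q.2.2) s].

(** The sets that contain a rational box around [x] form a filter that converges
    to [x] coordinatewise, hence in the product topology. *)
Lemma rational_box_nbhs (x : V) (O : set V) : nbhs x O ->
  exists s, rational_box s x /\ rational_box s `<=` O.
Proof.
pose F : set_system V := [set A | exists s, rational_box s x /\ rational_box s `<=` A].
have FF : Filter F.
  split; first by exists [::].
    move=> A B [s [sx sA]] [t [tx tB]]; exists (s ++ t).
    rewrite /rational_box; split => [|g] /=; rewrite all_cat.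
      by apply/andP.
    by move=> /andP[hs ht]; split; [exact: sA|exact: tB].
  by move=> A B AB [s [sx sA]]; exists s; split => //; exact: subset_trans AB.
suff : F --> x by move=> h /h.
apply/ptws_cvg => i; apply/cvgrPdist_lt => e e0.
have [a /andP[a1 a2]] : exists a : rat, x i - e < ratr a < x i.
  have [|a] := @rat_in_itvoo R (x i - e) (x i); first by rewrite ltrBlDr ltrDl.
  by rewrite in_itv/=; exists a.
have [b /andP[b1 b2]] : exists b : rat, x i < ratr b < x i + e.
  have [|b] := @rat_in_itvoo R (x i) (x i + e); first by rewrite ltrDl.
  by rewrite in_itv/=; exists b.
exists [:: (i, (a, b))]; split; first by rewrite /rational_box /= a2 b1.
move=> g; rewrite /rational_box /= andbT => /andP[h1 h2].
rewrite ltr_norml; move: a1 b2 h1 h2.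
by move: (ratr a) (ratr b) => a' b'; lra.
Qed.

(** An open set is a countable union of rational boxes. *)
Lemma measurable_orthants : @measurable _ (borel V) = <<s orthants >>.
Proof.
apply/seteqP; split; last first.
  apply: smallest_sub; first exact: sigma_algebra_measurable.
  by move=> _ [s ->]; exact: measurable_orthant.
apply: smallest_sub; first exact: smallest_sigma_algebra.
move=> O oO.
have proj i : measurable_fun setT ((fun g : V => g i) : g_sigma_algebraType orthants -> R).
  apply: (measurability _ (@measurable_left_rays R)).
  move=> _ [_ [a ->] <-]; rewrite setTI; apply: sub_sigma_algebra.
  exists [:: (i, a)]; apply/seteqP; split => g /=; rewrite /orthant /= in_itv/= ?andbT//.
have mbox s : @measurable _ (g_sigma_algebraType orthants) (rational_box s).
  elim: s => [|q s IH].
    by rewrite (_ : rational_box _ = setT); [exact: measurableT|apply/seteqP; split].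
  rewrite (_ : rational_box _ =
      (fun g : V => g q.1) @^-1` `]ratr q.2.1, ratr q.2.2[%classic `&` rational_box s).
    apply: measurableI => //.
    have := proj q.1 measurableT _ (measurable_itv `](ratr q.2.1 : R), ratr q.2.2[).
    by rewrite setTI.
  apply/seteqP; split => g; rewrite /rational_box /= in_itv/=.
    by move=> /andP[].
  by move=> [-> ->].
rewrite (_ : O = \bigcup_(s : seq (I * (rat * rat)))
    (if `[< rational_box s `<=` O >] then rational_box s else set0)).
  apply: (@countable_bigcupT_measurable _ (g_sigma_algebraType orthants)) => // s.
  by case: ifP => _; [exact: mbox|exact: measurable0].
apply/seteqP; split => g.
  move=> Og; have [s [sg sO]] := rational_box_nbhs (open_nbhs_nbhs (conj oO Og)).
  by exists s => //; rewrite (asboolT sO).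
by move=> [s _]; case: asboolP => // sO /sO.
Qed.

Definition soft_orthant (e : R) (s : seq (I * R)) (g : V) : R :=
  \prod_(q <- s) ramp q.2 e (g q.1).

Definition widen_orthant (e : R) (s : seq (I * R)) := [seq (q.1, q.2 + e) | q <- s].

Lemma soft_orthant_cont e s : continuous (soft_orthant e s).
Proof.
apply: continuous_rprod => q g.
apply: (@continuous_comp _ _ _ (fun g : V => g q.1) (ramp q.2 e)).
  exact: ptws_proj_continuous.
exact: continuous_ramp.
Qed.

Lemma soft_orthant01 e s g : 0 <= soft_orthant e s g <= 1.
Proof.
rewrite /soft_orthant; elim: s => [|q s /andP[h0 h1]]; first by rewrite big_nil ler01 lexx.
rewrite big_cons; have /andP[r0 r1] := ramp01 q.2 e (g q.1).
by rewrite mulr_ge0// mulr_ile1.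
Qed.

Lemma soft_orthant_sandwich e s g : 0 < e ->
  \1_(orthant s) g <= soft_orthant e s g <= \1_(orthant (widen_orthant e s)) g.
Proof.
move=> e0; have /andP[h0 h1] := soft_orthant01 e s g; apply/andP; split.
  rewrite indicE; case: (boolP (g \in _)) => [|_]; last exact: h0.
  rewrite inE /orthant /= => /allP H; rewrite /soft_orthant big_seq big1 // => q qs.
  by rewrite ramp1//; exact: H.
rewrite indicE; case: (boolP (g \in _)) => [_|]; first exact: h1.
rewrite notin_setE /orthant /= => /negP/allPn[q' /mapP[q qs ->] /=].
rewrite -ltNge => /ltW h; rewrite /soft_orthant (big_rem q)//= ramp0// mul0r.
exact: lexx.
Qed.

Variables (d1 : measure_display) (Om1 : measurableType d1) (P1 : probability Om1 R)
  (X : {RV P1 >-> borel V}).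
Variables (d2 : measure_display) (Om2 : measurableType d2) (P2 : probability Om2 R)
  (Y : {RV P2 >-> borel V}).

Lemma rv_orthant d (Om : measurableType d) (P : probability Om R)
    (Z : {RV P >-> borel V}) s : measurable (Z @^-1` orthant s).
Proof.
rewrite -[X in measurable X]setTI; apply: measurable_funP => //.
exact: measurable_orthant.
Qed.

Lemma prb_orthant_le s :
  (forall f : V -> R, continuous f -> (exists M, forall g, `|f g| <= M) ->
     \int[P1]_w f (X w) = \int[P2]_w f (Y w)) ->
  prb P1 (X @^-1` orthant s) <= prb P2 (Y @^-1` orthant s).
Proof.
move=> H.
have bs e : exists M, forall g, `|soft_orthant e s g| <= M.
  by exists 1 => g; have /andP[h0 h1] := soft_orthant01 e s g; rewrite ger0_norm.
have step e : 0 < e -> prb P1 (X @^-1` orthant s) <= prb P2 (Y @^-1` orthant (widen_orthant e s)).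
  move=> e0; rewrite -!Rint_prb; [|exact: rv_orthant..].
  apply: (@le_trans _ _ (\int[P1]_w soft_orthant e s (X w))).
    apply: Rint_le => [||w].
    - by apply: bmeas_indic; exact: rv_orthant.
    - by apply: bmeas_rv => //; exact: soft_orthant_cont.
    - by have /andP[h _] := soft_orthant_sandwich s (X w) e0.
  rewrite H//; last exact: soft_orthant_cont.
  apply: Rint_le => [||w].
  - by apply: bmeas_rv => //; exact: soft_orthant_cont.
  - by apply: bmeas_indic; exact: rv_orthant.
  - by have /andP[_ h] := soft_orthant_sandwich s (Y w) e0.
pose A n := Y @^-1` orthant (widen_orthant n.+1%:R^-1 s).
have mA n : measurable (A n) by exact: rv_orthant.
have capA : \bigcap_n A n = Y @^-1` orthant s.
  apply/seteqP; split => w /=; last first.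
    move=> /allP H1 n _; apply/allP => _ /mapP[q qs ->] /=.
    by rewrite (le_trans (H1 _ qs))// lerDl invr_ge0.
  move=> h; apply/allP => q qs; rewrite leNgt; apply/negP => hq.
  have d0 : 0 < Y w q.1 - q.2 by rewrite subr_gt0.
  have [n hn] := inv_nat_small d0.
  have /allP/(_ (q.1, q.2 + n.+1%:R^-1)) := h n Logic.I.
  rewrite (map_f (fun q : I * R => (q.1, q.2 + n.+1%:R^-1)) qs)/= => /(_ isT).
  by move: hn; move: (n.+1%:R^-1) => v; lra.
have dec : {homo A : n m / (n <= m)%N >-> (m <= n)%O}.
  move=> n m nm; apply/subsetPset => w /allP H1.
  apply/allP => _ /mapP[q qs ->] /=.
  have := H1 (q.1, q.2 + m.+1%:R^-1) (map_f (fun q : I * R => (q.1, q.2 + m.+1%:R^-1)) qs).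
  by move=> /= h; rewrite (le_trans h)// lerD2l lef_pV2 ?posrE ?ltr0n// ler_nat.
have := @nonincreasing_cvg_mu _ _ _ P2 A _ mA _ dec.
rewrite capA => /(_ _ (rv_orthant Y s)) cvgA.
rewrite -lee_fin -!prbE; [|exact: rv_orthant..].
have A0 : (P2 (A 0%N) < +oo)%E.
  by rewrite (le_lt_trans (probability_le1 P2 (mA 0%N)))// ltry.
apply: (@cvge_ge _ _ _ _ _ _ _ _ (cvgA A0)).
apply: nearW => n /=; rewrite !prbE//; last exact: rv_orthant.
by rewrite lee_fin; apply: step; rewrite invr_gt0.
Qed.

End InfiniteVectors.

(** Orthants form a generating pi-system, and their indicators are limits of
    bounded continuous functions. *)
Lemma vector_law_unique (R : realType) (I : countType)
    (d1 : measure_display) (Om1 : measurableType d1) (P1 : probability Om1 R)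
    (X : {RV P1 >-> borel {ptws I -> R}})
    (d2 : measure_display) (Om2 : measurableType d2) (P2 : probability Om2 R)
    (Y : {RV P2 >-> borel {ptws I -> R}}) :
  (forall f : {ptws I -> R} -> R, continuous f -> (exists M, forall g, `|f g| <= M) ->
     \int[P1]_w f (X w) = \int[P2]_w f (Y w)) ->
  eq_dist P1 X P2 Y.
Proof.
move=> H B mB.
apply: (@measure_unique _ R (borel {ptws I -> R}) (@orthants R I) (fun=> setT)
  _ _ _ _ (distribution P1 X) (distribution P2 Y) _ _ B mB).
- exact: measurable_orthants.
- move=> _ _ [s ->] [t ->]; exists (s ++ t); apply/seteqP; split => g; rewrite /orthant /=.
    by move=> [h1 h2]; rewrite all_cat h1 h2.
  by rewrite all_cat => /andP[].
- by move=> k; exists [::]; apply/seteqP; split.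
- by apply/seteqP; split => // g _; exists 0%N.
- move=> _ [s ->].
  have mX := rv_orthant X s; have mY := rv_orthant Y s.
  apply: (etrans (prbE P1 mX)); apply: (etrans _ (esym (prbE P2 mY))); congr EFin.
  by apply/eqP; rewrite eq_le !prb_orthant_le// => f cf bf; rewrite H.
- by move=> k; rewrite [X in (X < _)%E](@probability_setT _ _ _ (distribution P1 X)) ltry.
Qed.

(** * Random permutations with a given law *)

Section PermutationLaw.
Variables (R : realType) (k : nat) (a : 'S_k -> R).
Hypothesis a0 : forall p, 0 <= a p.
Hypothesis a1 : \sum_p a p = 1.

Lemma permutation_law : exists Pr : probability (borel 'S_k) R,
  forall p : 'S_k, prb Pr [set p] = a p.
Proof.
pose e i : 'S_k := nth 1%g (enum 'S_k) i.
pose m (i : nat) : {measure set (borel 'S_k) -> \bar R} :=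
  mscale (NngNum (a0 (e i))) (\d_(e i : borel 'S_k)).
pose mu : {measure set (borel 'S_k) -> \bar R} := msum m #|'S_k|.
have muE A : mu A = (\sum_p a p * \1_A p)%:E.
  have -> : \sum_p a p * \1_A p = \sum_(p <- enum 'S_k) a p * \1_A p by rewrite big_enum.
  rewrite -sumEFin (big_nth 1%g) -cardE big_mkord.
  by apply: eq_bigr => i _; rewrite EFinM; congr (_ * _)%E.
have muT : mu setT = 1%E.
  rewrite muE -a1; congr EFin; apply: eq_bigr => p _.
  by rewrite indicE in_setT mulr1.
pose Pr : probability (borel 'S_k) R :=
  HB.pack (Measure.sort mu) (Measure_isProbability.Build _ _ _ _ muT).
exists Pr => p; rewrite /prb [Pr _]muE /= (bigD1 p)//= big1 ?addr0.
  by rewrite indicE mem_set// mulr1.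
by move=> q qp; rewrite indicE memNset ?mulr0// => /= h; rewrite h eqxx in qp.
Qed.

End PermutationLaw.

(** * Relations between the modes of convergence *)

Lemma rcvg_eq (R : realType) (u v : nat -> R) (l l' : R) :
  u @ \oo --> l -> u =1 v -> l = l' -> v @ \oo --> l'.
Proof. by move=> h /funext <- <-. Qed.

Section OccVec.
Variable R : realType.

Lemma continuous_occ_permuton_vec : continuous (@occ_permuton_vec R : permuton R -> {ptws perms -> R}).
Proof.
move=> mu.
have FF : Filter (occ_permuton_vec x @[x --> nbhs mu]) by exact: (@fmap_filter _ _ _ _ (nbhs_filter mu)).
by apply: (proj2 (ptws_cvg _ FF)) => p; exact: (continuous_occ_permuton (p := projT2 p)).
Qed.

Lemma occ01 (k n : nat) (p : 'S_k) (s : 'S_n) : 0 <= occ R p s <= 1.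
Proof.
rewrite /occ divr_ge0//=.
have [->|c0] := eqVneq 'C(n, k) 0%N; first by rewrite invr0 mulr0.
rewrite ler_pdivrMr ?ltr0n ?lt0n// mul1r ler_nat -[X in 'C(X, _)](card_ord n) -card_draws.
by apply: subset_leq_card; apply/fintype.subsetP => I; rewrite !inE => /andP[].
Qed.

Lemma occ_permuton_rv d (Om : measurableType d) (P : probability Om R)
    (mu : {RV P >-> borel (permuton R)}) :
  exists L : {RV P >-> borel {ptws perms -> R}}, forall w, L w = occ_permuton_vec (mu w).
Proof.
have mL : measurable_fun setT (fun w => occ_permuton_vec (mu w) : borel {ptws perms -> R}).
  apply: measurable_fun_borel => O oO.
  rewrite (_ : _ @^-1` _ = mu @^-1` (@occ_permuton_vec R @^-1` O))//.
  by apply: rv_open; exact: (proj1 (continuousP _) (@continuous_occ_permuton_vec)).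
by exists (mfun_of mL).
Qed.

End OccVec.

Section Assertions.
Context (R : realType)
  (d : nat -> measure_display) (Om : forall n, measurableType (d n))
  (P : forall n, probability (Om n) R)
  (sigma : forall n, {RV (P n) >-> borel 'S_n.+1})
  (I : forall n k : nat, {RV (P n) >-> borel {set 'I_n.+1}}).

Local Notation occ_cvg k p l :=
  (\int[P n]_w occ R (k := k) p (sigma n w) @[n --> \oo] --> l).

(** The densities of the patterns in a permutation and in its permuton differ by
    a quantity that vanishes with the size in every coordinate; this passes to
    any continuous functional of the vectors by uniform continuity. *)
Lemma occ_vec_cvg (dM : measure_display) (OM : measurableType dM)
    (PM : probability OM R) (mu : {RV PM >-> borel (permuton R)})
    (L : {RV PM >-> borel {ptws perms -> R}}) :
  cvg_in_dist P (fun n => discrete_comp (@perm_permuton R n) (sigma n)) PM mu ->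
  (forall w, L w = occ_permuton_vec (mu w)) ->
  cvg_in_dist P (fun n => discrete_comp (@occ_vec R n.+1) (sigma n)) PM L.
Proof.
move=> /cvg_in_distP H LE; apply/cvg_in_distP => f cf [M fM].
have cfo : continuous (fun nu : permuton R => f (occ_permuton_vec nu)).
  by move=> nu; exact: (cvg_comp _ _ (@continuous_occ_permuton_vec R nu) (cf _)).
have := H _ cfo (ex_intro _ M (fun nu => fM _)).
rewrite (_ : \int[PM]_w f (L w) = \int[PM]_w f (occ_permuton_vec (mu w))); last first.
  by apply: eq_Rintegral => w _; rewrite LE.
move=> /cvg_near_dist h; apply/cvgrPdist_le => e e0.
have e2 : 0 < e / 2 by rewrite divr_gt0.
have [n0 hn0] := ptws_uniform (fun p : perms => 3 * ((projT1 p).+1 ^ 2)%:R) cf e2.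
have hF : \forall n \near \oo, (n0 <= n)%N by exact: nbhs_infty_ge.
apply: filterS2 hF (h _ e2) => n n0n h1.
have h2 : `|\int[P n]_w f (occ_vec R (sigma n w)) -
    \int[P n]_w f (occ_permuton_vec (perm_permuton R (sigma n w)))| <= e / 2.
  apply: Rint_dist => [||w].
  - apply: (@bmeas_finval _ _ _ _ (fun w => sigma n w : 'S_n.+1) (fun s => f (occ_vec R s))) => t.
    exact: discrete_rv_measurable.
  - apply: (@bmeas_finval _ _ _ _ (fun w => sigma n w : 'S_n.+1)
      (fun s => f (occ_permuton_vec (perm_permuton R s)))) => t.
    exact: discrete_rv_measurable.
  - apply: (hn0 n) => // [[k p]|[k p]] /=; first exact: occ01.
    by rewrite distrC; exact: occ_permuton_perm.
have := ler_distD (\int[P n]_w f (occ_permuton_vec (perm_permuton R (sigma n w))))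
  (\int[PM]_w f (occ_permuton_vec (mu w))) (\int[P n]_w f (occ_vec R (sigma n w))).
move: h1 h2; rewrite /= [in X in _ -> X -> _]distrC; lra.
Qed.

(** A coordinate is not a bounded test function, but truncating it to [0, 1]
    leaves pattern densities unchanged. *)
Lemma occ_cvg_coord (dL : measure_display) (OL : measurableType dL)
    (PL : probability OL R) (Lambda : {RV PL >-> borel {ptws perms -> R}}) (k : nat) (p : 'S_k.+1) :
  cvg_in_dist P (fun n => discrete_comp (@occ_vec R n.+1) (sigma n)) PL Lambda ->
  occ_cvg k.+1 p (\int[PL]_w clamp (Lambda w (existT _ k p))).
Proof.
move=> /cvg_in_distP H.
have cf : continuous (fun g : {ptws perms -> R} => clamp (g (existT _ k p))).
  move=> g; apply: (@continuous_comp _ _ _ (fun g : {ptws perms -> R} => g (existT _ k p)) (@clamp R)).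
    exact: ptws_proj_continuous.
  exact: continuous_clamp.
have bf : exists M, forall g : {ptws perms -> R}, `|clamp (g (existT _ k p))| <= M.
  by exists 1 => g; have /andP[h0 h1] := clamp01 (g (existT _ k p)); rewrite ger0_norm.
apply: (rcvg_eq (H _ cf bf)) => // n; apply: eq_Rintegral => w _ /=.
by rewrite clamp_id//; exact: occ01.
Qed.

Lemma occ_cvg_ge0 (k : nat) (p : 'S_k) (l : R) : occ_cvg k p l -> 0 <= l.
Proof.
move=> h; rewrite leNgt; apply/negP => l0.
have ln : 0 < - l by rewrite oppr_gt0.
have [n /=] := filter_ex (cvg_near_dist h ln).
suff : 0 <= \int[P n]_w occ R p (sigma n w) by rewrite ltr_norml; lra.
rewrite -[0](Rint_cst (P n)); apply: Rint_le => [||w].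
- exact: bmeas_cst.
- apply: (@bmeas_finval _ _ _ _ (fun w => sigma n w : 'S_n.+1) (fun s => occ R p s)) => t.
  exact: discrete_rv_measurable.
- by have /andP[] := occ01 R p (sigma n w).
Qed.

Lemma occ_expectation_cvgP (k : nat) (p : 'S_k) (l : R) :
  ('E_(P n)[fun w => occ R p (sigma n w)] @[n --> \oo] --> l%:E)%E <-> occ_cvg k p l.
Proof.
have b n : bmeas (fun w => occ R p (sigma n w)).
  apply: (@bmeas_finval _ _ _ _ (fun w => sigma n w : 'S_n.+1) (fun s => occ R p s)) => t.
  exact: discrete_rv_measurable.
rewrite (_ : (fun n => 'E_(P n)[_]%E) = EFin \o (fun n => \int[P n]_w occ R p (sigma n w))).
  by split => [/fine_cvgP[]//|h]; apply/fine_cvgP; split => //; exact: nearW.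
by apply/funext => n; rewrite /= expectationE.
Qed.

Hypothesis unifI : forall n k : nat, (k <= n.+1)%N -> uniform_subset (P n) k (I n k).
Hypothesis indepI : forall n k : nat, (k <= n.+1)%N ->
  independent_rv (P n) (sigma n) (I n k).

(** The law of the pattern of a uniform subset is given by the expected
    densities as soon as the permutation is large enough to have subsets of the
    required size. *)
Lemma random_pat_cvg (k : nat) (a : 'S_k.+1 -> R) (f : 'S_k.+1 -> R) :
  (forall p, occ_cvg k.+1 p (a p)) ->
  \int[P n]_w f (random_pat k.+1 (I n k.+1) (sigma n) w) @[n --> \oo] --> \sum_p f p * a p.
Proof.
move=> H.
have E n : (k <= n)%N -> \int[P n]_w f (random_pat k.+1 (I n k.+1) (sigma n) w) =
    \sum_p f p * \int[P n]_w occ R p (sigma n w).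
  move=> kn.
  rewrite (@Rint_finval _ _ _ (P n) _ (fun w => random_pat k.+1 (I n k.+1) (sigma n) w : 'S_k.+1) f).
    by apply: eq_bigr => p _; rewrite -(prb_random_pat (@unifI n k.+1 kn) (@indepI n k.+1 kn)).
  move=> t; exact: (discrete_rv_measurable (random_pat k.+1 (I n k.+1) (sigma n) : {RV (P n) >-> borel 'S_k.+1})).
have h : \sum_p f p * \int[P n]_w occ R p (sigma n w) @[n --> \oo] --> \sum_p f p * a p.
  by apply: rcvg_sum => p; apply: cvgM; [exact: cvg_cst|exact: H].
apply: cvg_trans h; apply: near_eq_cvg.
have hk : \forall n \near \oo, (k <= n)%N by exact: nbhs_infty_ge.
by apply: filterS hk => n kn; rewrite E.
Qed.

Lemma occ_limits_sum (k : nat) (a : 'S_k.+1 -> R) :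
  (forall p, occ_cvg k.+1 p (a p)) -> \sum_p a p = 1.
Proof.
move=> H; have := @random_pat_cvg k a (fun=> 1) H.
move=> /rcvg_cst h; rewrite (eq_bigr (fun p => 1 * a p)); last by move=> p _; rewrite mul1r.
by apply: h => n; rewrite Rint_cst.
Qed.

Lemma occ_cvg_pattern (k : nat) (a : 'S_k.+1 -> R) :
  (forall p, occ_cvg k.+1 p (a p)) ->
  exists (Pr : probability (borel 'S_k.+1) R) (rho : {RV Pr >-> borel 'S_k.+1}),
    cvg_in_dist P (fun n => random_pat k.+1 (I n k.+1) (sigma n)) Pr rho.
Proof.
move=> H.
have [Pr PrE] := permutation_law (fun p => occ_cvg_ge0 (H p)) (occ_limits_sum H).
have mid : measurable_fun setT (id : borel 'S_k.+1 -> borel 'S_k.+1) by exact: measurable_id.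
exists Pr, (mfun_of mid); apply/cvg_in_distP => f cf bf.
apply: (rcvg_eq (@random_pat_cvg k a f H)) => //.
rewrite (_ : \int[Pr]_w f (mfun_of mid w) = \int[Pr]_w f w)//.
rewrite (@Rint_finval _ _ _ Pr 'S_k.+1 (fun w => w) f).
  by apply: eq_bigr => p _; rewrite -PrE.
by move=> t; apply: sub_sigma_algebra; exact: discrete_open.
Qed.

Lemma pattern_limit_law (k : nat) (a : 'S_k.+1 -> R) (dr : measure_display)
    (Or : measurableType dr) (Pr : probability Or R) (rho : {RV Pr >-> borel 'S_k.+1}) (p : 'S_k.+1) :
  (forall p, occ_cvg k.+1 p (a p)) ->
  cvg_in_dist P (fun n => random_pat k.+1 (I n k.+1) (sigma n)) Pr rho ->
  Pr [set w | rho w = p] = (a p)%:E.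
Proof.
move=> H /cvg_in_distP Hr.
pose f (q : 'S_k.+1) : R := (q == p)%:R.
have cf : continuous f by exact: continuous_discrete.
have bf : exists M, forall s, `|f s| <= M.
  by exists 1 => s; rewrite /f; case: (s == p); rewrite ?normr1 ?normr0.
have mp : measurable [set w | rho w = p] by exact: (discrete_rv_measurable rho [set p]).
rewrite (prbE Pr mp); congr EFin.
have := rcvg_unique (@random_pat_cvg k a f H) (Hr f cf bf).
rewrite (bigD1 p)//= /f eqxx mul1r big1 ?addr0; last by move=> q /negbTE ->; rewrite mul0r.
move=> ->; rewrite -Rint_prb//; apply: eq_Rintegral => w _; rewrite indicE.
by congr (nat_of_bool _)%:R; apply/idP/eqP; rewrite inE.
Qed.

Lemma occ_vec_limit_law (dM : measure_display) (OM : measurableType dM)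
    (PM : probability OM R) (mu : {RV PM >-> borel (permuton R)})
    (dL : measure_display) (OL : measurableType dL) (PL : probability OL R)
    (Lambda : {RV PL >-> borel {ptws perms -> R}}) :
  cvg_in_dist P (fun n => discrete_comp (@perm_permuton R n) (sigma n)) PM mu ->
  cvg_in_dist P (fun n => discrete_comp (@occ_vec R n.+1) (sigma n)) PL Lambda ->
  eq_dist PL Lambda PM (fun w => occ_permuton_vec (mu w)).
Proof.
move=> Hmu HL; have [L LE] := occ_permuton_rv mu.
have HL' := occ_vec_cvg Hmu LE.
rewrite (_ : (fun w => occ_permuton_vec (mu w)) = L); last by apply/funext => w; rewrite LE.
apply: vector_law_unique => f cf bf.
by move/cvg_in_distP: HL => /(_ f cf bf) h1; move/cvg_in_distP: HL' => /(_ f cf bf); exact: rcvg_unique.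
Qed.

End Assertions.

(** Since [Lambda] has the law of a vector of pattern densities, its entries lie
    in [0, 1] almost surely. *)
Lemma expectation_clamp (R : realType) (dM : measure_display) (OM : measurableType dM)
    (PM : probability OM R) (mu : {RV PM >-> borel (permuton R)})
    (dL : measure_display) (OL : measurableType dL) (PL : probability OL R)
    (Lambda : {RV PL >-> borel {ptws perms -> R}}) (p : perms) :
  eq_dist PL Lambda PM (fun w => occ_permuton_vec (mu w)) ->
  'E_PL[fun w => Lambda w p]%E = (\int[PL]_w clamp (Lambda w p))%:E.
Proof.
move=> H.
have oP (A : set R) : open A -> open ((fun g : {ptws perms -> R} => g p) @^-1` A).
  exact: (proj1 (continuousP _) (@ptws_proj_continuous _ _ p)).
have mp : measurable_fun setT (fun w => Lambda w p : R).
  apply: (measurability _ (RGenOInfty.measurableE R)).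
  move=> _ [_ [x ->] <-]; rewrite setTI.
  rewrite (_ : _ @^-1` _ = Lambda @^-1` ((fun g : {ptws perms -> R} => g p) @^-1` `]x, +oo[%classic))//.
  by apply: rv_open; exact: oP.
have bc : bmeas (fun w => clamp (Lambda w p)).
  split; first by apply: measurableT_comp => //; exact: measurable_clamp.
  by exists 1 => w; have /andP[h0 h1] := clamp01 (Lambda w p); rewrite ger0_norm.
rewrite -expectationE// unlock; apply: ae_eq_integral => //.
- exact/measurable_EFinP.
- exact/measurable_EFinP/(proj1 bc).
pose B : set (borel {ptws perms -> R}) := (fun g : {ptws perms -> R} => g p) @^-1` (~` `[0%R, 1%R]%classic).
have oB : open (B : set {ptws perms -> R}).
  by apply: oP; rewrite openC; exact: interval_closed.
have mB : measurable B by exact: sub_sigma_algebra.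
exists (Lambda @^-1` B); split.
- exact: rv_open.
- apply: (etrans (H B mB)); rewrite /pushforward.
  rewrite (_ : _ @^-1` B = set0) ?measure0//; apply/seteqP; split => // w /=.
  by rewrite /B /= in_itv/=; apply; exact: (occ_permuton01 (projT2 p) (mu w)).
- move=> w /= h; apply: contrapT => hB; apply: h => _; congr EFin; rewrite clamp_id//.
  by move: hB; rewrite /B /= in_itv/= => /contrapT.
Qed.

(** * Equivalence of the modes of convergence *)

Theorem theorem2p5 (R : realType)
  (d : nat -> measure_display) (Om : forall n, measurableType (d n))
  (P : forall n, probability (Om n) R)
  (sigma : forall n, {RV (P n) >-> borel 'S_n.+1})
  (I : forall n k : nat, {RV (P n) >-> borel {set 'I_n.+1}})
  (unifI : forall n k : nat, (k <= n.+1)%N -> uniform_subset (P n) k (I n k))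
  (indepI : forall n k : nat, (k <= n.+1)%N ->
     independent_rv (P n) (sigma n) (I n k)) :
  [<->
    exists (dM : measure_display) (OM : measurableType dM)
      (PM : probability OM R) (mu : {RV PM >-> borel (permuton R)}),
      cvg_in_dist P (fun n => discrete_comp (@perm_permuton R n) (sigma n)) PM mu;
    exists (dL : measure_display) (OL : measurableType dL)
      (PL : probability OL R) (Lambda : {RV PL >-> borel {ptws perms -> R}}),
      cvg_in_dist P (fun n => discrete_comp (@occ_vec R n.+1) (sigma n)) PL Lambda;
    forall p : perms, exists2 Delta : R, 0 <= Delta &
      ('E_(P n)[fun w => occ R (projT2 p) (sigma n w)] @[n --> \oo]
        --> Delta%:E)%E;
    forall k : nat, exists (dr : measure_display) (Or : measurableType dr)
      (Pr : probability Or R) (rho : {RV Pr >-> borel 'S_k.+1}),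
      cvg_in_dist P (fun n => random_pat k.+1 (I n k.+1) (sigma n)) Pr rho ]
  /\
  (forall
    (dM : measure_display) (OM : measurableType dM) (PM : probability OM R)
    (mu : {RV PM >-> borel (permuton R)})
    (dL : measure_display) (OL : measurableType dL) (PL : probability OL R)
    (Lambda : {RV PL >-> borel {ptws perms -> R}})
    (Delta : perms -> R)
    (dr : nat -> measure_display) (Or : forall k, measurableType (dr k))
    (Pr : forall k, probability (Or k) R)
    (rho : forall k, {RV (Pr k) >-> borel 'S_k.+1}),
    cvg_in_dist P (fun n => discrete_comp (@perm_permuton R n) (sigma n)) PM mu ->
    cvg_in_dist P (fun n => discrete_comp (@occ_vec R n.+1) (sigma n)) PL Lambda ->
    (forall p : perms, 0 <= Delta p /\
      ('E_(P n)[fun w => occ R (projT2 p) (sigma n w)] @[n --> \oo]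
        --> (Delta p)%:E)%E) ->
    (forall k : nat,
      cvg_in_dist P (fun n => random_pat k.+1 (I n k.+1) (sigma n)) (Pr k) (rho k)) ->
    eq_dist PL Lambda PM (fun w => occ_permuton_vec (mu w)) /\
    forall (k : nat) (p : 'S_k.+1),
      [/\ Pr k [set w | rho k w = p] = (Delta (existT _ k p))%:E,
          (Delta (existT _ k p))%:E = 'E_PL[fun w => Lambda w (existT _ k p)]%E,
          'E_PL[fun w => Lambda w (existT _ k p)]%E
            = 'E_PM[fun w => occ_permuton p (mu w)]%E
        & forall m : 'I_k.+1 -> {RV PM >-> (R * R)%type},
            cond_iid PM mu m ->
            'E_PM[fun w => occ_permuton p (mu w)]%E
              = PM [set w | perm_of_points [tuple m i w | i < k.+1] = p]]).
Proof.
split; last first.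
  move=> dM OM PM mu dL OL PL Lambda Delta dr Or Pr rho Hmu HL HD Hr.
  have law := occ_vec_limit_law Hmu HL; split=> // k p.
  have oc q := (occ_expectation_cvgP sigma _ _).1 (proj2 (HD (existT _ k q))).
  have EL := expectation_clamp (existT _ k p) law.
  have ED := rcvg_unique (oc p) (occ_cvg_coord (p := p) HL).
  have [L LE] := occ_permuton_rv mu.
  have EM := rcvg_unique (occ_cvg_coord (p := p) HL) (occ_cvg_coord (p := p) (occ_vec_cvg Hmu LE)).
  have bo : bmeas (fun w => occ_permuton p (mu w)).
    by apply: (bmeas_permuton_rv mu); exact: continuous_occ_permuton.
  have EO : \int[PM]_w clamp (L w (existT _ k p)) = \int[PM]_w occ_permuton p (mu w).
    apply: eq_Rintegral => w _; rewrite LE /occ_permuton_vec /= clamp_id//.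
    exact: occ_permuton01.
  split.
  - apply: (pattern_limit_law unifI indepI p oc (Hr k)).
  - by rewrite EL ED.
  - by rewrite EL EM EO expectationE.
  - move=> m iid; rewrite expectationE// (cond_iid_occ p iid) -prbE//.
    exact: measurable_perm_of_points.
tfae.
- move=> [dM [OM [PM [mu Hmu]]]]; have [L LE] := occ_permuton_rv mu.
  by exists dM, OM, PM, L; exact: occ_vec_cvg Hmu LE.
- move=> [dL [OL [PL [Lambda HL]]]] [k p].
  have h := occ_cvg_coord (p := p) HL.
  by exists (\int[PL]_w clamp (Lambda w (existT _ k p))); [exact: occ_cvg_ge0 h|exact/occ_expectation_cvgP].
- move=> H k.
  have /choice[a aP] : forall p : 'S_k.+1, exists l : R,
      \int[P n]_w occ R p (sigma n w) @[n --> \oo] --> l.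
    by move=> p; have [l _ /occ_expectation_cvgP h] := H (existT _ k p); exists l.
  have [Pr [rho h]] := occ_cvg_pattern unifI indepI aP.
  by exists _, (borel 'S_k.+1), Pr, rho.
- move=> H; have [mu h] := patterns_to_permuton unifI indepI H.
  by exists _, (measurableTypeR R), (unif R), mu.
Qed.
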